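(* If $\mathcal{I}\in\mathfrak{L}_\alpha(\lambda)$ satisfies the Lyapunov stability condition and, for some constant $K_0$, the growth condition $$x\cdot b(x)\,\vee\,|x|\,k(x,z)\le K_0(1+|x|^2)\qquad\forall x,z\in\mathbb{R}^d,$$ then the associated Markov process is positive recurrent.
   Context: Fix $\alpha\in(1,2)$ and a nondecreasing function $\lambda:[0,\infty)\to(0,\infty)$; for a bounded domain $D$ put $\lambda_D=\inf\{\lambda(R):D\subset B_{R+1}\}$, where $B_R$ is the open ball of radius $R$ centered at $0$. $\mathfrak{L}_\alpha(\lambda)$ is the class of operators $$\mathcal{I}f(x)=b(x)\cdot\nabla f(x)+\int_{\mathbb{R}^d}\bigl(f(x+z)-f(x)-\mathbf{1}_{\{|z|\le1\}}\nabla f(x)\cdot z\bigr)\frac{k(x,z)}{|z|^{d+\alpha}}\,dz,$$ with $b:\mathbb{R}^d\to\mathbb{R}^d$, $k:\mathbb{R}^d\times\mathbb{R}^d\to(0,\infty)$ Borel measurable, such that for every bounded domain $D$: $|b(x)|\le\lambda_D$ and $\lambda_D^{-1}\le k(x,z)\le\lambda_D$ for all $x\in D$, $z\in\mathbb{R}^d$. Lyapunov stability condition: there exist $\mathcal{V}\in C^2(\mathbb{R}^d)$ with $\inf_{\mathbb{R}^d}\mathcal{V}>-\infty$, a compact set $\mathcal{K}\subset\mathbb{R}^d$ and $\varepsilon>0$ such that $\mathcal{I}\mathcal{V}(x)\le-\varepsilon$ for all $x\in\mathcal{K}^c$. Standing assumption: for every initial distribution $\nu_0$ there is a strong Markov process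 $(X,\mathbb{P}_{\nu_0})$ with càdlàg paths associated with $\mathcal{I}$, i.e., $X_0\sim\nu_0$ and $f(X_t)-f(X_0)-\int_0^t\mathcal{I}f(X_s)\,ds$ is a martingale (with respect to the right-continuous filtration generated by $X$) for every $f\in C_b^2(\mathbb{R}^d)$; $\mathbb{P}_x,\mathbb{E}_x$ correspond to $\nu_0=\delta_x$. $\tau(A)=\inf\{t\ge0:X_t\notin A\}$. The process is positive recurrent if for any compact set $G$ with positive Lebesgue measure, $\mathbb{E}_x[\tau(G^c)]<\infty$ for every $x\in\mathbb{R}^d$. *)

(* Defs.v *)
From HB Require Import structures.
From mathcomp Require Import all_boot all_order all_algebra.
From mathcomp Require Import all_classical all_reals all_analysis.
From mathcomp Require Import measurable_realfun.

Set Implicit Arguments.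
Unset Strict Implicit.
Unset Printing Implicit Defensive.

Import Order.TTheory GRing.Theory Num.Theory.
Import numFieldNormedType.Exports.

Local Open Scope classical_set_scope.
Local Open Scope ring_scope.

(* The library equips ['M[R]_(m, n)] with a topology but not with a sigma-algebra:
   we take the Borel one. *)
Definition borel_mx_display : measure_display.
Proof. exact: default_measure_display. Qed.

HB.instance Definition _ (R : realType) (m n : nat) :=
  @isMeasurable.Build borel_mx_display 'M[R]_(m, n)
    <<s @open 'M[R]_(m, n) >> (@sigma_algebra0 _ setT _) (@sigma_algebraC _ _)
    (@sigma_algebra_bigcup _ setT _).

Section borel_rV.
Context {R : realType} (n : nat).

Lemma measurable_coord (i : 'I_n) :
  measurable_fun [set: 'rV[R]_n] (fun v => v ord0 i).
Proof.
apply: (measurability _ (RGenOpens.measurableE R)).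
move=> _ [_ [a [b ->] <-]]; rewrite setTI.
apply: sub_sigma_algebra.
apply: open_comp; last exact: interval_open.
by move=> v _; exact: coord_continuous.
Qed.

Lemma open_rV_bigcup (U : set 'rV[R]_n) : open U ->
  U = \bigcup_(q in [set q : 'rV[rat]_n * nat |
        ball (map_mx ratr q.1 : 'rV[R]_n) q.2.+1%:R^-1 `<=` U])
      ball (map_mx ratr q.1 : 'rV[R]_n) q.2.+1%:R^-1.
Proof.
move=> oU; apply/seteqP; split=> [x Ux|x [q /= + qx]]; last exact.
have /nbhs_ballP[e /= e0 eU] : nbhs x U by exact: open_nbhs_nbhs.
have [k ke] : exists k : nat, (k.+1%:R^-1 < e / 2 :> R).
  have /ltr_add_invr[k] : 0 < e / 2 by rewrite divr_gt0.
  by rewrite add0r; exists k.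
have [q qx] : exists q : 'rV[rat]_n, forall i,
    `|x ord0 i - ratr (q ord0 i)| < k.+1%:R^-1.
  have H i : exists r : rat, `|x ord0 i - ratr r| < k.+1%:R^-1.
    have [|r] := @rat_in_itvoo R (x ord0 i - k.+1%:R^-1) (x ord0 i + k.+1%:R^-1).
      by rewrite ltrBlDr -addrA ltrDl addr_gt0.
    rewrite in_itv/= => /andP[r1 r2]; exists r.
    by rewrite distrC ltr_distl r1.
  exists (\row_i sval (cid (H i))) => i; rewrite mxE.
  by case: (cid _).
have bqx : ball (map_mx ratr q : 'rV[R]_n) k.+1%:R^-1 x.
  split=> // i j; rewrite (ord1 i) mxE /ball/= distrC.
  exact: qx.
exists (q, k) => //= y qy; apply: eU.
apply: (@le_ball _ _ _ (k.+1%:R^-1 + k.+1%:R^-1)).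
  by rewrite (splitr e) ltW// ltrD.
by apply: ball_triangle qy; exact: ball_sym.
Qed.

Lemma measurable_fun_rV d (T : measurableType d) (f : T -> 'rV[R]_n) :
  (forall i, measurable_fun setT (fun t => f t ord0 i)) ->
  measurable_fun setT f.
Proof.
move=> mf; apply: (@measurability _ _ _ _ _ _ (@open 'rV[R]_n)) => //.
move=> _ [U oU <-]; rewrite setTI (open_rV_bigcup oU) preimage_bigcup.
rewrite bigcup_mkcond; apply: countable_bigcupT_measurable => // q.
case: ifPn => // _.
have -> : f @^-1` ball (map_mx ratr q.1 : 'rV[R]_n) q.2.+1%:R^-1 =
    \bigcap_(i in [set: 'I_n])
      (fun t => f t ord0 i) @^-1` ball (ratr (q.1 ord0 i) : R) q.2.+1%:R^-1.
  apply/seteqP; split=> [t [_ bt] i _|t bt].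
    by have := bt ord0 i; rewrite mxE.
  by split=> // i j; rewrite (ord1 i) mxE; exact: bt.
apply: fin_bigcap_measurable => // i _.
rewrite -[X in measurable X]setTI; apply: mf => //.
by apply: open_measurable; exact: ball_open.
Qed.

End borel_rV.

Section lebesgue_rV.
(* Lebesgue measure on the Borel sets of R^n, by induction on n:
   R^(n+1) is identified with R * R^n through [rV_cons]. *)
Context {R : realType}.

Definition rV_cons (n : nat) (p : measurableTypeR R * 'rV[R]_n) : 'rV[R]_n.+1 :=
  \row_i oapp (p.2 ord0) p.1 (unlift ord0 i).

Definition rV_uncons (n : nat) (v : 'rV[R]_n.+1) :
    measurableTypeR R * 'rV[R]_n :=
  (v ord0 ord0, \row_i v ord0 (lift ord0 i)).

Lemma rV_consK n : cancel (@rV_cons n) (@rV_uncons n).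
Proof.
move=> [t v]; rewrite /rV_uncons /rV_cons mxE unlift_none/=; congr pair.
by apply/rowP => i; rewrite !mxE liftK.
Qed.

Lemma measurable_rV_cons n : measurable_fun setT (@rV_cons n).
Proof.
apply: measurable_fun_rV => i.
under eq_fun do rewrite mxE.
case: unliftP => [j _|_] /=; last exact: measurable_fst.
exact: (measurableT_comp (@measurable_coord R n j) measurable_snd).
Qed.

Lemma measurable_rV_uncons n : measurable_fun setT (@rV_uncons n).
Proof.
apply: measurable_fun_pair; first exact: measurable_coord.
apply: measurable_fun_rV => i.
under eq_fun do rewrite mxE.
exact: measurable_coord.
Qed.

Section step.
Variables (n : nat) (m : {sigma_finite_measure set 'rV[R]_n -> \bar R}).

Definition lebesgue_rV_step : set 'rV[R]_n.+1 -> \bar R :=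
  pushforward (lebesgue_measure \x m)%E (@rV_cons n).

Let step0 : lebesgue_rV_step set0 = 0%E.
Proof. by rewrite /lebesgue_rV_step /pushforward preimage_set0 measure0. Qed.

Let step_ge0 A : (0 <= lebesgue_rV_step A)%E.
Proof. by rewrite /lebesgue_rV_step /pushforward measure_ge0. Qed.

Let mstep A : measurable A -> measurable (@rV_cons n @^-1` A).
Proof.
by move=> mA; rewrite -[X in measurable X]setTI; exact: measurable_rV_cons.
Qed.

Let step_sigma_additive : semi_sigma_additive lebesgue_rV_step.
Proof.
move=> F mF tF mUF; rewrite /lebesgue_rV_step /pushforward preimage_bigcup.
apply: measure_semi_sigma_additive.
- by move=> k; exact: mstep.
- apply/trivIsetP => i j _ _ ij; rewrite -preimage_setI.
  by move/trivIsetP : tF => /(_ _ _ _ _ ij) ->//; rewrite preimage_set0.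
- by rewrite -preimage_bigcup; exact: mstep.
Qed.

HB.instance Definition _ := isMeasure.Build _ _ _ lebesgue_rV_step
  step0 step_ge0 step_sigma_additive.

Let step_sigma_finite : sigma_finite setT lebesgue_rV_step.
Proof.
have /sigma_finiteP[F [TF ndF Foo]] := sigma_finiteT (@lebesgue_measure R).
have /sigma_finiteP[G [TG ndG Goo]] := sigma_finiteT m.
exists (fun k => @rV_uncons n @^-1` (F k `*` G k)).
  rewrite -preimage_bigcup (_ : \bigcup_k (F k `*` G k) = setT).
    by rewrite preimage_setT.
  apply/seteqP; split=> // -[x y] _.
  have [i _ Fix] : (\bigcup_i F i) x by rewrite -TF.
  have [j _ Gjy] : (\bigcup_i G i) y by rewrite -TG.
  exists (maxn i j) => //; split => /=.
  - by move: x Fix; exact/subsetPset/ndF/leq_maxl.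
  - by move: y Gjy; exact/subsetPset/ndG/leq_maxr.
move=> k; have [mFk Fk] := Foo k; have [mGk Gk] := Goo k; split.
  rewrite -[X in measurable X]setTI; apply: measurable_rV_uncons => //.
  exact: measurableX.
rewrite /lebesgue_rV_step /pushforward -comp_preimage.
rewrite (_ : _ \o _ = id); last by apply/funext => p /=; rewrite rV_consK.
by rewrite preimage_id product_measure1E// lte_mul_pinfty// ge0_fin_numE.
Qed.

HB.instance Definition _ := Measure_isSigmaFinite.Build _ _ _ lebesgue_rV_step
  step_sigma_finite.

End step.

Fixpoint lebesgue_rV (n : nat) : {sigma_finite_measure set 'rV[R]_n -> \bar R} :=
  match n with
  | 0 => dirac (0 : 'rV[R]_0)
  | n'.+1 => lebesgue_rV_step (lebesgue_rV n')
  end.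

Lemma lebesgue_rV_box n (a b : 'rV[R]_n) : (forall i, a ord0 i <= b ord0 i) ->
  lebesgue_rV n [set v | forall i, v ord0 i \in `[a ord0 i, b ord0 i]] =
  (\prod_i (b ord0 i - a ord0 i))%:E.
Proof.
elim: n => [|n IH] in a b *; move=> ab.
  rewrite big_ord0 /= diracE mem_set//; by case.
rewrite big_ord_recl EFinM -[X in (_ * X%:E)%E]/(\prod_i _).
set a' : 'rV[R]_n := \row_i a ord0 (lift ord0 i).
set b' : 'rV[R]_n := \row_i b ord0 (lift ord0 i).
rewrite /= /lebesgue_rV_step /pushforward.
rewrite (_ : _ @^-1` _ = `[a ord0 ord0, b ord0 ord0] `*`
    [set v : 'rV[R]_n | forall i, v ord0 i \in `[a' ord0 i, b' ord0 i]]); last first.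
  apply/seteqP; split=> [[t v] /= H|[t v] [/= t0 H] i].
    split; first by have := H ord0; rewrite mxE unlift_none.
    by move=> i; have := H (lift ord0 i); rewrite !mxE liftK.
  rewrite mxE; case: unliftP => [j ->|->] //=.
  by have := H j; rewrite !mxE.
rewrite product_measure1E//=; last first.
  rewrite (_ : mkset _ = \bigcap_(i in [set: 'I_n])
      ([set: 'rV[R]_n] `&` (fun v => v ord0 i) @^-1` `[a' ord0 i, b' ord0 i])).
    by apply: fin_bigcap_measurable => // i _; exact: measurable_coord.
  by apply/seteqP; split=> [v H i _|v H i]; [split=> //; exact: H|case: (H i)].
rewrite IH; last by move=> i; rewrite !mxE.
rewrite lebesgue_measure_itv/= lte_fin.
congr (_ * _)%E; last by congr EFin; apply: eq_bigr => i _; rewrite !mxE.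
by have := ab ord0; rewrite le_eqVlt => /predU1P[->|->//]; rewrite ltxx subrr.
Qed.

End lebesgue_rV.

Section euclidean.
Context {R : realType} {d : nat}.
Implicit Types (x y : 'rV[R]_d) (f : 'rV[R]_d -> R).

Definition dotv x y : R := \sum_i x ord0 i * y ord0 i.

(* The library norm [`|x|] on row vectors is the sup norm. *)
Definition enorm x : R := Num.sqrt (dotv x x).

Definition eball (r : R) : set 'rV[R]_d := [set x | enorm x < r].

Definition partial (i : 'I_d) f : 'rV[R]_d -> R := 'D_(delta_mx ord0 i) f.

Definition grad f x : 'rV[R]_d := \row_i partial i f x.

Fixpoint Ck (k : nat) f : Prop :=
  continuous f /\
  match k with
  | 0 => True
  | k'.+1 => forall i,
      (forall x, derivable f x (delta_mx ord0 i)) /\ Ck k' (partial i f)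
  end.

(* [f] and all its partial derivatives up to order [k] are continuous and
   bounded. *)
Fixpoint Ckb (k : nat) f : Prop :=
  [/\ continuous f, exists M : R, forall x, `|f x| <= M &
  match k with
  | 0 => True
  | k'.+1 => forall i,
      (forall x, derivable f x (delta_mx ord0 i)) /\ Ckb k' (partial i f)
  end].

Definition bounded_domain (D : set 'rV[R]_d) : Prop :=
  [/\ D !=set0, open D, connected D & bounded_set D].

End euclidean.

Section operators.
Context {R : realType} {d : nat}.
Variable alpha : R.
Implicit Types (b : 'rV[R]_d -> 'rV[R]_d) (k : 'rV[R]_d -> 'rV[R]_d -> R).

(* Extended real valued: for [f] of class C^2 bounded below, as in the Lyapunov
   condition, the negative part of the integrand is integrable whereas its
   positive part need not be, and then the value is [+oo]. For [f] in C_b^2 the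
   value is finite. *)
Definition stable_op b k (f : 'rV[R]_d -> R) (x : 'rV[R]_d) : \bar R :=
  ((dotv (b x) (grad f x))%:E +
   \int[lebesgue_rV d]_z
     ((f (x + z) - f x - \1_[set z | (enorm z <= 1)%R] z * dotv (grad f x) z)
      * (k x z / enorm z `^ (d%:R + alpha)))%:E)%E.

(* The function [lam] lives on [0, +oo[, hence the constraint [0 <= r]. *)
Definition lam_dom (lam : R -> R) (D : set 'rV[R]_d) : R :=
  inf [set lam r | r in [set r | 0 <= r /\ D `<=` eball (r + 1)]].

Record stable_class (lam : R -> R) b k : Prop := StableClass {
  stable_class_mb : measurable_fun setT b ;
  stable_class_mk :
    measurable_fun setT (fun p : 'rV[R]_d * 'rV[R]_d => k p.1 p.2) ;
  stable_class_k_gt0 : forall x z, 0 < k x z ;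
  stable_class_b_le : forall D, bounded_domain D ->
    forall x, D x -> enorm (b x) <= lam_dom lam D ;
  stable_class_k_bounds : forall D, bounded_domain D ->
    forall x z, D x -> (lam_dom lam D)^-1 <= k x z <= lam_dom lam D
}.

Definition lyapunov_stable b k : Prop :=
  exists V : 'rV[R]_d -> R, [/\ Ck 2 V, has_lbound (range V) &
    exists (K : set 'rV[R]_d) (eps : R), [/\ compact K, 0 < eps &
      forall x, ~ K x -> (stable_op b k V x <= (- eps)%:E)%E]].

End operators.

Section processes.
Context {R : realType} {d : nat} {dO : measure_display} {Omega : measurableType dO}.
Variable X : R -> Omega -> 'rV[R]_d.

Definition natural_filtration (t : R) : set (set Omega) :=
  <<s \bigcup_(s in `[0, t]) preimage_set_system setT (X s) measurable >>.

Definition rc_filtration (t : R) : set (set Omega) :=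
  \bigcap_(s in `]t, +oo[) natural_filtration s.

(* The third clause is the definition of E[M_t | F_s] = M_s. *)
Definition is_martingale (Q : probability Omega R) (F : R -> set (set Omega))
    (M : R -> Omega -> R) : Prop :=
  [/\ forall t, 0 <= t -> forall B : set R, measurable B -> F t (M t @^-1` B),
      forall t, 0 <= t -> Q.-integrable setT (EFin \o M t) &
      forall s t A, 0 <= s -> s <= t -> F s A ->
        (\int[Q]_(w in A) (M t w)%:E = \int[Q]_(w in A) (M s w)%:E)%E].

Definition stopping_time (T : Omega -> \bar R) : Prop :=
  (forall w, 0 <= T w)%E /\
  forall t, 0 <= t -> rc_filtration t [set w | (T w <= t%:E)%E].

Definition stopped_events (T : Omega -> \bar R) : set (set Omega) :=
  [set A | measurable A /\
    forall t, 0 <= t -> rc_filtration t (A `&` [set w | (T w <= t%:E)%E])].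

Definition cadlag_paths : Prop :=
  forall w, (forall t, 0 <= t -> X s w @[s --> t^'+] --> X t w) /\
    (forall t, 0 < t -> cvg (X s w @[s --> t^'-])).

(* The second clause says that on {T < oo}, for every initial distribution nu,
   P_nu(X_(T+t) \in B | F_T) = p_t(X_T, B) where p_t(x, B) = P_x(X_t \in B). *)
Definition strong_Markov
    (P : probability 'rV[R]_d R -> probability Omega R) : Prop :=
  (forall t (B : set 'rV[R]_d), 0 <= t -> measurable B ->
    measurable_fun setT (fun x : 'rV[R]_d => P (dirac x) (X t @^-1` B))) /\
  (forall nu T, stopping_time T -> forall A, stopped_events T A ->
    forall t (B : set 'rV[R]_d), 0 <= t -> measurable B ->
    let A' := A `&` [set w | (T w < +oo)%E] in
    (P nu (A' `&` [set w | B (X (fine (T w) + t)%R w)]) =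
     \int[P nu]_(w in A') P (dirac (X (fine (T w)) w)) (X t @^-1` B))%E).

(* [(X, P nu)], for [nu] ranging over the initial distributions, is a strong
   Markov process with cadlag paths associated with the operator [I]. *)
Record associated_process (I : ('rV[R]_d -> R) -> 'rV[R]_d -> \bar R)
    (P : probability 'rV[R]_d R -> probability Omega R) : Prop :=
  AssociatedProcess {
  assoc_measurable : forall t, 0 <= t -> measurable_fun setT (X t) ;
  assoc_cadlag : cadlag_paths ;
  assoc_strong_Markov : strong_Markov P ;
  assoc_initial : forall nu (B : set 'rV[R]_d), measurable B ->
    P nu (X 0 @^-1` B) = nu B ;
  assoc_martingale : forall nu f, Ckb 2 f ->
    is_martingale (P nu) rc_filtration (fun t w =>
      f (X t w) - f (X 0 w) -
      \int[lebesgue_measure]_(s in `[0, t]) fine (I f (X s w)))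
}.

Definition exit_time (A : set 'rV[R]_d) (w : Omega) : \bar R :=
  ereal_inf [set t%:E | t in [set t | 0 <= t /\ ~ A (X t w)]].

(* Hitting times of compact sets are measurable for the completion of [P nu]
   only (debut theorem). The library integral of a nonnegative function is the
   supremum of the integrals of the measurable simple functions below it, which
   for such a function is its integral with respect to the completion. *)
Definition positive_recurrent
    (P : probability 'rV[R]_d R -> probability Omega R) : Prop :=
  forall G : set 'rV[R]_d, compact G -> (0 < lebesgue_rV d G)%E ->
  forall x : 'rV[R]_d, (\int[P (dirac x)]_w exit_time (~` G) w < +oo)%E.

End processes.

(* Main.v *)
Require Import Defs.
From HB Require Import structures.
From mathcomp Require Import finmap.
From mathcomp Require Import all_boot all_order all_algebra.
From mathcomp Require Import all_classical all_reals all_analysis.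
From mathcomp Require Import measurable_realfun.
From mathcomp Require Import ring lra.

Set Implicit Arguments.
Unset Strict Implicit.
Unset Printing Implicit Defensive.

Import Order.TTheory GRing.Theory Num.Theory.
Import numFieldNormedType.Exports.

Local Open Scope classical_set_scope.
Local Open Scope ring_scope.

(* The Lyapunov function V only controls the drift outside a compact set K, but
   it is integrable against the tails of the kernel, so that I V is bounded above
   on K as well. On the other hand the process jumps from any point of K into G
   at a rate bounded below, because k is bounded below and G has positive
   measure. Let g_n be smooth functions decreasing to the indicator of G. For m
   large, W_n = V - m g_n satisfies I W_n <= - eps outside the support of g_n,
   with m and eps independent of n, and optional stopping bounds the expected
   hitting time sigma_n of the n-th neighbourhood of G by (V(x) + m) / eps. The
   times sigma_n increase to some sigma, and X(sigma) belongs to G almost surely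
   by quasi-left-continuity, so that the hitting time of G is at most sigma.
   V is cut off outside large balls: the paths are cadlag on [0, +oo[, hence
   leave every ball as late as desired, and no explosion can occur. *)

(** * Functions of class C^k *)

Section calculus.
Context {R : realType} {d : nat}.
Implicit Types (f g : 'rV[R]_d -> R) (x z : 'rV[R]_d).

(** The integrability of [V] is extracted from the Lyapunov inequality itself: an upper bound on
    [I V] at a single point outside [K] forces the positive part of the jump integral to be finite
    there. Kernels centred at two points are comparable at distance more than 1 from both, so one
    finite tail integral bounds all those centred in a given ball. The indicator of G is not a test
    function and G may have empty interior; hence the shrinking open neighbourhoods, with estimates
    uniform in n. Openness has a second benefit: right-continuity of the paths alone puts {T < s} in
    F_s for their hitting times T. With C a bound for [I] applied to cutoffs of [V] on a ball
    containing [K], and c a lower bound for the jump rate from that ball into G, the choice m = (C +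
    eps) / c turns the drift on [K] into C - m c = - eps. The function W changes with n and with the
    cutoff radius, but the bounds - m <= W <= V do not, so the estimate of the expected time
    survives a simultaneous passage to the limit in the neighbourhood, the ball and the time
    horizon. *)

Definition pospow (j : nat) (u : R) : R := Num.max u 0 ^+ j.

Lemma pospow_continuous j : continuous (pospow j).
Proof.
move=> u; apply: (@continuous_comp _ _ _ (fun v : R => Num.max v 0) (fun v => v ^+ j)).
  by apply: continuous_max => //; exact: cvg_cst.
exact: exprn_continuous.
Qed.

(** The two smooth pieces meet only at 0, where the difference quotient is at most [|h| ^+ j.+1]; it
    tends to 0 because the exponent of the power is at least 2. *)
Lemma pospow_is_derive j u :
  is_derive u (1 : R) (pospow j.+2) (j.+2%:R * pospow j.+1 u).
Proof.
have [u0|u0|->] := ltgtP u 0.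
- apply: (@near_eq_is_derive _ _ _ (cst 0)).
    near=> v; rewrite /pospow max_r ?expr0n//.
    by apply/ltW; near: v; exact: lt_nbhsl.
  rewrite /pospow max_r ?expr0n ?mulr0//; last exact: ltW.
  exact: is_derive_cst.
- apply: (@near_eq_is_derive _ _ _ (fun v : R => v ^+ j.+2)).
    near=> v; rewrite /pospow max_l//.
    by apply/ltW; near: v; exact: lt_nbhsr.
  have -> : (fun v : R => v ^+ j.+2) = (id : R -> R) ^+ j.+2.
    by apply/funext => v; rewrite fctE.
  apply: is_derive_eq.
  rewrite /pospow max_l ?(ltW u0)//= /GRing.scale/= mulr1.
  by rewrite -mulr_natl.
- rewrite /pospow maxxx expr0n/= mulr0.
  suff H : h^-1 *: (pospow j.+2 (h *: 1 + 0) - pospow j.+2 0) @[h --> 0^'] --> (0 : R).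
    by apply: DeriveDef; [apply/cvg_ex; exists 0; exact: H | exact: cvg_lim H].
  apply: (@squeeze_cvgr _ _ _ _ (fun=> 0) (fun h : R => `|h| ^+ j.+1)).
  - near=> h; rewrite /pospow maxxx expr0n/= subr0 addr0 scaler1 /GRing.scale/=.
    have h0 : h != 0 by near: h; exact: nbhs_dnbhs_neq.
    have [hlt|hgt|h00] := ltgtP h 0.
    + by rewrite expr0n mulr0 lexx exprn_ge0.
    + by rewrite gtr0_norm// exprS mulKf// lexx exprn_ge0// ltW.
    + by rewrite h00 eqxx in h0.
  - exact: cvg_cst.
  - have : `|h| ^+ j.+1 @[h --> (0 : R)] --> `|0 : R| ^+ j.+1.
      apply: (@continuous_comp _ _ _ (fun v : R => `|v|) (fun v => v ^+ j.+1)).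
        exact: norm_continuous.
      exact: exprn_continuous.
    by rewrite normr0 expr0n/= => /cvg_within_filter; apply.
Unshelve. all: by end_near. Qed.

Lemma derive_line f x v :
  'D_1 (fun t : R => f (t *: v + x)) 0 = 'D_v f x.
Proof.
rewrite /derive; set g1 := fun h => h^-1 *: _; set g2 := fun h => h^-1 *: _.
suff -> : g1 = g2 by [].
by rewrite funeqE /g1 /g2 => h /=; rewrite addr0 scale0r add0r [_%:A]mulr1.
Qed.

Lemma derivable_line f x v :
  derivable (fun t : R => f (t *: v + x)) 0 1 <-> derivable f x v.
Proof.
rewrite /derivable; set g1 := fun h => h^-1 *: _; set g2 := fun h => h^-1 *: _.
suff -> : g1 = g2 by [].
by rewrite funeqE /g1 /g2 => h /=; rewrite addr0 scale0r add0r [_%:A]mulr1.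
Qed.

(** Only a derivative in the direction [v] is available, not differentiability of [f], so the chain
    rule is applied to the one-variable function t -> f (t v + x). *)
Lemma is_derive_comp1 (p : R -> R) f x (v : 'rV[R]_d) dp :
  derivable f x v -> is_derive (f x) (1 : R) p dp ->
  is_derive x v (p \o f) (dp * 'D_v f x).
Proof.
move=> fv pf.
pose h := fun t : R => f (t *: v + x).
have hE : h 0 = f x by rewrite /h scale0r add0r.
have dh : derivable h 0 1 by apply/derivable_line.
have dhE : 'D_1 h 0 = 'D_v f x by exact: derive_line.
have df1 : differentiable h 0 by exact/derivable1_diffP.
have df2 : differentiable p (h 0) by rewrite hE; apply/derivable1_diffP; case: pf.
have dc : derivable (p \o h) 0 1.
  by apply/derivable1_diffP; exact: differentiable_comp.
apply: DeriveDef; first by apply/derivable_line; exact: dc.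
rewrite -(derive_line (p \o f)) -/(p \o h).
rewrite -derive1E derive1_comp; [|exact: dh|by rewrite hE; case: pf].
rewrite !derive1E dhE hE; congr (_ * _).
by case: pf.
Qed.

Lemma Ck_continuous k f : Ck k f -> continuous f.
Proof. by case: k => [|k] []. Qed.

Lemma CkW k f : Ck k.+1 f -> Ck k f.
Proof.
elim: k f => [|k IH] f [cf H]; first by split.
by split=> // i; have [df /IH] := H i.
Qed.

Lemma Ck_cst k (c : R) : Ck k (fun _ : 'rV[R]_d => c).
Proof.
elim: k c => [|k IH] c; (split; first exact: cst_continuous) => //.
move=> i; split=> [x|]; first exact: derivable_cst.
rewrite (_ : partial i _ = fun=> 0)//.
by apply/funext => x; rewrite /partial derive_cst.
Qed.

Lemma CkD k f g : Ck k f -> Ck k g -> Ck k (fun x => f x + g x).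
Proof.
elim: k f g => [|k IH] f g [cf Hf] [cg Hg].
  by split=> // x; apply: continuousD; [exact: cf|exact: cg].
split; first by move=> x; apply: continuousD; [exact: cf|exact: cg].
move=> i; have [df Cf] := Hf i; have [dg Cg] := Hg i.
split=> [x|]; first exact: derivableD.
rewrite (_ : partial i _ = fun x => partial i f x + partial i g x); first exact: IH.
by apply/funext => x; rewrite /partial; exact: deriveD.
Qed.

Lemma CkM k f g : Ck k f -> Ck k g -> Ck k (fun x => f x * g x).
Proof.
elim: k f g => [|k IH] f g [cf Hf] [cg Hg].
  by split=> // x; apply: continuousM; [exact: cf|exact: cg].
split; first by move=> x; apply: continuousM; [exact: cf|exact: cg].
have Cf' : Ck k f by exact: CkW.
have Cg' : Ck k g by exact: CkW.
move=> i; have [df Cf] := Hf i; have [dg Cg] := Hg i.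
split=> [x|]; first exact: derivableM.
rewrite (_ : partial i _ = fun x => f x * partial i g x + g x * partial i f x).
  by apply: CkD; exact: IH.
by apply/funext => x; rewrite /partial; exact: deriveM.
Qed.

Lemma CkZ k (c : R) f : Ck k f -> Ck k (fun x => c * f x).
Proof. by move=> Cf; apply: CkM => //; exact: Ck_cst. Qed.

Lemma CkN k f : Ck k f -> Ck k (fun x => - f x).
Proof.
move=> /(CkZ (-1)); rewrite (_ : (fun x => -1 * f x) = fun x => - f x)//.
by apply/funext => x; rewrite mulN1r.
Qed.

Lemma CkB k f g : Ck k f -> Ck k g -> Ck k (fun x => f x - g x).
Proof. by move=> Cf Cg; apply: CkD => //; exact: CkN. Qed.

Lemma Ck_sum k (I : Type) (s : seq I) (F : I -> 'rV[R]_d -> R) :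
  (forall i, Ck k (F i)) -> Ck k (fun x => \sum_(i <- s) F i x).
Proof.
move=> CF; elim: s => [|i s IH].
  by rewrite (_ : (fun _ => _) = fun=> 0); [exact: Ck_cst|apply/funext => x; rewrite big_nil].
rewrite (_ : (fun _ => _) = fun x => F i x + \sum_(j <- s) F j x); first exact: CkD.
by apply/funext => x; rewrite big_cons.
Qed.

Lemma coord_is_derive x (v : 'rV[R]_d) (j : 'I_d) :
  is_derive x v (fun y : 'rV[R]_d => y ord0 j) (v ord0 j).
Proof.
suff H : h^-1 *: ((h *: v + x) ord0 j - x ord0 j) @[h --> 0^'] --> v ord0 j.
  by apply: DeriveDef; [apply/cvg_ex; exists (v ord0 j); exact: H | exact: cvg_lim H].
apply: cvg_near_cst.
near=> h; rewrite !mxE addrK /GRing.scale/= mulKf//.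
by near: h; exact: nbhs_dnbhs_neq.
Unshelve. all: by end_near. Qed.

Lemma Ck_coord k (j : 'I_d) : Ck k (fun x : 'rV[R]_d => x ord0 j).
Proof.
case: k => [|k]; split; try by move=> x; exact: coord_continuous.
  by [].
move=> i; split=> [x|]; first by case: (coord_is_derive x (delta_mx ord0 i) j).
rewrite (_ : partial i _ = fun=> (delta_mx ord0 i : 'rV[R]_d) ord0 j); first exact: Ck_cst.
apply/funext => x.
by rewrite /partial; case: (coord_is_derive x (delta_mx ord0 i) j).
Qed.

(** The derivative of a truncated power is a truncated power of one exponent less, which drives the
    induction on [k]. All the cutoffs below are built from this elementary family. *)
Lemma Ck_pospow k f : Ck k f -> Ck k (fun x => pospow k.+1 (f x)).
Proof.
have H j g : continuous g -> continuous (fun x => pospow j (g x)).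
  by move=> cg x; apply: continuous_comp; [exact: cg|exact: pospow_continuous].
elim: k f => [|k IH] f /[dup] Cf [cf Hf]; (split; first exact: H) => //.
move=> i; have [df Cdf] := Hf i.
have HD x := is_derive_comp1 (df x) (pospow_is_derive k (f x)).
split=> [x|]; first by case: (HD x).
rewrite (_ : partial i _ = fun x => (k.+2%:R * pospow k.+1 (f x)) * partial i f x).
  by apply: CkM => //; apply: CkZ; apply: IH; exact: CkW.
by apply/funext => x; rewrite /partial; case: (HD x).
Qed.

Lemma Ckb_Ck k f : Ckb k f -> Ck k f.
Proof.
elim: k f => [|k IH] f []; first by split.
move=> cf _ H; split=> // i; have [df /IH Cf] := H i; by split.
Qed.

Lemma compact_norm_le (r : R) : compact [set x : 'rV[R]_d | `|x| <= r].
Proof.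
apply: bounded_closed_compact.
  by exists r; split; [exact: num_real|move=> M rM x /= xr; exact: le_trans (ltW rM)].
have /closed_comp := @closed_le R r.
by apply; move=> x _; exact: norm_continuous.
Qed.

Lemma continuous_bounded_ball (r : R) f : continuous f ->
  exists B, forall x, `|x| <= r -> `|f x| <= B.
Proof.
move=> cf.
have [B [_ HB]] := compact_bounded (continuous_compact (continuous_subspaceT cf) (compact_norm_le (r := r))).
exists (B + 1) => x xr; apply: HB; first by rewrite ltrDl.
by exists x.
Qed.

(** Continuity gives the bounds on a ball. Vanishing outside it passes to the partial derivatives
    because [r < |x|] is an open condition. *)
Lemma Ckb_compact_support k f (r : R) : Ck k f ->
  (forall x, r < `|x| -> f x = 0) -> Ckb k f.
Proof.
move=> Ckf.
have [B HB] := continuous_bounded_ball r (Ck_continuous Ckf).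
(* [B] bounds [f] on a ball that may be empty and can thus be negative; the maximum with 0 covers
   the points where [f] vanishes. *)
have fB (x : 'rV[R]_d) : (forall x : 'rV[R]_d, r < `|x| -> f x = 0) -> `|f x| <= Num.max B 0.
  move=> f0; have [xr|xr] := leP `|x| r; last by rewrite f0// normr0 le_max lexx orbT.
  by rewrite le_max HB.
elim: k f B Ckf HB fB => [|k IH] f B [cf Hf] HB fB f0.
  by split=> //; exists (Num.max B 0) => x; exact: fB.
split=> //; first by exists (Num.max B 0) => x; exact: fB.
move=> i; have [df Cf] := Hf i; split=> //.
have [B' HB'] := continuous_bounded_ball r (Ck_continuous Cf).
apply: (IH _ B' Cf HB') => [x p0|x rx].
  have [xr|xr] := leP `|x| r; last by rewrite p0// normr0 le_max lexx orbT.
  by rewrite le_max HB'.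
rewrite /partial -[RHS](@derive_cst _ 'rV[R]_d R 0 x (delta_mx ord0 i)).
apply: near_eq_derive.
have : \forall y \near x, r < `|y|.
  have /open_comp := @open_gt R r.
  move=> /(_ 'rV[R]_d Num.norm) H; apply: open_nbhs_nbhs; split=> //.
  by apply: H => y _; exact: norm_continuous.
by apply: filterS => y ry; rewrite f0.
Qed.

End calculus.

(** * Norm comparisons and Taylor estimates from partial derivatives *)

Section taylor.
Context {R : realType} {d : nat}.
Implicit Types (f g : 'rV[R]_d -> R) (x z : 'rV[R]_d).

Lemma coord_le_norm z i : `|z ord0 i| <= `|z|.
Proof.
rewrite [leRHS]/Num.norm /= mx_normrE.
by apply/bigmax_geP; right => /=; exists (ord0, i).
Qed.

Lemma norm_le_coord z (c : R) : 0 <= c -> (forall i, `|z ord0 i| <= c) -> `|z| <= c.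
Proof.
move=> c0 H; rewrite [leLHS]/Num.norm /= mx_normrE.
by apply/bigmax_leP; split=> // -[i j] _ /=; rewrite (ord1 i).
Qed.

Lemma dotv_ge0 z : 0 <= dotv z z.
Proof. by apply: sumr_ge0 => i _; rewrite -expr2 sqr_ge0. Qed.

Lemma enorm_ge0 z : 0 <= enorm z.
Proof. exact: sqrtr_ge0. Qed.

Lemma enorm_sqr z : enorm z ^+ 2 = dotv z z.
Proof. by rewrite sqr_sqrtr ?dotv_ge0. Qed.

Lemma coord_le_enorm z i : `|z ord0 i| <= enorm z.
Proof.
rewrite -(@ler_pXn2r _ 2)// ?nnegrE ?enorm_ge0// enorm_sqr real_normK ?num_real//.
rewrite /dotv (bigD1 i)//= expr2 lerDl.
by apply: sumr_ge0 => j _; rewrite -expr2 sqr_ge0.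
Qed.

Lemma norm_le_enorm z : `|z| <= enorm z.
Proof. by apply: norm_le_coord; [exact: enorm_ge0|exact: coord_le_enorm]. Qed.

Lemma enorm_le_norm z : enorm z <= d%:R * `|z|.
Proof.
rewrite -(@ler_pXn2r _ 2)// ?nnegrE ?enorm_ge0// ?mulr_ge0//.
rewrite enorm_sqr exprMn.
apply: (@le_trans _ _ (\sum_(i < d) `|z| ^+ 2)).
  apply: ler_sum => i _; rewrite -expr2 -real_normK ?num_real//.
  by rewrite ler_pXn2r ?nnegrE// coord_le_norm.
rewrite sumr_const card_ord -[leLHS]mulr_natl ler_wpM2r ?sqr_ge0//.
by rewrite -natrX ler_nat; case: (d) => // n; rewrite leq_pmulr.
Qed.

Lemma enorm_eq0 z : enorm z = 0 -> z = 0.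
Proof.
move=> z0; apply/eqP; rewrite -normr_le0 -z0; exact: norm_le_enorm.
Qed.

(** A crude Cauchy-Schwarz inequality: bounding coordinate by coordinate costs the factor d, and
    constants are never optimized here. *)
Lemma dotv_le x z : `|dotv x z| <= d%:R * (enorm x * enorm z).
Proof.
apply: (le_trans (ler_norm_sum _ _ _)).
apply: (@le_trans _ _ (\sum_(i < d) (enorm x * enorm z))).
  by apply: ler_sum => i _; rewrite normrM ler_pM// coord_le_enorm.
by rewrite sumr_const card_ord -[leLHS]mulr_natl.
Qed.

Lemma line_is_derive f x (v : 'rV[R]_d) (u : R) :
  derivable f (u *: v + x) v ->
  is_derive u 1 (fun t : R => f (t *: v + x)) ('D_v f (u *: v + x)).
Proof.
move=> df.
pose g1 := fun h : R => h^-1 *: (f (h *: v + (u *: v + x)) - f (u *: v + x)).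
pose g2 := fun h : R => h^-1 *: (f ((h *: 1 + u) *: v + x) - f (u *: v + x)).
have E : g2 = g1.
  by rewrite funeqE /g1 /g2 => h /=; rewrite [_%:A]mulr1 scalerDl addrA.
have d2 : derivable (fun t : R => f (t *: v + x)) u 1.
  by rewrite /derivable -/g2 E.
by apply: DeriveDef => //; rewrite /derive -/g2 E.
Qed.

Lemma coord_mvt f x (v : 'rV[R]_d) (t : R) :
  (forall y, derivable f y v) ->
  exists2 s, `|s| <= `|t| & f (x + t *: v) - f x = 'D_v f (x + s *: v) * t.
Proof.
move=> df.
pose h := fun u : R => f (u *: v + x).
have dh (u : R) : is_derive u 1 h ('D_v f (u *: v + x)) by exact: line_is_derive.
have ch (A : set R) : {within A, continuous h}.
  apply: continuous_subspaceT => u.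
  by apply/differentiable_continuous/derivable1_diffP; case: (dh u).
have [t0|t0] := leP 0 t.
  have [s] := MVT_segment t0 (fun u _ => dh u) (@ch _).
  rewrite in_itv/= => /andP[s0 st]; rewrite /h scale0r add0r subr0 => E.
  exists s; first by rewrite !ger0_norm.
  by rewrite [x + t *: _]addrC E [s *: v + x]addrC.
have [s] := MVT_segment (ltW t0) (fun u _ => dh u) (@ch _).
rewrite in_itv/= => /andP[st s0]; rewrite /h scale0r add0r sub0r => E.
exists s; first by rewrite !ler0_norm ?lerN2// ltW.
by rewrite [x + t *: _]addrC -[LHS]opprB E mulrN opprK [s *: v + x]addrC.
Qed.

(** These truncations are the corners of a staircase path from [x] to [x + z] whose steps are
    parallel to the axes, so that one-variable mean values of partial derivatives suffice. *)
Definition trunc (m : nat) z : 'rV[R]_d := \row_i (if (i < m)%N then z ord0 i else 0).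

Lemma trunc0 z : trunc 0 z = 0.
Proof. by apply/rowP => i; rewrite !mxE. Qed.

Lemma trunc_full z : trunc d z = z.
Proof. by apply/rowP => i; rewrite !mxE ltn_ord. Qed.

Lemma truncS (i : 'I_d) z : trunc i.+1 z = trunc i z + z ord0 i *: delta_mx ord0 i.
Proof.
apply/rowP => j; rewrite !mxE eqxx/= ltnS leq_eqVlt.
have [->|ji] := eqVneq j i; first by rewrite eqxx ltnn/= add0r mulr1.
by rewrite mulr0 addr0 (inj_eq val_inj) (negbTE ji).
Qed.

Lemma telescope_coord f x z :
  f (x + z) - f x = \sum_(i < d) (f (x + trunc i.+1 z) - f (x + trunc i z)).
Proof.
rewrite -(big_mkord xpredT (fun i => f (x + trunc i.+1 z) - f (x + trunc i z))).
by rewrite telescope_sumr// trunc_full trunc0 addr0.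
Qed.

Lemma partial_lipschitz f (M : R) : 0 <= M ->
  (forall i y, derivable f y (delta_mx ord0 i)) ->
  (forall i y, `|partial i f y| <= M) ->
  forall x z, `|f (x + z) - f x| <= M * d%:R * `|z|.
Proof.
move=> M0 df HM x z; rewrite telescope_coord.
apply: (le_trans (ler_norm_sum _ _ _)).
apply: (@le_trans _ _ (\sum_(i < d) (M * `|z|))); last first.
  by rewrite sumr_const card_ord -[leLHS]mulr_natl mulrA [d%:R * M]mulrC.
apply: ler_sum => i _; rewrite truncS addrA.
have [s _ ->] := coord_mvt (x + trunc i z) (z ord0 i) (df i).
by rewrite normrM ler_pM// ?coord_le_norm// HM.
Qed.

Lemma taylor2 f (M : R) : 0 <= M ->
  (forall i y, derivable f y (delta_mx ord0 i)) ->
  (forall i j y, derivable (partial i f) y (delta_mx ord0 j)) ->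
  (forall i j y, `|partial j (partial i f) y| <= M) ->
  forall x z, `|f (x + z) - f x - dotv (grad f x) z| <= M * d%:R ^+ 2 * `|z| ^+ 2.
Proof.
move=> M0 df ddf HM x z; rewrite telescope_coord /dotv -sumrB.
apply: (le_trans (ler_norm_sum _ _ _)).
apply: (@le_trans _ _ (\sum_(i < d) (M * d%:R * `|z| ^+ 2))); last first.
  rewrite sumr_const card_ord -[leLHS]mulr_natl.
  by rewrite (_ : _ * (M * _ * _) = M * d%:R ^+ 2 * `|z| ^+ 2)//; ring.
apply: ler_sum => i _; rewrite truncS addrA.
have [s sz ->] := coord_mvt (x + trunc i z) (z ord0 i) (df i).
rewrite mxE -mulrBl normrM -addrA expr2 [leRHS]mulrA ler_pM// ?coord_le_norm//.
apply: (le_trans (partial_lipschitz M0 (ddf i) (HM i) _ _)).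
rewrite ler_wpM2l ?mulr_ge0//.
(* The displacement from [x] to the intermediate point is dominated by [z] coordinate by
   coordinate. *)
apply: norm_le_coord => // j; rewrite !mxE eqxx/=.
have [ji|ji] := eqVneq j i.
  rewrite ji ltnn/= add0r mulr1; apply: (le_trans sz); exact: coord_le_norm.
rewrite mulr0 addr0; case: ifP => _; first exact: coord_le_norm.
by rewrite normr0.
Qed.

Lemma Ckb_bounded k f : Ckb k f -> exists2 M, 0 <= M & forall x, `|f x| <= M.
Proof.
by case: k => [|k] [_ [M HM] _]; exists M => //; exact: le_trans (normr_ge0 _) (HM 0).
Qed.

Lemma le_sum_ord (M : 'I_d -> R) i : (forall j, 0 <= M j) -> M i <= \sum_j M j.
Proof.
move=> M0; rewrite (bigD1 i)//= lerDl.
by apply: sumr_ge0 => j _; exact: M0.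
Qed.

Lemma Ckb_grad_bounded f : Ckb 1 f -> exists2 M, 0 <= M & forall i x, `|partial i f x| <= M.
Proof.
case=> _ _ H.
have K i : exists M, 0 <= M /\ forall x, `|partial i f x| <= M.
  have Ci : Ckb 0 (partial i f) by have [] := H i.
  by have [M M0 HM] := Ckb_bounded Ci; exists M.
have [M HM] := choice K.
exists (\sum_i M i); first by apply: sumr_ge0 => i _; have [] := HM i.
move=> i x; have [_ HMi] := HM i; apply: (le_trans (HMi x)).
by apply: le_sum_ord => j; have [] := HM j.
Qed.

Lemma Ckb_taylor f : Ckb 2 f -> exists2 C, 0 <= C &
  forall x z, `|f (x + z) - f x - dotv (grad f x) z| <= C * enorm z ^+ 2.
Proof.
case=> _ _ H.
have K i : exists M, 0 <= M /\ forall j x, `|partial j (partial i f) x| <= M.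
  have Ci : Ckb 1 (partial i f) by have [] := H i.
  by have [M M0 HM] := Ckb_grad_bounded Ci; exists M.
have [N HN] := choice K.
pose M := \sum_i N i.
have M0 : 0 <= M by apply: sumr_ge0 => i _; have [] := HN i.
exists (M * d%:R ^+ 2); first by rewrite mulr_ge0.
move=> x z; apply: (@le_trans _ _ (M * d%:R ^+ 2 * `|z| ^+ 2)).
  apply: taylor2 => //.
  - by move=> i y; have [+ _] := H i; exact.
  - by move=> i j y; have [_ [_ _ /(_ j)[+ _]]] := H i; exact.
  move=> i j y; have [_ HNi] := HN i; apply: (le_trans (HNi j y)).
  by apply: le_sum_ord => l; have [] := HN l.
rewrite ler_wpM2l ?mulr_ge0// ler_pXn2r ?nnegrE ?enorm_ge0//.
exact: norm_le_enorm.
Qed.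

End taylor.

(** * Smooth cutoff functions *)

Section cutoffs.
Context {R : realType} {d : nat}.
Implicit Types (f g : 'rV[R]_d -> R) (x y z : 'rV[R]_d).

(** The exponent 3 gives class C^2. For r > 0 the function is positive exactly on the open Euclidean
    ball, which lies in the ball of the sup norm of the same radius. *)
Definition bump (c : 'rV[R]_d) (r : R) x : R :=
  pospow 3 (r ^+ 2 - \sum_i (x ord0 i - c ord0 i) ^+ 2).

Lemma bump_Ck c r : Ck 2 (bump c r).
Proof.
apply: (@Ck_pospow _ _ 2); apply: CkB; first exact: Ck_cst.
apply: Ck_sum => i; under [X in Ck 2 X]eq_fun do rewrite expr2.
by apply: CkM; apply: CkB; [exact: Ck_coord|exact: Ck_cst|exact: Ck_coord|exact: Ck_cst].
Qed.

Lemma bump_ge0 c r x : 0 <= bump c r x.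
Proof. by rewrite /bump /pospow exprn_ge0// le_max lexx orbT. Qed.

Lemma bump_center_gt0 c r : 0 < r -> 0 < bump c r c.
Proof.
move=> r0; rewrite /bump /pospow big1 ?subr0; last first.
  by move=> i _; rewrite subrr expr0n.
by rewrite exprn_gt0// lt_max exprn_gt0.
Qed.

Lemma bump_supp c r x : 0 < r -> 0 < bump c r x -> ball c r x.
Proof.
move=> r0 bx; split=> // i j; rewrite (ord1 i) /ball/= distrC.
rewrite -(@ltr_pXn2r _ 2)// ?nnegrE// ?(ltW r0)// real_normK ?num_real//.
have : 0 < r ^+ 2 - \sum_i (x ord0 i - c ord0 i) ^+ 2.
  rewrite ltNge; apply/negP => H; move: bx.
  by rewrite /bump /pospow max_r// expr0n ltxx.
rewrite subr_gt0; apply: le_lt_trans.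
rewrite (bigD1 j)//= lerDl.
by apply: sumr_ge0 => l _; exact: sqr_ge0.
Qed.

(** Finitely many bumps supported in [U] cover [K]; their sum is bounded away from 0 on [K] and
    vanishes off [U]. *)
Lemma smooth_urysohn (K U : set 'rV[R]_d) : compact K -> open U -> K `<=` U ->
  exists g, [/\ Ck 2 g, forall x, 0 <= g x <= 1,
    forall x, K x -> g x = 1 & forall x, ~ U x -> g x = 0].
Proof.
move=> cK oU KU.
have [K0|/set0P K0] := eqVneq K set0.
  exists (fun=> 0); split=> //; first exact: Ck_cst.
    by move=> x; rewrite lexx ler01.
  by move=> x; rewrite K0.
have H x : exists r : R, K x -> 0 < r /\ ball x r `<=` U.
  have [Kx|nKx] := pselect (K x); last by exists 0.
  have /nbhs_ballP[e /= e0 eU] : nbhs x U by apply: open_nbhs_nbhs; split=> //; exact: KU.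
  by exists e.
have [r Hr] := choice H.
pose W x := [set y | 0 < bump x (r x) y].
have oW x : open (W x).
  have /open_comp := @open_gt R 0.
  move=> /(_ 'rV[R]_d (bump x (r x))); apply => y _.
  exact: (Ck_continuous (bump_Ck x (r x))).
have cK' := cK.
rewrite compact_cover in cK'.
have [|D DK KD] := cK' 'rV[R]_d K W (fun x _ => oW x).
  by move=> x Kx; exists x => //; apply: bump_center_gt0; have [] := Hr x Kx.
pose h y := \sum_(x <- enum_fset D) bump x (r x) y.
have Ch : Ck 2 h by apply: Ck_sum => x; exact: bump_Ck.
have h0 y : 0 <= h y by apply: sumr_ge0 => x _; exact: bump_ge0.
have hK y : K y -> 0 < h y.
  move=> /KD[x /= xD yx]; rewrite /h (big_rem x)//=.
  by rewrite ltr_pwDl//; apply: sumr_ge0 => *; exact: bump_ge0.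
have hU y : ~ U y -> h y = 0.
  move=> Uy; rewrite /h big_seq big1// => x xD.
  have Kx : K x by move: (DK x xD); rewrite inE.
  have [r0 bU] := Hr x Kx.
  apply/eqP; rewrite eq_le bump_ge0 andbT leNgt; apply/negP => /(bump_supp r0)/bU.
  exact: Uy.
have [c cKc Hc] := compact_EVT_min K0 cK (continuous_subspaceT (Ck_continuous Ch)).
have m0 : 0 < h c by apply: hK; rewrite inE in cKc.
(* Dividing by the minimum [h c] of [h] on [K] makes the argument of [pospow] nonpositive on [K]; it
   equals 1 wherever [h] vanishes. *)
exists (fun x => 1 - pospow 3 (1 - (h c)^-1 * h x)); split.
- apply: CkB; first exact: Ck_cst.
  apply: (@Ck_pospow _ _ 2); apply: CkB; first exact: Ck_cst.
  exact: CkZ.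
- move=> x.
  have u0 : 0 <= Num.max (1 - (h c)^-1 * h x) 0 by rewrite le_max lexx orbT.
  have u1 : Num.max (1 - (h c)^-1 * h x) 0 <= 1.
    by rewrite ge_max ler01 andbT gerBl mulr_ge0// invr_ge0 ltW.
  by rewrite subr_ge0 gerBl exprn_ge0// exprn_ile1.
- move=> x Kx; rewrite /pospow max_r ?expr0n ?subr0//.
  rewrite subr_le0 mulrC ler_pdivlMr// mul1r; apply: Hc.
  by rewrite inE.
- by move=> x /hU ->; rewrite mulr0 subr0 /pospow max_l// expr1n subrr.
Qed.

(** The value 1 is imposed on the closure of [U n.+1] and not only on [G]: at the hitting time of an
    open set, a right-continuous path is only known to be in the closure of that set. *)
Lemma cutoff_sequence (G : set 'rV[R]_d) : compact G ->
  exists (U : nat -> set 'rV[R]_d) (g : nat -> 'rV[R]_d -> R), 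
  [/\ forall n, open (U n), forall n, U n.+1 `<=` U n, forall n, G `<=` U n &
    forall x, (forall n, U n x) -> G x] /\
  [/\ forall n, Ckb 2 (g n), forall n x, 0 <= g n x <= 1,
    forall n x, closure (U n.+1) x -> g n x = 1 &
    forall n x, ~ U n x -> g n x = 0].
Proof.
move=> cG.
pose U n := \bigcup_(y in G) ball y (n.+1%:R^-1 : R).
have oU n : open (U n) by apply: bigcup_open => y _; exact: ball_open.
have UU n : closure (U n.+1) `<=` U n.
  move=> x cx.
  have e0 : 0 < n.+1%:R^-1 - n.+2%:R^-1 :> R by rewrite subr_gt0 ltf_pV2 ?posrE// ltr_nat.
  have [w [[y Gy yw] xw]] := cx _ (nbhsx_ballx x _ e0).
  exists y => //; rewrite (_ : n.+1%:R^-1 = n.+2%:R^-1 + (n.+1%:R^-1 - n.+2%:R^-1)); last by ring.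
  by apply: ball_triangle yw _; exact: ball_sym.
have [B [_ HB]] := compact_bounded cG.
have UB x : U 0%N x -> `|x| <= (B + 1) + 1.
  move=> [y Gy]; rewrite -ball_normE /ball_/= invr1 => yx.
  rewrite -(subrK y x); apply: (le_trans (ler_normD _ _)).
  rewrite addrC lerD//; last by rewrite distrC ltW.
  by apply: HB => //; rewrite ltrDl.
have U0 n : U n `<=` U 0%N.
  elim: n => [//|n IH]; apply: subset_trans IH; apply: subset_trans (UU n).
  exact: subset_closure.
have cUn n : compact (closure (U n.+1)).
  apply: bounded_closed_compact; last exact: closed_closure.
  exists (B + 1 + 1); split; first exact: num_real.
  by move=> M BM x /UU/U0/UB xB; exact: le_trans (ltW BM).
have H n : exists g, [/\ Ck 2 g, forall x, 0 <= g x <= 1,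
    forall x, closure (U n.+1) x -> g x = 1 & forall x, ~ U n x -> g x = 0].
  exact: smooth_urysohn.
have [g Hg] := choice H.
exists U, g; split; split=> //.
- by move=> n; apply: subset_trans (UU n); exact: subset_closure.
- by move=> n x Gx; exists x => //; exact: ballxx.
- move=> x Ux; have : closed G by apply: compact_closed => //; exact: norm_hausdorff.
  apply => A /nbhs_ballP[e /= e0 eA].
  have [n ne] : exists n : nat, (n.+1%:R^-1 < e).
    by have /ltr_add_invr[k] := e0; rewrite add0r; exists k.
  have [y Gy xy] := Ux n; exists y; split=> //; apply: eA.
  by apply: (le_ball (ltW ne)); exact: ball_sym.
- move=> n; have [Cg _ _ gU] := Hg n.
  apply: (@Ckb_compact_support _ _ _ _ (B + 1 + 1)) => // x Bx.
  by apply: gU => /U0/UB; rewrite leNgt Bx.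
- by move=> n x; have [] := Hg n.
- by move=> n; have [] := Hg n.
- by move=> n; have [] := Hg n.
Qed.

End cutoffs.

(** * Lebesgue measure and the stable kernel *)

Section translation.
Context {R : realType}.

Lemma measurable_rV_add n (a : 'rV[R]_n) : measurable_fun setT (fun v : 'rV[R]_n => v + a).
Proof.
apply: measurable_fun_rV => i; under eq_fun do rewrite mxE.
by apply: measurable_funD; [exact: measurable_coord|exact: measurable_cst].
Qed.

Lemma lebesgue_measure_translate (a : R) (A : set (measurableTypeR R)) : measurable A ->
  lebesgue_measure ((fun x => x + a) @^-1` A) = lebesgue_measure A.
Proof.
move=> mA.
have mf : measurable_fun setT (fun x : measurableTypeR R => (x + a : measurableTypeR R)).
  by apply: measurable_funD; [exact: measurable_id|exact: measurable_cst].
pose mu := measure_function_pushforward__canonical__measure_function_Measure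
  (@lebesgue_measure R) mf.
rewrite (@lebesgue_measure_unique _ mu _ A mA)// => X /ocitvP[->|[[u v]/= uv ->]].
  by rewrite !measure0.
rewrite /mu/= /pushforward.
rewrite (_ : _ @^-1` _ = `]u - a, v - a]%classic).
  rewrite !lebesgue_measure_itv/= !lte_fin ltrBlDr subrK; case: ifP => // _.
  by rewrite -!EFinB; congr EFin; ring.
by apply/seteqP; split=> x /=; rewrite !in_itv/= ltrBlDr lerBrDr.
Qed.

(** The measure is the image of a product, on which a translation acts factor by factor; uniqueness
    of the product measure reduces the claim to rectangles. *)
Lemma lebesgue_rV_translate n (a : 'rV[R]_n) (A : set 'rV[R]_n) : measurable A ->
  lebesgue_rV n ((fun v => v + a) @^-1` A) = lebesgue_rV n A.
Proof.
elim: n a A => [|n IH] a A mA.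
  congr (lebesgue_rV 0 _); apply/seteqP; split=> x /=.
    by rewrite (_ : x + a = x)//; apply/rowP; case.
  by rewrite (_ : x + a = x)//; apply/rowP; case.
rewrite /= /lebesgue_rV_step /pushforward.
pose a' : 'rV[R]_n := \row_i a ord0 (lift ord0 i).
pose S (p : measurableTypeR R * 'rV[R]_n) : measurableTypeR R * 'rV[R]_n :=
  (p.1 + a ord0 ord0, p.2 + a').
have mS : measurable_fun setT S.
  apply: measurable_fun_pair.
    apply: (measurable_funD measurable_fst); exact: measurable_cst.
  exact: (measurableT_comp (measurable_rV_add a') measurable_snd).
pose mu := measure_function_pushforward__canonical__measure_function_Measure
  (lebesgue_measure \x lebesgue_rV n)%E mS.
rewrite [RHS](@product_measure_unique _ _ _ _ _ lebesgue_measure (lebesgue_rV n) mu); last first.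
- by rewrite -[X in measurable X]setTI; exact: measurable_rV_cons.
- move=> B C mB mC; rewrite /mu/= /pushforward.
  rewrite (_ : S @^-1` _ = ((fun x => x + a ord0 ord0) @^-1` B) `*` ((fun v => v + a') @^-1` C)).
    rewrite product_measure1E//=.
    + by rewrite lebesgue_measure_translate// IH.
    + rewrite -[X in measurable X]setTI.
      by apply: measurable_funD => //; exact: measurable_cst.
    + by rewrite -[X in measurable X]setTI; apply: measurable_rV_add.
  by [].
congr ((_ \x _)%E _); apply/seteqP.
suff E p : rV_cons p + a = rV_cons (S p) by split=> p /=; rewrite E.
apply/rowP => i; rewrite !mxE.
by case: unliftP => [j ->|->]//=; rewrite !mxE.
Qed.

Lemma ge0_integral_translate n (a : 'rV[R]_n) (f : 'rV[R]_n -> \bar R) :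
  measurable_fun setT f -> (forall x, 0 <= f x)%E ->
  (\int[lebesgue_rV n]_x f (x + a)%R = \int[lebesgue_rV n]_x f x)%E.
Proof.
move=> mf f0.
pose mu := measure_function_pushforward__canonical__measure_function_Measure
  (lebesgue_rV n) (measurable_rV_add a).
transitivity (\int[mu]_x f x)%E.
  by rewrite ge0_integral_pushforward//; exact: measurable_rV_add.
by apply: eq_measure_integral => A mA _; rewrite /mu/= /pushforward lebesgue_rV_translate.
Qed.

End translation.

(** * Integrability of the stable kernel near 0 and at infinity *)

Section kernel.
Context {R : realType}.

Lemma continuous_measurable_rV n (f : 'rV[R]_n -> R) :
  continuous f -> measurable_fun setT f.
Proof.
move=> cf; apply: (measurability _ (RGenOpens.measurableE R)).
move=> _ [_ [a [b ->] <-]]; rewrite setTI.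
apply: sub_sigma_algebra.
by apply: open_comp; [move=> v _; exact: cf|exact: interval_open].
Qed.

Lemma measurable_dotv d (T : measurableType d) n (f g : T -> 'rV[R]_n) :
  measurable_fun setT f -> measurable_fun setT g ->
  measurable_fun setT (fun t => dotv (f t) (g t)).
Proof.
move=> mf mg; apply: measurable_sum => i.
apply: measurable_funM.
  exact: (measurableT_comp (@measurable_coord R n i) mf).
exact: (measurableT_comp (@measurable_coord R n i) mg).
Qed.

Lemma measurable_enorm n : measurable_fun setT (@enorm R n).
Proof.
apply: measurableT_comp; last by apply: measurable_dotv; exact: measurable_id.
exact: (continuous_measurable_fun (@sqrt_continuous R)).
Qed.

Lemma measurable_box n (r : R) :
  measurable [set v : 'rV[R]_n | forall i, `|v ord0 i| <= r].
Proof.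
rewrite (_ : mkset _ = \bigcap_(i in [set: 'I_n])
    ([set: 'rV[R]_n] `&` (fun v => v ord0 i) @^-1` `[- r, r])).
  by apply: fin_bigcap_measurable => // i _; exact: measurable_coord.
apply/seteqP; split=> [v /= H i _|v H i] /=.
  by split=> //; rewrite in_itv/= -ler_norml.
by have [_ /=] := H i Logic.I; rewrite in_itv/= -ler_norml.
Qed.

Lemma lebesgue_rV_cube n (r : R) : 0 <= r ->
  lebesgue_rV n [set v : 'rV[R]_n | forall i, `|v ord0 i| <= r] = ((2 * r) ^+ n)%:E.
Proof.
move=> r0.
rewrite (_ : (2 * r) ^+ n = \prod_(i < n) ((const_mx r : 'rV[R]_n) ord0 i -
    (const_mx (- r) : 'rV[R]_n) ord0 i)); last first.
  rewrite (eq_bigr (fun=> 2 * r)); last by move=> i _; rewrite !mxE; ring.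
  by rewrite prodr_const card_ord.
rewrite -lebesgue_rV_box; last first.
  by move=> i; rewrite !mxE -subr_ge0 opprK addr_ge0.
congr (lebesgue_rV n _).
by apply/seteqP; split=> v /= H i; have := H i; rewrite !mxE in_itv/= ler_norml.
Qed.

(** A substitute for polar coordinates: the indicators of the boxes, weighted by [c j], add up to a
    function above [u] whose integral is at most the sum of a geometric series. *)
Lemma integral_shells n (u : 'rV[R]_n -> R) (c rho : nat -> R) (C q : R) :
  measurable_fun setT u -> (forall z, 0 <= u z) ->
  (forall j, 0 <= c j) -> (forall j, 0 <= rho j) -> 0 <= C -> 0 <= q < 1 ->
  (forall j, c j * (2 * rho j) ^+ n <= C * q ^+ j) ->
  (forall z, u z != 0 -> exists j, u z <= c j /\ forall i, `|z ord0 i| <= rho j) ->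
  (\int[lebesgue_rV n]_z (u z)%:E < +oo)%E.
Proof.
move=> mu u0 c0 rho0 C0 /andP[q0 q1] cq ue.
pose B j := [set v : 'rV[R]_n | forall i, `|v ord0 i| <= rho j].
have mB j : measurable (B j) by exact: measurable_box.
pose F j z := (c j * \1_(B j) z)%:E : \bar R.
have F0 j z : (0 <= F j z)%E by rewrite lee_fin mulr_ge0.
have mF j : measurable_fun setT (F j).
  apply/measurable_EFinP; apply: measurable_funM; first exact: measurable_cst.
  exact: measurable_indic.
apply: (@le_lt_trans _ _ (\int[lebesgue_rV n]_z (\sum_(j <oo) F j z))%E).
  apply: ge0_le_integral => //.
  - by move=> z _; rewrite lee_fin.
  - exact/measurable_EFinP.
  - by apply: ge0_emeasurable_sum => // k z _ _; exact: F0.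
  move=> z _; have [z0|z0] := eqVneq (u z) 0.
    by rewrite z0; apply: nneseries_ge0 => j _ _; exact: F0.
  have [j [uj zj]] := ue z z0.
  apply: (@le_trans _ _ (F j z)).
    by rewrite lee_fin indicE mem_set ?mulr1.
  rewrite (@nneseriesD1 _ _ j)//.
  by apply: leeDl; apply: nneseries_ge0 => k _ _; exact: F0.
rewrite integral_nneseries//.
apply: (@le_lt_trans _ _ (C / (1 - q))%:E); last by rewrite ltry.
apply: lime_le; first by apply: is_cvg_nneseries => j _ _; exact: integral_ge0.
apply: nearW => m.
apply: (@le_trans _ _ (\sum_(0 <= j < m) (C * q ^+ j))%:E).
  rewrite -sumEFin; apply: lee_sum => j _; rewrite /F.
  under eq_integral do rewrite EFinM.
  rewrite ge0_integralZl//; last by rewrite lee_fin.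
  rewrite integral_indic// setIT.
    by have /= -> := lebesgue_rV_cube n (rho0 j); rewrite -EFinM lee_fin.
  by apply/measurable_EFinP; exact: measurable_indic.
rewrite lee_fin -[leLHS]/(series (geometric C q) m).
rewrite geometric_seriesE ?lt_eqF//= -mulrA ler_wpM2l// ler_pdivrMr ?subr_gt0//.
by rewrite mulVf ?gt_eqF ?subr_gt0// lerBlDr lerDl exprn_ge0.
Qed.

Variable alpha : R.
Hypothesis alpha12 : 0 < alpha < 2.

(** For a positive exponent the value at [z = 0] is 0, by the convention on inverses; a lower bound
    of the kernel therefore has to exclude that point. *)
Definition kern n (z : 'rV[R]_n) : R := (enorm z `^ (n%:R + alpha))^-1.

Lemma kern_ge0 n (z : 'rV[R]_n) : 0 <= kern z.
Proof. by rewrite invr_ge0 powR_ge0. Qed.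

Lemma measurable_kern n : measurable_fun setT (@kern n).
Proof.
rewrite (_ : @kern n = (fun x : R => x `^ (- (n%:R + alpha))) \o @enorm R n); last first.
  by apply/funext => z; rewrite /kern/= powRN.
by apply: measurableT_comp; [exact: measurable_powR|exact: measurable_enorm].
Qed.

Let alpha0 : 0 < alpha. Proof. by case/andP: alpha12. Qed.
Let s n : R := n%:R + alpha.
Let s0 n : 0 < s n. Proof. by rewrite ltr_wpDl. Qed.
Let p n : R := 2 `^ (s n).
Let p0 n : 0 < p n. Proof. by rewrite powR_gt0. Qed.

Let powR_expr (a t : R) j : 0 <= a -> (a ^+ j) `^ t = (a `^ t) ^+ j.
Proof.
by move=> a0; rewrite -powR_mulrn// powRAC powR_mulrn// powR_ge0.
Qed.

Let powR_inv (a t : R) : 0 <= a -> a^-1 `^ t = (a `^ t)^-1.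
Proof.
by move=> a0; rewrite -powR_inv1// powRAC powR_inv1// powR_ge0.
Qed.

Lemma kern_le n (z : 'rV[R]_n) (r : R) : 0 < r -> r <= enorm z -> kern z <= (r `^ (s n))^-1.
Proof.
move=> r0 rz; rewrite lef_pV2 ?posrE ?powR_gt0//; last exact: lt_le_trans rz.
by apply: ge0_ler_powR; rewrite ?nnegrE ?enorm_ge0// ltW.
Qed.

Definition in1 n (z : 'rV[R]_n) : R := \1_[set z : 'rV[R]_n | enorm z <= 1] z.

Lemma measurable_in1 n : measurable_fun setT (@in1 n).
Proof.
apply: measurable_indic; rewrite -[X in measurable X]setTI.
rewrite (_ : [set z | _] = (@enorm R n) @^-1` `]-oo, 1]); last first.
  by apply/seteqP; split=> z /=; rewrite in_itv.
by apply: measurable_enorm => //; exact: measurable_itv.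
Qed.

Lemma in1E n (z : 'rV[R]_n) : in1 z = (enorm z <= 1)%R%:R.
Proof. rewrite /in1 indicE; congr (_%:R); congr nat_of_bool.
by apply/idP/idP; rewrite inE. Qed.

Lemma in1_01 n (z : 'rV[R]_n) : 0 <= in1 z <= 1.
Proof. by rewrite in1E; case: (enorm z <= 1); rewrite ?lexx ?ler01. Qed.

(** On the shell 2^-(j+1) < |z| <= 2^-j the integrand is at most 4^-j 2^((j+1)(n+alpha)), and the
    enclosing box has measure 2^n 2^(-jn): the ratio of the series is 2^(alpha-2), less than 1. *)
Lemma kern_small_integral n :
  (\int[lebesgue_rV n]_z (in1 z * enorm z ^+ 2 * kern z)%:E < +oo)%E.
Proof.
have h0 : 0 < 2^-1 :> R by rewrite invr_gt0.
apply: (@integral_shells n _ (fun j => (2^-1 ^+ j) ^+ 2 * p n ^+ j.+1) (fun j => 2^-1 ^+ j)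
  (2 ^+ n * p n) (2^-1 ^+ 2 * p n * 2^-1 ^+ n)).
- apply: measurable_funM; last exact: measurable_kern.
  apply: measurable_funM; first exact: measurable_in1.
  by apply: measurable_funX; exact: measurable_enorm.
- move=> z; have /andP[z0 _] := in1_01 z.
  by apply: mulr_ge0; [apply: mulr_ge0 => //; exact: sqr_ge0|exact: kern_ge0].
- by move=> j; rewrite mulr_ge0 ?exprn_ge0// ltW.
- by move=> j; rewrite exprn_ge0.
- by rewrite mulr_ge0 ?exprn_ge0// ltW.
- apply/andP; split; first by rewrite !mulr_ge0 ?exprn_ge0// ltW.
  rewrite mulrAC -exprD exprVn mulrC ltr_pdivrMr ?exprn_gt0// mul1r.
  rewrite /p -[ltRHS]powR_mulrn//.
  rewrite /powR ifF ?pnatr_eq0// ltr_expR ltr_pM2r ?ln_gt0 ?ltr1n//.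
  by rewrite /s natrD addrC ltrD2r; case/andP: alpha12.
- move=> j; rewrite le_eqVlt; apply/orP; left; apply/eqP.
  rewrite !expr2 !exprMn [_ ^+ n ^+ j]exprAC exprS.
  move: (2^-1 ^+ j) (p n ^+ j) (2 ^+ n) => A B C; ring.
- move=> z; rewrite !mulf_eq0 !negb_or => /andP[/andP[z1 /andP[z2 _]] _].
  have ez0 : 0 < enorm z.
    by rewrite lt_neqAle enorm_ge0 andbT eq_sym.
  have ez1 : enorm z <= 1.
    by move: z1; rewrite in1E; case: (enorm z <= 1); rewrite ?eqxx.
  have ex : exists j, 2^-1 ^+ j.+1 < enorm z.
    have [m /= zm] := ltr_add_invr ez0; rewrite add0r in zm.
    exists m; apply: le_lt_trans zm; rewrite exprVn lef_pV2 ?posrE ?exprn_gt0 ?ltr0n//.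
    by rewrite -natrX ler_nat ltnW// ltn_expl.
  have [j jz jmin] := ex_minnP ex.
  (* Minimality of [j] gives the outer radius of the shell; for [j = 0] it is the constraint carried
     by [in1]. *)
  have zj : enorm z <= 2^-1 ^+ j.
    case: j jz jmin => [|j] jz jmin; first by rewrite expr0.
    by rewrite leNgt; apply/negP => /jmin; rewrite ltnn.
  exists j; split; last by move=> i; exact: le_trans (coord_le_enorm z i) zj.
  rewrite in1E ez1 mul1r ler_pM ?sqr_ge0 ?kern_ge0//.
    by rewrite ler_pXn2r ?nnegrE ?enorm_ge0// exprn_ge0.
  apply: (le_trans (kern_le _ (ltW jz))); first by rewrite exprn_gt0.
  rewrite powR_expr// powR_inv//.
  by rewrite exprVn invrK.
Qed.

(** The same computation on the shells 2^j <= |z| < 2^(j+1) gives the ratio 2^(-alpha). *)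
Lemma kern_large_integral n :
  (\int[lebesgue_rV n]_z ((1 - in1 z) * kern z)%:E < +oo)%E.
Proof.
apply: (@integral_shells n _ (fun j => (p n)^-1 ^+ j) (fun j => 2 ^+ j.+1)
  (4 ^+ n) (2 ^+ n / p n)).
- apply: measurable_funM; last exact: measurable_kern.
  by apply: measurable_funB; [exact: measurable_cst|exact: measurable_in1].
- move=> z; have /andP[_ z1] := in1_01 z.
  by apply: mulr_ge0; [rewrite subr_ge0|exact: kern_ge0].
- by move=> j; rewrite exprn_ge0// invr_ge0 ltW.
- by move=> j; rewrite exprn_ge0.
- by rewrite exprn_ge0.
- apply/andP; split; first by rewrite divr_ge0 ?exprn_ge0// ltW.
  rewrite ltr_pdivrMr// mul1r -powR_mulrn// /p /powR ifF ?pnatr_eq0// ltr_expR.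
  by rewrite ltr_pM2r ?ln_gt0 ?ltr1n// /s ltrDl.
- move=> j; rewrite le_eqVlt; apply/orP; left; apply/eqP.
  rewrite exprS mulrA -natrM !exprMn [2 ^+ j ^+ n]exprAC.
  move: (2 ^+ n ^+ j) ((p n)^-1 ^+ j) ((2 * 2)%:R ^+ n) => A B C; ring.
- move=> z; rewrite mulf_eq0 negb_or => /andP[z1 _].
  have ez1 : 1 < enorm z.
    by move: z1; rewrite in1E ltNge; case: (enorm z <= 1); rewrite ?subrr ?eqxx.
  have ex : exists j, enorm z < 2 ^+ j.+1.
    have zm := archi_boundP (enorm_ge0 z).
    exists (Num.bound (enorm z)); apply: (lt_trans zm); rewrite -natrX ltr_nat.
    by apply: ltn_trans (ltnSn _) (ltn_expl _ _).
  have [j jz jmin] := ex_minnP ex.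
  have zj : 2 ^+ j <= enorm z.
    case: j jz jmin => [|j] jz jmin; first by rewrite expr0 ltW.
    by rewrite leNgt; apply/negP => /jmin; rewrite ltnn.
  exists j; split; last by move=> i; exact: le_trans (coord_le_enorm z i) (ltW jz).
  rewrite in1E (lt_geF ez1) subr0 mul1r.
  apply: (le_trans (kern_le _ zj)); first by rewrite exprn_gt0.
  by rewrite powR_expr// exprVn.
Qed.

End kernel.

(** * The operator *)

Section integral_facts.
Context {R : realType} d (T : measurableType d) (mu : {measure set T -> \bar R}).
Local Open Scope ereal_scope.

(** Positive and negative parts are compared separately, which allows infinite integrals: it will be
    applied to the jump integral of [V] itself. *)
Lemma le_integral_measurable (f g : T -> \bar R) :
  measurable_fun setT f -> measurable_fun setT g -> (forall x, f x <= g x) ->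
  \int[mu]_x f x <= \int[mu]_x g x.
Proof.
move=> mf mg fg; rewrite integralE [leRHS]integralE.
apply: leeB; apply: ge0_le_integral => //.
- exact: measurable_funepos.
- exact: measurable_funepos.
- by move=> x _; apply: funepos_le; [move=> ? _|rewrite inE].
- exact: measurable_funeneg.
- exact: measurable_funeneg.
- by move=> x _; apply: funeneg_le; [move=> ? _|rewrite inE].
Qed.

Lemma integrable_EFin_dominated (f g : T -> R) :
  measurable_fun setT f -> measurable_fun setT g -> (forall x, `|f x| <= g x)%R ->
  \int[mu]_x (g x)%:E < +oo -> mu.-integrable setT (EFin \o f).
Proof.
move=> mf mg fg gi; apply/integrableP; split; first exact/measurable_EFinP.
apply: le_lt_trans gi; apply: ge0_le_integral => //.
- by apply: measurableT_comp => //; exact/measurable_EFinP.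
- exact/measurable_EFinP.
- by move=> x _; rewrite lee_fin.
Qed.

Lemma abse_integral_le (f g : T -> R) :
  measurable_fun setT f -> measurable_fun setT g -> (forall x, `|f x| <= g x)%R ->
  `|\int[mu]_x (f x)%:E| <= \int[mu]_x (g x)%:E.
Proof.
move=> mf mg fg; apply: (le_trans (le_abse_integral _ _ _)) => //.
  exact/measurable_EFinP.
apply: ge0_le_integral => //.
- by apply: measurableT_comp => //; exact/measurable_EFinP.
- exact/measurable_EFinP.
- by move=> x _; rewrite lee_fin.
Qed.

End integral_facts.

Section local_bounds.
Context {R : realType} {d : nat}.

Lemma ball0_bounded_domain (r : R) : 0 < r -> bounded_domain (ball (0 : 'rV[R]_d) r).
Proof.
move=> r0; split.
- by exists 0; exact: ballxx.
- exact: ball_open.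
(* The ball is star-shaped: it is a union of segments that share the centre. *)
- rewrite (_ : ball _ _ = \bigcup_(x in ball (0 : 'rV[R]_d) r)
      [set t *: x | t in `[0, 1 : R]%classic]).
    apply: bigcup_connected.
      exists 0 => x _; exists 0; last by rewrite scale0r.
      by rewrite /= in_itv/= lexx ler01.
    move=> x _; apply: connected_continuous_connected.
      exact: segment_connected.
    by apply: continuous_subspaceT; exact: scalel_continuous.
  apply/seteqP; split=> [x xr|_ [x xr [t t01 <-]]].
    by exists x => //; exists 1; [rewrite /= in_itv/= lexx ler01|rewrite scale1r].
  move: xr t01; rewrite -ball_normE /ball_/= !sub0r !normrN in_itv/= => xr /andP[t0 t1].
  by rewrite normrZ ger0_norm// (le_lt_trans _ xr)// ler_piMl.
- exists r; split; first exact: num_real.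
  move=> M rM x; rewrite -ball_normE /ball_/= sub0r normrN => xr.
  by rewrite ltW// (lt_trans xr).
Qed.

(** All the information carried by [lam] is condensed into one constant per ball, positive because
    it dominates [k]. *)
Lemma stable_class_local lam (b : 'rV[R]_d -> 'rV[R]_d) k : stable_class lam b k ->
  forall r : R, exists2 L, 0 < L & forall x, `|x| <= r ->
    enorm (b x) <= L /\ forall z, L^-1 <= k x z <= L.
Proof.
case=> _ _ k0 bD kD r; pose D := ball (0 : 'rV[R]_d) (`|r| + 1).
have BD : bounded_domain D by apply: ball0_bounded_domain; rewrite ltr_pwDr.
have DE x : `|x| <= r -> D x.
  move=> xr; rewrite /D -ball_normE /ball_/= sub0r normrN.
  by rewrite (le_lt_trans xr)// (le_lt_trans (ler_norm r))// ltrDl.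
exists (lam_dom lam D).
  have D0 : D 0 by apply: ballxx; rewrite ltr_pwDr.
  have /andP[_] := kD D BD 0 0 D0; exact: lt_le_trans (k0 _ _).
by move=> x /DE Dx; split; [exact: bD|move=> z; exact: kD].
Qed.

End local_bounds.

(** * The operator on functions of class C_b^2 *)

Section levy.
Context {R : realType} {d : nat}.
Variables (alpha : R) (lam : R -> R).
Hypothesis alpha12 : 0 < alpha < 2.
Variables (b : 'rV[R]_d -> 'rV[R]_d) (k : 'rV[R]_d -> 'rV[R]_d -> R).
Hypothesis hclass : stable_class lam b k.
Implicit Types (f g : 'rV[R]_d -> R) (x z : 'rV[R]_d).
Local Notation mu := (lebesgue_rV d).
Local Notation kern := (@kern R alpha d).

Let k_gt0 x z : 0 < k x z. Proof. by case: hclass. Qed.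

Let kern0 z : 0 <= kern z. Proof. exact: kern_ge0. Qed.

Definition levy f x z : R := f (x + z) - f x - in1 z * dotv (grad f x) z.

Definition levy_int f x : \bar R := (\int[mu]_z (levy f x z * (k x z * kern z))%:E)%E.

Lemma stable_opE f x :
  stable_op alpha b k f x = ((dotv (b x) (grad f x))%:E + levy_int f x)%E.
Proof. by []. Qed.

(** This is min(1, |z|^2) times the kernel, whose integrability says that the kernel is the density
    of a Levy measure. Up to a constant it dominates the jump integrand of every function of class
    C_b^2, uniformly for [x] in a ball. *)
Definition levy_dom z : R := (in1 z * enorm z ^+ 2 + (1 - in1 z)) * kern z.

Lemma in1_cases z : (enorm z <= 1 /\ in1 z = 1) \/ (1 < enorm z /\ in1 z = 0).
Proof. by rewrite in1E; case: leP => ?; [left|right]. Qed.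

Lemma levy_dom_ge0 z : 0 <= levy_dom z.
Proof.
apply: mulr_ge0 => //; have [[_ ->]|[_ ->]] := in1_cases z.
  by rewrite mul1r subrr addr0 sqr_ge0.
by rewrite mul0r add0r subr0.
Qed.

Lemma measurable_levy_dom : measurable_fun setT levy_dom.
Proof.
apply: measurable_funM; last exact: measurable_kern.
apply: measurable_funD.
  apply: measurable_funM; first exact: measurable_in1.
  by apply: measurable_funX; exact: measurable_enorm.
by apply: measurable_funB; [exact: measurable_cst|exact: measurable_in1].
Qed.

Lemma levy_dom_int : (\int[mu]_z (levy_dom z)%:E < +oo)%E.
Proof.
rewrite (eq_integral (fun z => (in1 z * enorm z ^+ 2 * kern z)%:E +
    ((1 - in1 z) * kern z)%:E)%E); last first.
  by move=> z _; rewrite -EFinD -mulrDl.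
rewrite ge0_integralD//.
- by rewrite lte_add_pinfty//; [exact: kern_small_integral|exact: kern_large_integral].
- move=> z _; rewrite lee_fin; apply: mulr_ge0 => //.
  by apply: mulr_ge0; [case/andP: (in1_01 z)|exact: sqr_ge0].
- apply/measurable_EFinP; apply: measurable_funM; last exact: measurable_kern.
  apply: measurable_funM; first exact: measurable_in1.
  by apply: measurable_funX; exact: measurable_enorm.
- move=> z _; rewrite lee_fin; apply: mulr_ge0 => //.
  by rewrite subr_ge0; case/andP: (in1_01 z).
- apply/measurable_EFinP; apply: measurable_funM; last exact: measurable_kern.
  by apply: measurable_funB; [exact: measurable_cst|exact: measurable_in1].
Qed.

Lemma levy_bound f : Ckb 2 f ->
  exists2 C, 0 <= C & forall x z, `|levy f x z| <= C * (in1 z * enorm z ^+ 2 + (1 - in1 z)).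
Proof.
move=> Cf; have [C C0 HC] := Ckb_taylor Cf.
have [M M0 HM] := Ckb_bounded Cf.
exists (C + 2 * M); first by rewrite addr_ge0// mulr_ge0.
move=> x z; rewrite /levy; have [[_ ->]|[_ ->]] := in1_cases z.
  rewrite mul1r subrr addr0 mul1r; apply: (le_trans (HC x z)).
  by rewrite ler_wpM2r ?sqr_ge0// lerDl mulr_ge0.
rewrite !mul0r subr0 add0r subr0 mulr1; apply: (le_trans (ler_normB _ _)).
by apply: (@le_trans _ _ (M + M)); [exact: lerD|rewrite mulrDl mul1r lerDr].
Qed.

Lemma measurable_grad f : Ck 1 f -> measurable_fun setT (grad f).
Proof.
move=> [_ Cf]; apply: measurable_fun_rV => i.
under eq_fun do rewrite mxE.
by apply: continuous_measurable_rV; have [_ [+ _]] := Cf i.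
Qed.

Lemma measurable_rV_add2 (e : measure_display) (T : measurableType e)
    (u v : T -> 'rV[R]_d) :
  measurable_fun setT u -> measurable_fun setT v ->
  measurable_fun setT (fun t => u t + v t).
Proof.
move=> mu' mv; apply: measurable_fun_rV => i.
under eq_fun do rewrite mxE.
apply: measurable_funD.
  exact: (measurableT_comp (@measurable_coord R d i) mu').
exact: (measurableT_comp (@measurable_coord R d i) mv).
Qed.

Lemma measurable_levy2 f : Ck 1 f ->
  measurable_fun setT (fun p : 'rV[R]_d * 'rV[R]_d => levy f p.1 p.2 * (k p.1 p.2 * kern p.2)).
Proof.
move=> Cf; have mf := continuous_measurable_rV (Ck_continuous Cf).
apply: measurable_funM; last first.
  apply: measurable_funM; first by case: hclass.
  exact: (measurableT_comp (@measurable_kern R alpha d) measurable_snd).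
apply: measurable_funB.
  apply: measurable_funB.
    by apply: (measurableT_comp mf); exact: measurable_rV_add2.
  exact: (measurableT_comp mf measurable_fst).
apply: measurable_funM.
  exact: (measurableT_comp (@measurable_in1 R d) measurable_snd).
apply: measurable_dotv => //.
exact: (measurableT_comp (measurable_grad Cf) measurable_fst).
Qed.

Lemma measurable_levy f x : Ck 1 f ->
  measurable_fun setT (fun z => levy f x z * (k x z * kern z)).
Proof.
by move=> Cf; exact: (measurable_fun_pair2 x (measurable_levy2 Cf)).
Qed.

Lemma measurable_k x : measurable_fun setT (k x).
Proof.
case: hclass => _ mk _ _ _.
exact: (measurable_fun_pair2 x mk).
Qed.

(** Tonelli is applied to the positive and negative parts in turn, so the integral may be infinite
    at some points. *)
Lemma measurable_levy_int f : Ck 1 f -> measurable_fun setT (levy_int f).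
Proof.
move=> Cf; have mF := measurable_levy2 Cf.
pose F (p : 'rV[R]_d * 'rV[R]_d) := (levy f p.1 p.2 * (k p.1 p.2 * kern p.2))%:E.
have mF' : measurable_fun setT F by exact/measurable_EFinP.
rewrite (_ : levy_int f = (fun x => fubini_F mu (F^\+)%E x - fubini_F mu (F^\-)%E x)%E).
  apply: emeasurable_funB; apply: measurable_fun_fubini_tonelli_F => //.
    exact: measurable_funepos.
  exact: measurable_funeneg.
apply/funext => x; rewrite /levy_int integralE /fubini_F.
by congr (_ - _)%E; apply: eq_integral => z _; rewrite ?funeposE ?funenegE.
Qed.

Lemma levy_kern_bound f (C L : R) x z :
  `|levy f x z| <= C * (in1 z * enorm z ^+ 2 + (1 - in1 z)) -> k x z <= L ->
  `|levy f x z * (k x z * kern z)| <= C * L * levy_dom z.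
Proof.
move=> HC kL; rewrite normrM /levy_dom.
rewrite [X in _ * X]ger0_norm; last by rewrite mulr_ge0// ltW.
rewrite (_ : C * L * _ = C * (in1 z * enorm z ^+ 2 + (1 - in1 z)) * (L * kern z)); last by ring.
apply: ler_pM => //; first by rewrite mulr_ge0// ltW.
exact: ler_wpM2r.
Qed.

Lemma levy_integrable f x : Ckb 2 f ->
  mu.-integrable setT (EFin \o (fun z => levy f x z * (k x z * kern z))).
Proof.
move=> Cf; have [C C0 HC] := levy_bound Cf.
have [L L0 HL] := stable_class_local hclass `|x|.
have [_ kL] := HL x (lexx _).
apply: (@integrable_EFin_dominated _ _ _ _ _ (fun z => C * L * levy_dom z)).
- by apply: measurable_levy; exact: CkW (Ckb_Ck Cf).
- by apply: measurable_funM; [exact: measurable_cst|exact: measurable_levy_dom].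
- by move=> z; apply: levy_kern_bound => //; case/andP: (kL z).
- under eq_integral do rewrite EFinM.
  rewrite ge0_integralZl_EFin//.
  + by rewrite lte_mul_pinfty// ?lee_fin ?mulr_ge0 ?(ltW L0)//; exact: levy_dom_int.
  + by move=> z _; rewrite lee_fin levy_dom_ge0.
  + by apply/measurable_EFinP; exact: measurable_levy_dom.
  + by rewrite mulr_ge0// ltW.
Qed.

Lemma levy_int_fin f x : Ckb 2 f -> levy_int f x \is a fin_num.
Proof. by move=> Cf; apply: integrable_fin_num => //; exact: levy_integrable. Qed.

Lemma stable_op_fin f x : Ckb 2 f -> stable_op alpha b k f x \is a fin_num.
Proof. by move=> Cf; rewrite stable_opE fin_numD levy_int_fin. Qed.

Lemma fine_stable_op f x : Ckb 2 f ->
  fine (stable_op alpha b k f x) = dotv (b x) (grad f x) + fine (levy_int f x).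
Proof. by move=> Cf; rewrite stable_opE fineD// levy_int_fin. Qed.

Lemma measurable_stable_op f : Ckb 2 f ->
  measurable_fun setT (fun x => fine (stable_op alpha b k f x)).
Proof.
move=> Cf; have C1 : Ck 1 f by exact: CkW (Ckb_Ck Cf).
under eq_fun do rewrite fine_stable_op//.
apply: measurable_funD.
  by apply: measurable_dotv; [case: hclass|exact: measurable_grad].
exact: (measurableT_comp (@fine_measurable R setT measurableT) (measurable_levy_int C1)).
Qed.

Lemma stable_op_local_bound f (r : R) : Ckb 2 f ->
  exists2 C, 0 <= C & forall x, `|x| <= r -> `|fine (stable_op alpha b k f x)| <= C.
Proof.
move=> Cf; have [C C0 HC] := levy_bound Cf.
have [L L0 HL] := stable_class_local hclass r.
have C1 : Ckb 1 f.
  have [cf Bf Df] := Cf; split=> // i; have [di Ci] := Df i; split=> //.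
  by have [] := Ci.
have [M M0 HM] := Ckb_grad_bounded C1.
have L1 : (\int[mu]_z (C * L * levy_dom z)%:E < +oo)%E.
  under eq_integral do rewrite EFinM.
  rewrite ge0_integralZl_EFin//.
  + by rewrite lte_mul_pinfty// ?lee_fin ?mulr_ge0 ?(ltW L0)//; exact: levy_dom_int.
  + by move=> z _; rewrite lee_fin levy_dom_ge0.
  + by apply/measurable_EFinP; exact: measurable_levy_dom.
  + by rewrite mulr_ge0// ltW.
have L2 : (0 <= \int[mu]_z (C * L * levy_dom z)%:E)%E.
  by apply: integral_ge0 => z _; rewrite lee_fin mulr_ge0 ?levy_dom_ge0 ?mulr_ge0 ?(ltW L0).
exists (d%:R * (L * (d%:R * M)) + fine (\int[mu]_z (C * L * levy_dom z)%:E)).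
  by apply: addr_ge0; [rewrite !mulr_ge0 ?(ltW L0)|exact: fine_ge0].
move=> x xr; have [bL kL] := HL x xr.
rewrite fine_stable_op//; apply: (le_trans (ler_normD _ _)); apply: lerD.
  apply: (le_trans (dotv_le _ _)); rewrite ler_wpM2l// ler_pM ?enorm_ge0//.
  apply: (le_trans (enorm_le_norm _)); rewrite ler_wpM2l//.
  by apply: norm_le_coord => // i; rewrite mxE.
rewrite -lee_fin fineK ?ge0_fin_numE// -abse_EFin fineK ?levy_int_fin//.
apply: abse_integral_le.
- by apply: measurable_levy; exact: CkW (Ckb_Ck Cf).
- by apply: measurable_funM; [exact: measurable_cst|exact: measurable_levy_dom].
- by move=> z; apply: levy_kern_bound => //; case/andP: (kL z).
Qed.

Lemma stable_op_lin f g (c : R) x : Ckb 2 f -> Ckb 2 g ->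
  fine (stable_op alpha b k (fun y => f y - c * g y) x) =
  fine (stable_op alpha b k f x) - c * fine (stable_op alpha b k g x).
Proof.
move=> Cf Cg.
have Eg : grad (fun y => f y - c * g y) x = grad f x - c *: grad g x.
  apply/rowP => i; rewrite !mxE /partial.
  have df : derivable f x (delta_mx ord0 i) by case: Cf => _ _ /(_ i)[+ _]; exact.
  have dg : derivable g x (delta_mx ord0 i) by case: Cg => _ _ /(_ i)[+ _]; exact.
  have := deriveB df (@derivableZ _ _ _ _ c _ _ dg); rewrite deriveZ//.
have dotE (u v w : 'rV[R]_d) : dotv w (u - c *: v) = dotv w u - c * dotv w v.
  rewrite /dotv mulr_sumr -sumrB; apply: eq_bigr => i _; rewrite !mxE; ring.
have dotE' (u v w : 'rV[R]_d) : dotv (u - c *: v) w = dotv u w - c * dotv v w.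
  rewrite /dotv mulr_sumr -sumrB; apply: eq_bigr => i _; rewrite !mxE; ring.
have key (p q u v : R) : p - c * q + (u - c * v) = p + u - c * (q + v) by ring.
have E : levy_int (fun y => f y - c * g y) x = (levy_int f x - c%:E * levy_int g x)%E.
  rewrite /levy_int -integralZl//; last exact: levy_integrable.
  rewrite -integralB//; [|exact: levy_integrable|]; last first.
    by apply: integrableZl => //; exact: levy_integrable.
  apply: eq_integral => z _; rewrite -EFinM -EFinB /levy Eg dotE'; congr EFin; ring.
transitivity (dotv (b x) (grad f x) + fine (levy_int f x) -
    c * (dotv (b x) (grad g x) + fine (levy_int g x))); last first.
  congr (_ - _ * _); first exact: esym (fine_stable_op x Cf).
  exact: esym (fine_stable_op x Cg).
rewrite stable_opE E Eg dotE fineD//; last first.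
  by rewrite fin_numB fin_numM// !levy_int_fin.
rewrite fineB ?fin_numM ?levy_int_fin// fineM ?levy_int_fin//.
exact: key.
Qed.

End levy.

(** * Cutoffs of the Lyapunov function and its tail integral *)

Section lyapunov.
Context {R : realType} {d : nat}.
Variables (alpha : R) (lam : R -> R).
Hypothesis alpha12 : 0 < alpha < 2.
Variables (b : 'rV[R]_d -> 'rV[R]_d) (k : 'rV[R]_d -> 'rV[R]_d -> R).
Hypothesis hclass : stable_class lam b k.
Implicit Types (f g : 'rV[R]_d -> R) (x z : 'rV[R]_d).
Local Notation mu := (lebesgue_rV d).
Local Notation kern := (@kern R alpha d).
Local Notation levy_int := (@levy_int R d alpha k).
Local Notation I := (stable_op alpha b k).

Let k_gt0 x z : 0 < k x z. Proof. by case: hclass. Qed.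

Let kern0 z : 0 <= kern z. Proof. exact: kern_ge0. Qed.

Lemma open_measurable_rV n (U : set 'rV[R]_n) : open U -> measurable U.
Proof. by move=> oU; exact: sub_sigma_algebra. Qed.

Lemma closed_measurable_rV n (U : set 'rV[R]_n) : closed U -> measurable U.
Proof.
move=> cU; rewrite -(setCK U); apply: measurableC; apply: open_measurable_rV.
exact: closed_openC.
Qed.

Lemma open_norm_lt (r : R) : open [set x : 'rV[R]_d | `|x| < r].
Proof.
have /open_comp := @open_lt R r.
by move=> /(_ 'rV[R]_d Num.norm); apply => x _; exact: norm_continuous.
Qed.

Lemma open_norm_gt (r : R) : open [set x : 'rV[R]_d | r < `|x|].
Proof.
have /open_comp := @open_gt R r.
by move=> /(_ 'rV[R]_d Num.norm); apply => x _; exact: norm_continuous.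
Qed.

Lemma near_norm_lt (r : R) x : `|x| < r -> \forall y \near x, `|y| < r.
Proof. by move=> xr; apply: open_nbhs_nbhs; split=> //; exact: open_norm_lt. Qed.

Lemma near_eq_grad f g x : (\forall y \near x, f y = g y) -> grad f x = grad g x.
Proof. by move=> fg; apply/rowP => i; rewrite !mxE; exact: near_eq_derive. Qed.

Lemma grad_eq0 f x : (\forall y \near x, f y = 0) -> grad f x = 0.
Proof.
move=> f0; rewrite (@near_eq_grad f (cst 0))//.
by apply/rowP => i; rewrite !mxE /partial derive_cst.
Qed.

Lemma dotv0r x : dotv x 0 = 0.
Proof. by rewrite /dotv big1// => i _; rewrite mxE mulr0. Qed.

Lemma dotv0l x : dotv 0 x = 0.
Proof. by rewrite /dotv big1// => i _; rewrite mxE mul0r. Qed.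

(** Multiplication by a function with values in [0, 1] keeps the order [f' <= f] everywhere, so that
    cutting off can only lower the contribution of large jumps. *)
Lemma cutoff f (r : R) : Ck 2 f -> (forall x, 0 <= f x) ->
  exists f', [/\ Ckb 2 f', forall x, 0 <= f' x <= f x & forall x, `|x| <= r -> f' x = f x].
Proof.
move=> Cf f0.
have [|psi [Cpsi psi01 psi1 psi0]] := @smooth_urysohn R d [set x | `|x| <= r]
    [set x | `|x| < r + 1] (@compact_norm_le R d r) (@open_norm_lt (r + 1)).
  by move=> x /= xr; rewrite (le_lt_trans xr)// ltrDl.
exists (fun x => psi x * f x); split.
- apply: (@Ckb_compact_support _ _ _ _ (r + 1)); first exact: CkM.
  by move=> x xr; rewrite psi0 ?mul0r//= => /(lt_trans xr); rewrite ltxx.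
- move=> x; have /andP[p0 p1] := psi01 x.
  by rewrite mulr_ge0//= ler_piMl.
- by move=> x xr; rewrite psi1// mul1r.
Qed.

Lemma levy0 f x z : (\forall y \near x, f y = 0) -> levy f x z = f (x + z).
Proof.
by move=> f0; rewrite /levy grad_eq0// (nbhs_singleton f0) dotv0l mulr0 !subr0.
Qed.

Lemma stable_op0 f x : Ckb 2 f -> (\forall y \near x, f y = 0) ->
  (I f x = \int[mu]_z (f (x + z) * (k x z * kern z))%:E)%E.
Proof.
move=> Cf f0; rewrite stable_opE grad_eq0// dotv0r add0e.
by apply: eq_integral => z _; rewrite levy0.
Qed.

Variable V : 'rV[R]_d -> R.
Hypotheses (CV : Ck 2 V) (V0 : forall x, 0 <= V x).

Let mV : measurable_fun setT V.
Proof. exact: continuous_measurable_rV (Ck_continuous CV). Qed.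

(** At [x] the two functions share value and gradient, hence drift and compensator; only the values
    at [x + z] differ, and those of [V'] are the smaller ones. *)
Lemma lyapunov_cutoff V' (r e : R) x : Ckb 2 V' -> (forall y, 0 <= V' y <= V y) ->
  (forall y, `|y| <= r -> V' y = V y) -> `|x| < r ->
  (I V x <= e%:E)%E -> fine (I V' x) <= e.
Proof.
move=> CV' V'V V'E xr IV.
rewrite -lee_fin fineK; last exact: (stable_op_fin alpha12 hclass).
apply: le_trans IV; rewrite !stable_opE.
have gE : grad V' x = grad V x.
  by apply: near_eq_grad; near=> y; apply: V'E; apply: ltW; near: y; exact: near_norm_lt.
rewrite gE; apply: leeD2l; apply: le_integral_measurable.
- by apply/measurable_EFinP; apply: (measurable_levy alpha hclass); exact: CkW (Ckb_Ck CV').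
- by apply/measurable_EFinP; apply: (measurable_levy alpha hclass); exact: CkW CV.
- move=> z; rewrite lee_fin ler_wpM2r//; first by rewrite mulr_ge0// ltW.
  rewrite /levy gE (V'E x (ltW xr)) !lerD2r.
  by have /andP[] := V'V (x + z).
Unshelve. all: by end_near. Qed.

(** The factor [k x z] is left out, being bounded above and below by positive constants for [x] in a
    ball: what remains can be compared between two points [x]. *)
Definition tail_int x : \bar R := (\int[mu]_z ((1 - in1 z) * V (x + z) * kern z)%:E)%E.

Let measurable_tail x : measurable_fun setT (fun z => (1 - in1 z) * V (x + z) * kern z).
Proof.
apply: measurable_funM; last exact: measurable_kern.
apply: measurable_funM.
  by apply: measurable_funB; [exact: measurable_cst|exact: measurable_in1].
apply: (measurableT_comp mV).
by apply: measurable_rV_add2; [exact: measurable_cst|exact: measurable_id].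
Qed.

Let in1C0 z : 0 <= 1 - in1 z.
Proof. by rewrite subr_ge0; case/andP: (in1_01 z). Qed.

Let tail_ge0 x z : 0 <= (1 - in1 z) * V (x + z) * kern z.
Proof. by rewrite !mulr_ge0. Qed.

(** The negative part of the jump integrand of [V] is at most that of a cutoff, which is integrable.
    The bound on [I V x] then controls the positive part, and so the large jumps, since [k] is
    bounded below. *)
Lemma lyapunov_tail_int x (e : R) : (I V x <= e%:E)%E -> (tail_int x < +oo)%E.
Proof.
move=> IV.
have [V' [CV' V'V V'E]] := cutoff (`|x| + 1) CV V0.
have xr : `|x| < `|x| + 1 by rewrite ltrDl.
have gE : grad V' x = grad V x.
  by apply: near_eq_grad; near=> y; apply: V'E; apply: ltW; near: y; exact: near_norm_lt.
have [L L0 HL] := stable_class_local hclass `|x|.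
have [_ kL] := HL x (lexx _).
pose F z := (levy V x z * (k x z * kern z))%:E.
pose F' z := (levy V' x z * (k x z * kern z))%:E.
have mF : measurable_fun setT F.
  by apply/measurable_EFinP; apply: (measurable_levy alpha hclass); exact: CkW CV.
have F'F z : (F' z <= F z)%E.
  rewrite lee_fin ler_wpM2r//; first by rewrite mulr_ge0// ltW.
  rewrite /levy gE (V'E x (ltW xr)) !lerD2r.
  by have /andP[] := V'V (x + z).
have iF' : mu.-integrable setT F' by exact: (levy_integrable alpha12 hclass).
have mF' : measurable_fun setT F' by case/integrableP: iF'.
have Fneg : (\int[mu]_z F^\- z < +oo)%E.
  apply: (@le_lt_trans _ _ (\int[mu]_z F'^\- z)%E).
    apply: ge0_le_integral => //.
    - exact: measurable_funeneg.
    - exact: measurable_funeneg.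
    - by move=> z _; apply: funeneg_le; [move=> ? _|rewrite inE].
  exact: (integral_funeneg_lt_pinfty measurableT iF').
(* An infinite positive part, next to a finite negative one, would make [I V x] infinite. *)
have Fpos : (\int[mu]_z F^\+ z < +oo)%E.
  rewrite ltNge leye_eq; apply/negP => /eqP Foo.
  move: IV; rewrite stable_opE /levy_int -/F integralE Foo.
  have : (0 <= \int[mu]_z F^\- z)%E by exact: integral_ge0.
  by case: (\int[mu]_z F^\- z)%E Fneg.
have kint : (\int[mu]_z (V x * L * ((1 - in1 z) * kern z))%:E < +oo)%E.
  under eq_integral do rewrite EFinM.
  rewrite ge0_integralZl_EFin//.
  + by rewrite lte_mul_pinfty// ?lee_fin ?mulr_ge0 ?(ltW L0)//; exact: kern_large_integral.
  + by move=> z _; rewrite lee_fin mulr_ge0.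
  + apply/measurable_EFinP; apply: measurable_funM; last exact: measurable_kern.
    by apply: measurable_funB; [exact: measurable_cst|exact: measurable_in1].
  + by rewrite mulr_ge0// ltW.
have mk : measurable_fun setT (fun z => V x * L * ((1 - in1 z) * kern z)).
  apply: measurable_funM; first exact: measurable_cst.
  apply: measurable_funM; last exact: measurable_kern.
  by apply: measurable_funB; [exact: measurable_cst|exact: measurable_in1].
(* For large [z], V(x+z) k is the sum of (V(x+z) - V(x)) k, at most the positive part once
   multiplied by the kernel, and of V(x) k, at most V(x) L; the outer factor [L] pays for the lower
   bound [L^-1 <= k]. *)
apply: (@le_lt_trans _ _ (\int[mu]_z (L%:E * (F^\+ z + (V x * L * ((1 - in1 z) * kern z))%:E)))%E).
  apply: ge0_le_integral => //.
  - by move=> z _; rewrite lee_fin.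
  - exact/measurable_EFinP.
  - apply: emeasurable_funM; first exact: measurable_cst.
    by apply: emeasurable_funD; [exact: measurable_funepos|exact/measurable_EFinP].
  - move=> z _.
    apply: (@le_trans _ _ (L * (Num.max (fine (F z)) 0 + V x * L * ((1 - in1 z) * kern z)))%:E); last first.
      by rewrite funeposE EFinM EFinD EFin_max lexx.
    rewrite lee_fin /F/=.
    have /andP[k1 k2] := kL z.
    have Lk : 1 <= L * k x z by rewrite -ler_pdivrMl// mulr1.
    have [[_ ->]|[_ E]] := in1_cases z.
      rewrite subrr !mul0r mulr0 addr0 mulr_ge0 ?(ltW L0)//.
      by rewrite le_max lexx orbT.
    rewrite /levy E subr0 mul0r subr0 !mul1r.
    apply: (@le_trans _ _ (L * k x z * (V (x + z) * kern z))).
      by rewrite ler_peMl// mulr_ge0.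
    rewrite -mulrA; apply: ler_wpM2l; first exact: ltW.
    apply: (@le_trans _ _ ((V (x + z) - V x) * (k x z * kern z) + V x * L * kern z)); last first.
      by rewrite lerD2r le_max lexx.
    have : V x * (k x z * kern z) <= V x * (L * kern z).
      by apply: ler_wpM2l => //; exact: ler_wpM2r.
    move: (k x z) (kern z) (V x) (V (x + z)) => u v w y; nra.
rewrite ge0_integralZl_EFin//; last 3 first.
- by move=> z _; rewrite adde_ge0// lee_fin !mulr_ge0// ltW.
- by apply: emeasurable_funD; [exact: measurable_funepos|exact/measurable_EFinP].
- exact: ltW.
rewrite lte_mul_pinfty ?lee_fin ?(ltW L0)//.
rewrite ge0_integralD//.
- by rewrite lte_add_pinfty.
- exact: measurable_funepos.
- by move=> z _; rewrite lee_fin !mulr_ge0// ltW.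
- exact/measurable_EFinP.
Unshelve. all: by end_near. Qed.

End lyapunov.

(** * Bounds on the Lyapunov function that are uniform on balls *)

Section compact_estimates.
Context {R : realType} {d : nat}.
Variables (alpha : R) (lam : R -> R).
Hypothesis alpha12 : 0 < alpha < 2.
Variables (b : 'rV[R]_d -> 'rV[R]_d) (k : 'rV[R]_d -> 'rV[R]_d -> R).
Hypothesis hclass : stable_class lam b k.
Implicit Types (f g : 'rV[R]_d -> R) (x z : 'rV[R]_d).
Local Notation mu := (lebesgue_rV d).
Local Notation kern := (@kern R alpha d).
Local Notation levy_int := (@levy_int R d alpha k).
Local Notation I := (stable_op alpha b k).

Let k_gt0 x z : 0 < k x z. Proof. by case: hclass. Qed.

Let kern0 z : 0 <= kern z. Proof. exact: kern_ge0. Qed.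

Let s0 : 0 < d%:R + alpha. Proof. by rewrite ltr_wpDl//; case/andP: alpha12. Qed.

Let in1C0 z : 0 <= 1 - in1 z.
Proof. by rewrite subr_ge0; case/andP: (in1_01 z). Qed.

Lemma kern_le1 z : 1 < enorm z -> kern z <= 1.
Proof.
move=> z1; apply: (le_trans (kern_le alpha12 ltr01 (ltW z1))).
by rewrite powR1 invr1.
Qed.

Lemma kern_ge z (r : R) : z != 0 -> enorm z <= r -> (r `^ (d%:R + alpha))^-1 <= kern z.
Proof.
move=> z0 zr; have ez : 0 < enorm z.
  rewrite lt_neqAle enorm_ge0 andbT eq_sym.
  by apply: contra_neq z0 => /enorm_eq0.
rewrite lef_pV2 ?posrE ?powR_gt0//; last exact: lt_le_trans zr.
apply: ge0_ler_powR; rewrite ?nnegrE ?enorm_ge0//; first exact: ltW.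
exact: le_trans (ltW ez) zr.
Qed.

(** As [y + a] has length more than 1, adding at most D to its norm multiplies it by at most 1 + D;
    the factor d pays for passing from one norm to the other. *)
Lemma kern_shift y a (D : R) : (0 < d)%N -> `|a| <= D -> 1 < enorm y -> 1 < enorm (y + a) ->
  kern (y + a) <= (d%:R * (1 + D)) `^ (d%:R + alpha) * kern y.
Proof.
move=> d0 aD y1 ya1; have D0 : 0 <= D by exact: le_trans aD.
have dD : 0 < d%:R * (1 + D) by rewrite mulr_gt0 ?ltr0n// ltr_wpDr.
have yya : enorm y <= d%:R * (1 + D) * enorm (y + a).
  apply: (le_trans (enorm_le_norm _)); rewrite -mulrA ler_wpM2l//.
  rewrite mulrDl mul1r -[y in `|y|](addrK a); apply: (le_trans (ler_normB _ _)).
  apply: lerD; first exact: norm_le_enorm.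
  by apply: (le_trans aD); rewrite ler_peMr// ltW.
have y0 : 0 < enorm y by exact: lt_trans y1.
have ya0 : 0 < enorm (y + a) by exact: lt_trans ya1.
rewrite /kern ler_pdivlMr ?powR_gt0// ler_pdivrMl ?powR_gt0// mulrC.
rewrite -powRM ?(ltW dD) ?enorm_ge0//.
apply: ge0_ler_powR => //; rewrite ?nnegrE ?enorm_ge0//; first exact: ltW.
by rewrite mulr_ge0 ?enorm_ge0// ltW.
Qed.

Lemma CkbB n f g (c : R) : Ckb n f -> Ckb n g -> Ckb n (fun x => f x - c * g x).
Proof.
elim: n f g => [|n IH] f g [cf [Mf HMf] Hf] [cg [Mg HMg] Hg].
  split=> //; first by case: (@CkB R d 0 f (fun x => c * g x)) => //; apply: CkZ.
  exists (Mf + `|c| * Mg) => x; apply: (le_trans (ler_normB _ _)).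
  by rewrite lerD// normrM ler_wpM2l.
split.
- by case: (@CkB R d 0 f (fun x => c * g x)) => //; apply: CkZ.
- exists (Mf + `|c| * Mg) => x; apply: (le_trans (ler_normB _ _)).
  by rewrite lerD// normrM ler_wpM2l.
move=> i; have [df Cf] := Hf i; have [dg Cg] := Hg i.
have D x : is_derive x (delta_mx ord0 i) (fun x => f x - c * g x)
    (partial i f x - c * partial i g x).
  have /derivableP := df x; have /derivableP := dg x => dg' df'.
  exact: is_deriveB df' (@is_deriveZ _ _ _ _ c _ _ _ dg').
split=> [x|]; first by case: (D x).
rewrite (_ : partial i _ = fun x => partial i f x - c * partial i g x); first exact: IH.
by apply/funext => x; rewrite /partial; case: (D x).
Qed.

Variable V : 'rV[R]_d -> R.
Hypotheses (CV : Ck 2 V) (V0 : forall x, 0 <= V x).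

Let mV : measurable_fun setT V.
Proof. exact: continuous_measurable_rV (Ck_continuous CV). Qed.

Let measurable_tail x : measurable_fun setT (fun z => (1 - in1 z) * V (x + z) * kern z).
Proof.
apply: measurable_funM; last exact: measurable_kern.
apply: measurable_funM.
  by apply: measurable_funB; [exact: measurable_cst|exact: measurable_in1].
apply: (measurableT_comp mV).
by apply: measurable_rV_add2; [exact: measurable_cst|exact: measurable_id].
Qed.

Let tail_ge0 x z : 0 <= (1 - in1 z) * V (x + z) * kern z.
Proof. by rewrite !mulr_ge0. Qed.

Lemma in1_int : (\int[mu]_z (@in1 R d z)%:E < +oo)%E.
Proof.
apply: (@le_lt_trans _ _ (\int[mu]_z
    (\1_[set v : 'rV[R]_d | forall i, (`|v ord0 i| <= 1)%R] z : R)%:E)%E).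
  apply: ge0_le_integral => //.
  - by move=> z _; rewrite lee_fin; case/andP: (in1_01 z).
  - by apply/measurable_EFinP; exact: measurable_in1.
  - by apply/measurable_EFinP/measurable_indic; exact: measurable_box.
  move=> z _; rewrite lee_fin; have [[z1 ->]|[_ ->]] := in1_cases z; last first.
    by rewrite indicE.
  rewrite indicE mem_set// => i; exact: le_trans (coord_le_enorm z i) z1.
rewrite integral_indic//; last exact: measurable_box.
by rewrite setIT; have /= -> := lebesgue_rV_cube d (@ler01 R); rewrite ltry.
Qed.

(** A translation by [x0 - x] gives both tail integrals the same factor V(x0 + y), leaving only the
    kernels to be compared. *)
Lemma tail_int_bound x0 (r : R) : (0 < d)%N -> (tail_int alpha V x0 < +oo)%E ->
  exists2 B, 0 <= B & forall x, `|x| <= r -> (tail_int alpha V x <= B%:E)%E.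
Proof.
move=> d0 Vx0; pose D := r + `|x0|.
have [M HM] : exists M : R, forall x, `|x| <= `|x0| + 1 -> `|V x| <= M.
  exact: continuous_bounded_ball (Ck_continuous CV).
have M0 : 0 <= M by apply: le_trans (HM x0 _); rewrite ?lerDl.
pose kap := (d%:R * (1 + D)) `^ (d%:R + alpha).
have kap0 : 0 <= kap by exact: powR_ge0.
(* For |y| <= 1 the shifted kernel is at most 1 where it counts and V(x0 + y) is at most [M]; for
   |y| > 1 the two kernels are comparable with constant [kap]. *)
pose H y := (M%:E * (in1 y)%:E + kap%:E * ((1 - in1 y) * V (x0 + y) * kern y)%:E)%E.
have mH1 : measurable_fun setT (fun y => (M * @in1 R d y)%:E)%E.
  apply/measurable_EFinP; apply: measurable_funM; first exact: measurable_cst.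
  exact: measurable_in1.
have mH2 : measurable_fun setT (fun y => (kap * ((1 - in1 y) * V (x0 + y) * kern y))%:E)%E.
  apply/measurable_EFinP; apply: measurable_funM; first exact: measurable_cst.
  exact: measurable_tail.
have in10 y : 0 <= @in1 R d y by case/andP: (in1_01 y).
have H0 y : (0 <= H y)%E.
  by rewrite adde_ge0// -EFinM lee_fin mulr_ge0.
have Hoo : (\int[mu]_y H y < +oo)%E.
  rewrite ge0_integralD//; first last.
  - by move=> y _; rewrite -EFinM lee_fin mulr_ge0.
  - by move=> y _; rewrite -EFinM lee_fin mulr_ge0.
  rewrite !ge0_integralZl_EFin//.
  - by apply: lte_add_pinfty; rewrite lte_mul_pinfty ?lee_fin//; exact: in1_int.
  - by move=> y _; rewrite lee_fin.
  - exact/measurable_EFinP.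
  - by move=> y _; rewrite lee_fin.
  - by apply/measurable_EFinP; exact: measurable_in1.
have Hi0 : (0 <= \int[mu]_y H y)%E by exact: integral_ge0.
exists (fine (\int[mu]_y H y)); first exact: fine_ge0.
move=> x xr; rewrite fineK ?ge0_fin_numE//.
rewrite /tail_int -(ge0_integral_translate (x0 - x)); last 2 first.
- exact/measurable_EFinP.
- by move=> z; rewrite lee_fin.
apply: ge0_le_integral => //.
- by move=> z _; rewrite lee_fin.
- apply/measurable_EFinP.
  by apply: (measurableT_comp (measurable_tail x)); exact: measurable_rV_add.
- by apply: emeasurable_funD.
move=> y _; rewrite /H -!EFinM -EFinD lee_fin.
rewrite (_ : x + (y + (x0 - x)) = x0 + y); last by rewrite [LHS]addrC -addrA subrK addrC.
have [[_ ->]|[ya1 ->]] := in1_cases (y + (x0 - x)).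
  by rewrite subrr !mul0r addr_ge0// mulr_ge0.
rewrite subr0 mul1r; have [[y1 ->]|[y1 ->]] := in1_cases y.
  rewrite subrr !mul0r !mulr0 addr0 mulr1.
  apply: (@le_trans _ _ (V (x0 + y))).
    by rewrite ler_piMr// kern_le1.
  apply: (le_trans (ler_norm _)); apply: HM; apply: (le_trans (ler_normD _ _)).
  by rewrite lerD2l (le_trans (norm_le_enorm _)).
rewrite mulr0 add0r subr0 mul1r mulrCA ler_wpM2l//.
apply: kern_shift => //; apply: (le_trans (ler_normB _ _)).
by rewrite addrC lerD2r.
Qed.

(** The constant must serve all cutoffs at once. They are compared with a fixed one, [W]: the
    difference vanishes near [x] and at all points reached by jumps of length at most 1, so the
    operator applied to it sees only large jumps and is at most [L] times the tail integral. *)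
Lemma lyapunov_compact_bound x0 (r : R) : (0 < d)%N -> (tail_int alpha V x0 < +oo)%E ->
  exists2 C, 0 <= C & forall V', Ckb 2 V' -> (forall y, 0 <= V' y <= V y) ->
    (forall y, `|y| <= r + 2 -> V' y = V y) ->
    forall x, `|x| <= r -> fine (I V' x) <= C.
Proof.
move=> d0 Vx0.
have [W [CW WV WE]] := cutoff (r + 2) CV V0.
have [C C0 HC] := stable_op_local_bound alpha12 hclass r CW.
have [L L0 HL] := stable_class_local hclass r.
have [B B0 HB] := tail_int_bound r d0 Vx0.
exists (C + L * B); first by rewrite addr_ge0// mulr_ge0// ltW.
move=> V' CV' V'V V'E x xr.
have [_ kL] := HL x xr.
(* The factor 1 is kept so that the difference has the form required by [stable_op_lin]. *)
have CD : Ckb 2 (fun y => V' y - 1 * W y) by exact: CkbB.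
have D0 : \forall y \near x, V' y - 1 * W y = 0.
  have xr2 : `|x| < r + 2 by rewrite (le_lt_trans xr)// ltrDl.
  near=> y; have yr : `|y| <= r + 2 by apply: ltW; near: y; exact: near_norm_lt.
  by rewrite V'E// WE// mul1r subrr.
have key (u v : R) : u = u - 1 * v + v by ring.
have eq_le (u v : R) : u = v -> u <= v by move=> ->.
rewrite (key (fine (I V' x)) (fine (I W x))) [leRHS]addrC.
apply: lerD; last by apply: (le_trans (ler_norm _)); exact: HC.
have E : fine (I V' x) - 1 * fine (I W x) = fine (I (fun y => V' y - 1 * W y) x).
  exact: esym (stable_op_lin alpha12 hclass 1 x CV' CW).
apply: (@le_trans _ _ (fine (I (fun y => V' y - 1 * W y) x))).
  by apply: eq_le; exact: E.
rewrite -lee_fin fineK; last exact: (stable_op_fin alpha12 hclass).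
have E2 := stable_op0 alpha b k CD D0.
apply: (@le_trans _ _ (\int[mu]_z (L%:E * ((1 - in1 z) * V (x + z) * kern z)%:E))%E).
  rewrite E2; apply: le_integral_measurable.
  - apply/measurable_EFinP; apply: measurable_funM.
      apply: (measurableT_comp (continuous_measurable_rV (Ck_continuous (Ckb_Ck CD)))).
      by apply: measurable_rV_add2; [exact: measurable_cst|exact: measurable_id].
    by apply: measurable_funM; [exact: (measurable_k hclass)|exact: measurable_kern].
  - by apply: emeasurable_funM; [exact: measurable_cst|exact/measurable_EFinP].
  move=> z; rewrite -EFinM lee_fin.
  have /andP[k1 k2] := kL z.
  have [[z1 ->]|[_ ->]] := in1_cases z.
    have xz : `|x + z| <= r + 2.
      apply: (le_trans (ler_normD _ _)); apply: lerD => //.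
      by apply: (le_trans (norm_le_enorm z)); apply: (le_trans z1); rewrite ler1n.
    by rewrite V'E// WE// mul1r !subrr !mul0r mulr0.
  rewrite subr0 !mul1r.
  apply: (@le_trans _ _ (V (x + z) * (k x z * kern z))).
    apply: ler_wpM2r; first by rewrite mulr_ge0// ltW.
    have /andP[_ V'1] := V'V (x + z); have /andP[W0 _] := WV (x + z).
    by rewrite lerBlDr (le_trans V'1)// lerDl.
  by rewrite mulrCA; apply: ler_wpM2r k2; rewrite mulr_ge0.
rewrite ge0_integralZl_EFin//; last 3 first.
- by move=> z _; rewrite lee_fin.
- exact/measurable_EFinP.
- exact: ltW.
rewrite EFinM; apply: lee_wpmul2l; first by rewrite lee_fin ltW.
exact: HB.
Unshelve. all: by end_near. Qed.

End compact_estimates.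

(** * Jump rates into a set of positive measure *)

Section jumps.
Context {R : realType} {d : nat}.
Variables (alpha : R) (lam : R -> R).
Hypothesis alpha12 : 0 < alpha < 2.
Variables (b : 'rV[R]_d -> 'rV[R]_d) (k : 'rV[R]_d -> 'rV[R]_d -> R).
Hypothesis hclass : stable_class lam b k.
Implicit Types (f g : 'rV[R]_d -> R) (x z : 'rV[R]_d).
Local Notation mu := (lebesgue_rV d).
Local Notation kern := (@kern R alpha d).
Local Notation I := (stable_op alpha b k).

Let k_gt0 x z : 0 < k x z. Proof. by case: hclass. Qed.

Let kern0 z : 0 <= kern z. Proof. exact: kern_ge0. Qed.

Lemma jump_ge0 g x : Ckb 2 g -> (forall y, 0 <= g y) -> (\forall y \near x, g y = 0) ->
  0 <= fine (I g x).
Proof.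
move=> Cg g0 gx; apply: fine_ge0; have E := stable_op0 alpha b k Cg gx.
rewrite E; apply: integral_ge0 => z _.
by rewrite lee_fin; apply: mulr_ge0 => //; apply: mulr_ge0 => //; exact: ltW.
Qed.

Lemma lebesgue_rV_compact_lty (G : set 'rV[R]_d) : compact G -> (mu G < +oo)%E.
Proof.
move=> cG; have [B [_ HB]] := compact_bounded cG.
have B0 : 0 <= Num.max (B + 1) 0 by rewrite le_max lexx orbT.
apply: (@le_lt_trans _ _
    (mu [set v : 'rV[R]_d | forall i, `|v ord0 i| <= Num.max (B + 1) 0])); last first.
  by have /= -> := lebesgue_rV_cube d B0; rewrite ltry.
apply: le_measure; rewrite ?inE.
- apply: closed_measurable_rV; apply: compact_closed => //; exact: norm_hausdorff.
- exact: measurable_box.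
move=> x Gx i; apply: (le_trans (coord_le_norm x i)).
by rewrite le_max HB// ltrDl.
Qed.

(* When g vanishes near x, [I g x] is the mean of g under the jump kernel at x. *)
Lemma jump_lower (G : set 'rV[R]_d) (r : R) : compact G -> (0 < mu G)%E -> (0 < d)%N ->
  exists2 c, 0 < c & forall g, Ckb 2 g -> (forall x, 0 <= g x) ->
    (forall x, G x -> g x = 1) -> forall x, `|x| <= r ->
    (\forall y \near x, g y = 0) -> c <= fine (I g x).
Proof.
move=> cG G0 d0.
have mG : measurable G.
  by apply: closed_measurable_rV; apply: compact_closed => //; exact: norm_hausdorff.
have [B [_ HB]] := compact_bounded cG.
have [L L0 HL] := stable_class_local hclass r.
(* An upper bound for the Euclidean length of a jump from the ball of radius [r] into [G]. *)
pose rho := d%:R * (`|r| + `|B + 1| + 1).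
have rho0 : 0 < rho by rewrite mulr_gt0 ?ltr0n// ltr_wpDl.
pose c0 := L^-1 * (rho `^ (d%:R + alpha))^-1.
have c00 : 0 < c0 by rewrite mulr_gt0// invr_gt0// powR_gt0.
have Goo := lebesgue_rV_compact_lty cG.
exists (c0 * fine (mu G)).
  by rewrite mulr_gt0// fine_gt0// G0.
move=> g Cg g0 gG x xr gx.
have [_ kL] := HL x xr.
rewrite -lee_fin fineK; last exact: (stable_op_fin alpha12 hclass).
have E := stable_op0 alpha b k Cg gx.
apply: (@le_trans _ _ (\int[mu]_z (c0 * \1_G (z + x))%:E)%E).
  under eq_integral do rewrite EFinM.
  have mi : measurable_fun setT (fun z : 'rV[R]_d => (\1_G z : R)%:E).
    by apply/measurable_EFinP; exact: measurable_indic.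
  rewrite ge0_integralZl_EFin//; last 2 first.
  - apply/measurable_EFinP.
    by apply: (measurableT_comp (measurable_indic mG)); exact: measurable_rV_add.
  - exact: ltW.
  rewrite (ge0_integral_translate x mi); last by move=> z; rewrite lee_fin.
  by rewrite integral_indic// setIT EFinM fineK// ge0_fin_numE.
rewrite E; apply: ge0_le_integral => //.
- by move=> z _; rewrite lee_fin mulr_ge0// ltW.
- apply/measurable_EFinP; apply: measurable_funM; first exact: measurable_cst.
  by apply: (measurableT_comp (measurable_indic mG)); exact: measurable_rV_add.
- apply/measurable_EFinP; apply: measurable_funM.
    apply: (measurableT_comp (continuous_measurable_rV (Ck_continuous (Ckb_Ck Cg)))).
    by apply: measurable_rV_add2; [exact: measurable_cst|exact: measurable_id].
  by apply: measurable_funM; [exact: (measurable_k hclass)|exact: measurable_kern].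
move=> z _; rewrite lee_fin [z + x]addrC.
have kk0 : 0 <= k x z * kern z by rewrite mulr_ge0// ltW.
rewrite indicE; case: (boolP (x + z \in G)) => xzG; last first.
  by rewrite mulr0 mulr_ge0.
rewrite inE in xzG; rewrite mulr1 (gG _ xzG) mul1r.
have /andP[k1 _] := kL z.
apply: ler_pM => //; rewrite ?invr_ge0 ?powR_ge0 ?(ltW L0)//.
apply: kern_ge => //.
  (* A zero jump would put [x] itself in [G], where [g] is 1, although [g] vanishes near [x]. *)
  apply/eqP => z0; move: xzG; rewrite z0 addr0 => /gG.
  by rewrite (nbhs_singleton gx) => /eqP; rewrite eq_sym oner_eq0.
apply: (le_trans (enorm_le_norm _)); rewrite ler_wpM2l//.
rewrite -[z in `|z|](addKr x) addrC; apply: (le_trans (ler_normB _ _)).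
rewrite addrC -addrA; apply: lerD.
  exact: le_trans (ler_norm r).
apply: (@le_trans _ _ (B + 1)); first by apply: HB => //; rewrite ltrDl.
by apply: (le_trans (ler_norm _)); rewrite lerDl.
Qed.

End jumps.

(** * Cadlag paths and optional stopping *)

Section grid.
Context {R : realType}.

(* For s >= 0, the least multiple of 1/(n+1) that is strictly above s;
   [Num.trunc] is 0 on negative arguments. *)
Definition grid_above (n : nat) (s : R) : R :=
  (Num.trunc (s * n.+1%:R)).+1%:R / n.+1%:R.

Lemma grid_above_gt n s : s < grid_above n s.
Proof. by rewrite ltr_pdivlMr ?ltr0n// truncnS_gt. Qed.

Lemma grid_above_le n s : 0 <= s -> grid_above n s <= s + n.+1%:R^-1.
Proof.
move=> s0; rewrite ler_pdivrMr ?ltr0n// mulrDl mulVf ?pnatr_eq0//.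
by rewrite -addn1 natrD lerD2r truncn_le mulr_ge0.
Qed.

Lemma grid_above_cvg s : 0 <= s -> grid_above n s @[n --> \oo] --> s.
Proof.
move=> s0; apply: (@squeeze_cvgr _ _ _ _ (fun=> s) (fun n => s + n.+1%:R^-1)).
- by apply: nearW => n; rewrite ltW ?grid_above_gt//= grid_above_le.
- exact: cvg_cst.
- rewrite -[X in _ --> X]addr0; apply: cvgD; first exact: cvg_cst.
  exact: cvg_harmonic.
Qed.

Lemma trunc_grid_itv (n j : nat) :
  [set s : R | 0 <= s /\ Num.trunc (s * n.+1%:R) = j] =
  `[j%:R / n.+1%:R, j.+1%:R / n.+1%:R[%classic.
Proof.
have n0 : 0 < n.+1%:R :> R by rewrite ltr0n.
apply/seteqP; split=> [s [s0 <-]|s] /=; rewrite in_itv/=.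
  by rewrite ler_pdivrMr// ltr_pdivlMr// truncn_itv// mulr_ge0// ltW.
rewrite ler_pdivrMr// ltr_pdivlMr// => H; split; last exact: truncn_def.
by move: H => /andP[/(le_trans _) H _]; rewrite -(pmulr_lge0 _ n0) H.
Qed.

(** Reading the path at the next grid point gives step functions; that point is strictly to the
    right and tends to s, so right-continuity yields pointwise convergence. *)
Lemma right_continuous_measurable (Y : R -> R) :
  (forall t, 0 <= t -> Y s @[s --> t^'+] --> Y t) ->
  measurable_fun ([set` `[0, +oo[] : set R) Y.
Proof.
move=> rc; apply: (@measurable_fun_cvg _ _ _ _ (fun n s => Y (grid_above n s))).
- move=> n _ B mB.
  rewrite (_ : _ `&` _ = \bigcup_(j in [set j | B (Y (j.+1%:R / n.+1%:R))])
      `[j%:R / n.+1%:R, j.+1%:R / n.+1%:R[%classic).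
    by apply: bigcup_measurable => j _; exact: measurable_itv.
  apply/seteqP; split=> [s [/=]|s [j /= Bj]].
    rewrite in_itv/= andbT => s0 Bs; exists (Num.trunc (s * n.+1%:R)) => //.
    by rewrite -trunc_grid_itv.
  move=> sI; have : `[j%:R / n.+1%:R, j.+1%:R / n.+1%:R[%classic s by exact: sI.
  rewrite -trunc_grid_itv => -[s0 sj]; split; first by rewrite /= in_itv/= s0.
  by rewrite /= /grid_above sj.
- move=> t; rewrite /= in_itv/= andbT => t0.
  have /cvg_at_rightP := rc t t0; apply; split; last exact: grid_above_cvg.
  by move=> n; exact: grid_above_gt.
Qed.

End grid.

Lemma itv_lty {R : realType} (a c : bool) (x y : R) :
  (@lebesgue_measure R [set` Interval (BSide a x) (BSide c y)] < +oo)%E.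
Proof. by rewrite lebesgue_measure_itv/=; case: ifP => _; rewrite ?ltry. Qed.

Lemma fine_itv {R : realType} (a c : bool) (x y : R) : x <= y ->
  fine (@lebesgue_measure R [set` Interval (BSide a x) (BSide c y)]) = y - x.
Proof.
rewrite le_eqVlt => /predU1P[->|xy]; rewrite lebesgue_measure_itv/= lte_fin.
  by rewrite ltxx/= subrr.
by rewrite xy.
Qed.

(** * Boundedness and time integrals along a cadlag path *)

Section cadlag.
Context {R : realType} {d : nat}.
Variable p : R -> 'rV[R]_d.
Hypothesis rc : forall t, 0 <= t -> p s @[s --> t^'+] --> p t.
Hypothesis ll : forall t, 0 < t -> cvg (p s @[s --> t^'-]).

(** Near each time the path is bounded on the right by right-continuity and on the left by the
    existence of a left limit; compactness of [0, t] does the rest. *)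
Lemma cadlag_bounded (t : R) : exists B : R, forall s, 0 <= s <= t -> `|p s| <= B.
Proof.
have cI : compact `[0, t]%classic by exact: segment_compact.
have /compact_near_coveringP H := cI.
pose P (B s : R) : Prop := 0 <= s -> `|p s| <= B.
have [|B [_ HB]] := H R (+oo%R) P _.
- move=> s; rewrite /= in_itv/= => /andP[s0 st].
  have [M HM] : exists M : R, \forall s' \near s, 0 <= s' -> `|p s'| <= M.
    have Hr : \forall s' \near s^'+, `|p s'| <= `|p s| + 1.
      have /cvgrPdist_lt /(_ 1 ltr01) := rc s0.
      apply: filterS => u pu; rewrite -[p u](subrK (p s)).
      apply: (le_trans (ler_normD _ _)); rewrite addrC lerD2l distrC; exact: ltW.
    have [M2 Hl] : exists M2 : R, \forall s' \near s^'-, 0 <= s' -> `|p s'| <= M2.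
      move: s0; rewrite le_eqVlt => /predU1P[<-|s0].
        exists 0; apply: filterS (nbhs_left_lt 0) => u u0.
        by rewrite leNgt u0.
      have /cvg_ex[l /cvgrPdist_lt /(_ 1 ltr01) pl] := ll s0.
      exists (`|l| + 1); apply: filterS pl => u pu _; rewrite -[p u](subrK l).
      apply: (le_trans (ler_normD _ _)); rewrite addrC lerD2l distrC; exact: ltW.
    exists (Num.max (`|p s| + 1) M2).
    have {}Hr : \forall u \near s, s < u -> `|p u| <= `|p s| + 1 by exact: Hr.
    have {}Hl : \forall u \near s, u < s -> 0 <= u -> `|p u| <= M2 by exact: Hl.
    near=> u => u0.
    have [us|us|->] := ltgtP u s.
    + rewrite le_max; apply/orP; right.
      by move: us u0; near: u; exact: Hl.
    + rewrite le_max; apply/orP; left.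
      by move: us; near: u; exact: Hr.
    + by rewrite le_max lerDl ler01.
  exists ([set s' | 0 <= s' -> `|p s'| <= M], [set B | M < B]) => /=.
    split=> //; exists M; split; first exact: num_real.
    by move=> u.
  by move=> [u v] /= [Hu /ltW Mv] u0; exact: le_trans (Hu u0) Mv.
exists (B + 1) => s /andP[s0 st].
by have /(_ (B + 1)) := HB; rewrite ltrDl => /(_ ltr01 s); rewrite /= in_itv/= s0 st; apply.
Unshelve. all: by end_near. Qed.

(** Nothing is known of the path at negative times; composing with [Num.max s 0] gives a function
    measurable on the whole line. *)
Lemma cadlag_measurable : measurable_fun setT (fun s : R => p (Num.max s 0)).
Proof.
apply: measurable_fun_rV => i.
apply: (@measurable_comp _ _ _ _ _ _ (`[0, +oo[%classic : set R)
  (fun s => p s ord0 i) setT (fun s : R => Num.max s 0)) => //.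
- by move=> _ [s _ <-]; rewrite /= in_itv/= andbT le_max lexx orbT.
- apply: right_continuous_measurable => t t0.
  apply: (@continuous_cvg _ _ _ _ _ _ (fun v : 'rV[R]_d => v ord0 i) (p t)).
    exact: coord_continuous.
  exact: rc.
- by apply: measurable_maxr; [exact: measurable_id|exact: measurable_cst].
Qed.

Variable h : 'rV[R]_d -> R.
Hypothesis mh : measurable_fun setT h.
Hypothesis hb : forall r : R, exists C : R, forall x, `|x| <= r -> `|h x| <= C.

Lemma cadlag_integrable (t : R) :
  (@lebesgue_measure R).-integrable `[0, t]%classic (EFin \o (fun s => h (p s))).
Proof.
have [B HB] := cadlag_bounded t; have [C HC] := hb B.
apply: measurable_bounded_integrable.
- exact: measurable_itv.
- exact: itv_lty.
- apply: (@eq_measurable_fun _ _ _ _ _ (h \o (fun s => p (Num.max s 0)))).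
    by move=> s; rewrite inE/= in_itv/= => /andP[s0 _]; rewrite max_l.
  apply: measurable_funTS; apply: measurableT_comp => //.
  exact: cadlag_measurable.
- exists C; split; first exact: num_real.
  move=> M CM s; rewrite /= in_itv/= => st.
  by apply: le_trans (ltW CM); apply: HC; exact: HB.
Qed.

Definition path_integral (t : R) : R :=
  \int[lebesgue_measure]_(s in `[0, t]) h (p s).

Lemma path_integral0 : path_integral 0 = 0.
Proof.
rewrite /path_integral (_ : `[0, 0]%classic = [set 0]); first exact: Rintegral_set1.
by rewrite set_itv1.
Qed.

(** Bounds are asked only strictly before [t]: at an exit time the path may already have jumped to
    an uncontrolled position, and a single instant has measure 0. *)
Lemma path_integral_bound (c1 c2 t : R) : 0 <= t ->
  (forall u, 0 <= u < t -> c1 <= h (p u) <= c2) ->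
  c1 * t <= path_integral t <= c2 * t.
Proof.
move=> t0 H.
have mt (c : R) : \int[lebesgue_measure]_(s in `[0, t[) c = c * t.
  rewrite Rintegral_cst; last exact: measurable_itv.
  by have /= -> := fine_itv true true t0; rewrite subr0.
have ic (c : R) : (@lebesgue_measure R).-integrable `[0, t[%classic (EFin \o (fun=> c)).
  apply: measurable_bounded_integrable.
  - exact: measurable_itv.
  - exact: itv_lty.
  - exact: measurable_cst.
  - exists `|c|; split; first exact: num_real.
    by move=> M cM s _; exact: ltW.
have ih : (@lebesgue_measure R).-integrable `[0, t[%classic (EFin \o (fun s => h (p s))).
  apply: integrableS (cadlag_integrable t); [exact: measurable_itv|exact: measurable_itv|].
  by move=> s; rewrite /= !in_itv/= => /andP[-> /ltW ->].
rewrite /path_integral -Rintegral_itv_bndo_bndc//.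
apply/andP; split; rewrite -mt; apply: le_Rintegral => //.
  by move=> s; rewrite /= in_itv/= => /H/andP[].
by move=> s; rewrite /= in_itv/= => /H/andP[].
Qed.

Lemma path_integral_lip (C s t : R) : 0 <= s -> s <= t ->
  (forall u, 0 <= u <= t -> `|h (p u)| <= C) ->
  `|path_integral t - path_integral s| <= C * (t - s).
Proof.
move=> s0 st H.
rewrite /path_integral Rintegral_itvB; [|exact: cadlag_integrable|by []|by []].
have ih : (@lebesgue_measure R).-integrable `]s, t]%classic (EFin \o (fun s => h (p s))).
  apply: integrableS (cadlag_integrable t); [exact: measurable_itv|exact: measurable_itv|].
  by move=> u; rewrite /= !in_itv/= => /andP[/ltW su ->]; rewrite (le_trans s0 su).
apply: (le_trans (le_normr_Rintegral _ ih)) => //.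
apply: (@le_trans _ _ (\int[lebesgue_measure]_(u in `]s, t]) C)).
  apply: le_Rintegral => //.
  - exact: integrable_norm.
  - apply: measurable_bounded_integrable.
    + exact: measurable_itv.
    + exact: itv_lty.
    + exact: measurable_cst.
    + exists `|C|; split; first exact: num_real.
      by move=> M cM u _; exact: ltW.
  - move=> u; rewrite /= in_itv/= => /andP[/ltW su ut]; apply: H.
    by rewrite (le_trans s0 su).
rewrite Rintegral_cst; last exact: measurable_itv.
by have /= -> := fine_itv false false st.
Qed.

Lemma path_integral_right_cvg t : 0 <= t -> path_integral s @[s --> t^'+] --> path_integral t.
Proof.
move=> t0; have [B HB] := cadlag_bounded (t + 1); have [C HC] := hb B.
have C0 : 0 <= C by apply: le_trans (HC _ (HB 0 _)); rewrite ?lexx ?addr_ge0.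
apply/cvgrPdist_lt => e e0; near=> s.
have ts : t <= s by apply: ltW; near: s; exact: nbhs_right_gt.
have st1 : s <= t + 1 by apply: ltW; near: s; apply: nbhs_right_lt; rewrite ltrDl.
rewrite distrC; apply: (@le_lt_trans _ _ (C * (s - t))).
  apply: path_integral_lip => // u /andP[u0 us]; apply: HC; apply: HB.
  by rewrite u0 (le_trans us).
(* [C] may be 0, and the next step divides by this constant. *)
apply: (@le_lt_trans _ _ ((C + 1) * (s - t))).
  by rewrite ler_wpM2r ?subr_ge0// lerDl.
rewrite mulrC -ltr_pdivlMr ?ltr_wpDl// ltrBlDl.
near: s; apply: nbhs_right_lt; rewrite ltrDl divr_gt0// ltr_wpDl//.
Unshelve. all: by end_near. Qed.

End cadlag.

(** * Optional stopping at a bounded time *)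

Section optional_stopping.
Context {R : realType} {dO : measure_display} {Omega : measurableType dO}.
Variables (Q : probability Omega R) (F : R -> set (set Omega)) (M : R -> Omega -> R).
Hypothesis FT : forall t, F t setT.
Hypothesis FC : forall t A, F t A -> F t (~` A).
Hypothesis FI : forall t A B, F t A -> F t B -> F t (A `&` B).
Hypothesis Fle : forall s t, 0 <= s -> s <= t -> F s `<=` F t.
Hypothesis Fm : forall t A, 0 <= t -> F t A -> measurable A.
Hypothesis HM : is_martingale Q F M.
Hypothesis Mrc : forall w t, 0 <= t -> M s w @[s --> t^'+] --> M t w.

Lemma martingale_measurable t : 0 <= t -> measurable_fun setT (M t).
Proof.
move=> t0 _ B mB; rewrite setTI; case: HM => + _ _.
by move=> /(_ t t0 B mB)/(Fm t0).
Qed.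

Lemma martingale_integrable t : 0 <= t -> Q.-integrable setT (EFin \o M t).
Proof. by case: HM => _ + _; apply. Qed.

Variables (T : Omega -> R) (t0 C : R).
Hypothesis t00 : 0 < t0.
Hypothesis T0 : forall w, 0 <= T w <= t0.
Hypothesis Tstop : forall s, 0 < s -> s <= t0 -> F s [set w | T w < s].
Hypothesis MTC : forall w, `|M (T w) w| <= C.

(** The alternative [v = t0] serves the last grid cell, which is cut at [t0]: there [a] may exceed
    [v], but then the event is the whole space. *)
Let stopF (a v : R) : 0 < v -> v <= t0 -> a <= v \/ v = t0 -> F v [set w | T w < a].
Proof.
move=> v0 vt av; have [a0|a0] := leP a 0.
  rewrite (_ : [set w | _] = ~` setT); first exact/FC/FT.
  rewrite setCT; apply/seteqP; split=> // w /= Ta.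
  by have /andP[] := T0 w; rewrite leNgt (lt_le_trans Ta).
have [at0|ta] := leP a t0.
  apply: (Fle (ltW a0) _ (Tstop a0 at0)).
  by case: av => [//|->].
rewrite (_ : [set w | _] = setT); first exact: FT.
apply/seteqP; split=> // w _ /=.
by have /andP[_ /le_lt_trans] := T0 w; apply.
Qed.

Section step.
Variable n : nat.
Let N : R := n.+1%:R.
Let N0 : 0 < N. Proof. by rewrite ltr0n. Qed.
(** On the event [A j] the time [T] lies in the j-th grid cell, and [u j] is the upper end of that
    cell, cut at [t0]: the value taken there by the discretized time. *)
Let u (j : nat) : R := Num.min (j.+1%:R / N) t0.
Let A (j : nat) : set Omega := [set w | Num.trunc (T w * N) = j].
Let D (j : nat) : set Omega := A j `&` [set w | `|M (u j) w| <= C + 1].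

Let u0 j : 0 < u j.
Proof. by rewrite lt_min t00 andbT divr_gt0// ltr0n. Qed.

Let ut j : u j <= t0.
Proof. by rewrite ge_min lexx orbT. Qed.

Let uA j : F (u j) (A j).
Proof.
rewrite (_ : A j = [set w | T w < j.+1%:R / N] `&` ~` [set w | T w < j%:R / N]).
  have cases (a : R) : a <= j.+1%:R / N -> a <= u j \/ u j = t0.
    rewrite /u; case: (leP (j.+1%:R / N) t0) => ?; first by left.
    by right.
  apply: FI; last apply: FC; apply: stopF => //; apply: cases => //.
  by rewrite ler_pM2r ?invr_gt0// ler_nat.
have TN w : 0 <= T w * N by rewrite mulr_ge0// ?(ltW N0)//; case/andP: (T0 w).
apply/seteqP; split=> [w <- /=|w /= [H1 /negP]].
  have /andP[a1 a2] := truncn_itv (TN w); split; first by rewrite ltr_pdivlMr.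
  by apply/negP; rewrite -leNgt ler_pdivrMr.
rewrite -leNgt => H2; rewrite /A/=.
by apply: truncn_def; rewrite -ler_pdivrMr// -ltr_pdivlMr// H2.
Qed.

Let uD j : F (u j) (D j).
Proof.
apply: FI; first exact: uA.
rewrite (_ : [set w | _] = M (u j) @^-1` `[- (C + 1), C + 1]).
  case: HM => + _ _; apply; [exact: ltW|exact: measurable_itv].
by apply/seteqP; split=> w /=; rewrite in_itv/= ler_norml.
Qed.

Let mD j : measurable (D j).
Proof. by apply: (Fm _ (uD j)); exact: ltW. Qed.

Let K w : R := \sum_(j < (Num.trunc (t0 * N)).+1) M (u j) w * \1_(D j) w.
Let H w : R := \sum_(j < (Num.trunc (t0 * N)).+1) M t0 w * \1_(D j) w.
Let v w : R := Num.min (grid_above n (T w)) t0.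

Let stepE (G : nat -> R) w : \sum_(j < (Num.trunc (t0 * N)).+1) G j * \1_(D j) w =
  if `|M (v w) w| <= C + 1 then G (Num.trunc (T w * N)) else 0.
Proof.
have jlt : (Num.trunc (T w * N) < (Num.trunc (t0 * N)).+1)%N.
  by rewrite ltnS le_truncn// ler_wpM2r ?(ltW N0)//; case/andP: (T0 w).
rewrite (bigD1 (Ordinal jlt))//= big1 ?addr0; last first.
  move=> i ij; rewrite indicE memNset ?mulr0// => -[/= iE _]; move: ij.
  by rewrite -val_eqE/= iE eqxx.
rewrite indicE; case: ifPn => Hv.
  by rewrite mem_set ?mulr1//; split.
by rewrite memNset ?mulr0// => -[_ /=]; exact/negP.
Qed.

Let measurable_step (G : nat -> Omega -> R) : (forall j, measurable_fun setT (G j)) ->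
  measurable_fun setT (fun w => \sum_(j < (Num.trunc (t0 * N)).+1) G j w * \1_(D j) w).
Proof.
move=> mG; apply: measurable_sum => j; exact: measurable_funM.
Qed.

(* The truncation at C + 1 replaces uniform integrability: it is an event of the
   past at the discretized time, on which M may be exchanged with [M t0]. *)
Lemma stopping_step : exists K H : Omega -> R,
  [/\ measurable_fun setT K, measurable_fun setT H,
    forall w, K w = if `|M (v w) w| <= C + 1 then M (v w) w else 0,
    forall w, H w = if `|M (v w) w| <= C + 1 then M t0 w else 0 &
    (\int[Q]_w (K w)%:E = \int[Q]_w (H w)%:E)%E].
Proof.
exists K, H; split.
- apply: (@measurable_step (fun j => M (u j))) => j.
  by apply: martingale_measurable; exact: ltW.
- apply: (@measurable_step (fun=> M t0)) => j.
  by apply: martingale_measurable; exact: ltW.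
- by move=> w; rewrite /K (stepE (fun j => M (u j) w)).
- by move=> w; rewrite /H (stepE (fun=> M t0 w)).
have intE j (G : Omega -> R) :
    (\int[Q]_w (G w * \1_(D j) w)%:E = \int[Q]_(w in D j) (G w)%:E)%E.
  rewrite [RHS]integral_mkcond; apply: eq_integral => w _.
  rewrite patchE indicE; case: ifP => _; first by rewrite mulr1.
  by rewrite mulr0.
have intG j (G : Omega -> R) : Q.-integrable setT (EFin \o G) ->
    Q.-integrable setT (fun w => (G w * \1_(D j) w)%:E).
  move=> iG; rewrite (_ : (fun w => _) = (EFin \o G) \_ (D j)).
      have iD : Q.-integrable (D j) (EFin \o G).
      exact: (integrableS measurableT (mD j) (@subsetT _ _) iG).
    by have := iD; rewrite integrable_mkcond.
  apply/funext => w; rewrite patchE indicE; case: ifP => _; first by rewrite mulr1.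
  by rewrite mulr0.
rewrite /K /H; under eq_integral do rewrite -sumEFin.
rewrite integral_sum//; last first.
  by move=> j; apply: intG; apply: martingale_integrable; exact: ltW.
under [RHS]eq_integral do rewrite -sumEFin.
rewrite integral_sum//; last first.
  by move=> j; apply: intG; apply: martingale_integrable; exact: ltW.
(* [D j] belongs to the past at time [u j], so the martingale property applies between [u j] and
   [t0]. *)
apply: eq_bigr => j _; rewrite !intE; apply/esym.
by case: HM => _ _; apply; rewrite ?(ltW (u0 j)).
Qed.

End step.

(** Only the value at [T] is bounded, not the martingale. By right-continuity the discretized values
    are eventually within 1 of it, hence unaffected by the truncation; one side is then dominated by
    C + 1, the other by the integrable [|M t0|]. *)
Lemma optional_stopping : measurable_fun setT (fun w => M (T w) w) /\
  (\int[Q]_w (M (T w) w)%:E = \int[Q]_w (M 0 w)%:E)%E.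
Proof.
pose v n w := Num.min (grid_above n (T w)) t0.
have Mv w : M (v n w) w @[n --> \oo] --> M (T w) w.
  have /andP[Tw0 Twt] := T0 w.
  have vT n : T w <= v n w by rewrite le_min Twt andbT ltW// grid_above_gt.
  move: Twt; rewrite le_eqVlt => /predU1P[Tt|Tt].
    rewrite (_ : (fun n => M (v n w) w) = fun=> M (T w) w); first exact: cvg_cst.
    apply/funext => n; congr M; apply/eqP; rewrite eq_le vT andbT.
    by rewrite /v ge_min Tt lexx orbT.
  have /cvg_at_rightP := Mrc Tw0 (w := w); apply; split.
    by move=> n; rewrite lt_min Tt grid_above_gt.
  apply: (@squeeze_cvgr _ _ _ _ (fun=> T w) (fun n => grid_above n (T w))).
  - by apply: nearW => n; rewrite vT ge_min lexx.
  - exact: cvg_cst.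
  - exact: grid_above_cvg.
have Mvn w : \forall n \near \oo, `|M (v n w) w| <= C + 1.
  have /cvgrPdist_lt /(_ 1 ltr01) := Mv w; apply: filterS => n Hn.
  rewrite -[M (v n w) w](subrK (M (T w) w)); apply: (le_trans (ler_normD _ _)).
  by rewrite addrC lerD// distrC ltW.
have C0 : 0 <= C + 1.
  by apply: addr_ge0 => //; exact: le_trans (normr_ge0 _) (MTC point).
have [K HK] := choice (fun n => stopping_step n).
have [H HH] := choice HK.
have cK w : K n w @[n --> \oo] --> M (T w) w.
  apply: cvg_trans (Mv w); apply: near_eq_cvg.
  near=> n; have [_ _ -> _ _] := HH n; rewrite ifT//.
  by near: n; exact: Mvn.
have cH w : H n w @[n --> \oo] --> M t0 w.
  apply: cvg_near_cst.
  near=> n; have [_ _ _ -> _] := HH n; rewrite ifT//.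
  by near: n; exact: Mvn.
have mT : measurable_fun setT (fun w => M (T w) w).
  apply: (measurable_fun_cvg (h := K)) => [n|w _]; first by have [] := HH n.
  exact: cK.
split=> //.
have iC : Q.-integrable setT (EFin \o (fun=> C + 1)).
  by apply: finite_measure_integrable_cst.
have LK : (\int[Q]_w (K n w)%:E)%E @[n --> \oo] --> (\int[Q]_w (M (T w) w)%:E)%E.
  apply: (@dominated_cvg _ _ _ Q setT measurableT (fun n w => (K n w)%:E) _ _ _ _ _ iC) => //.
  - by move=> n; apply/measurable_EFinP; have [] := HH n.
  - by move=> w _; apply: cvg_EFin; [exact: nearW|exact: cK].
  - move=> n w _; rewrite lee_fin; have [_ _ -> _ _] := HH n.
    by case: ifP => //; rewrite normr0.
have iM := martingale_integrable (ltW t00).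
have LH : (\int[Q]_w (H n w)%:E)%E @[n --> \oo] --> (\int[Q]_w (M t0 w)%:E)%E.
  apply: (@dominated_cvg _ _ _ Q setT measurableT (fun n w => (H n w)%:E) _
     (fun w => `|M t0 w|%:E)) => //.
  - by move=> n; apply/measurable_EFinP; have [] := HH n.
  - by move=> w _; apply: cvg_EFin; [exact: nearW|exact: cH].
  - exact: integrable_abse iM.
  - move=> n w _; rewrite lee_fin; have [_ _ _ -> _] := HH n.
    by case: ifP => //; rewrite normr0.
have -> : (\int[Q]_w (M (T w) w)%:E = \int[Q]_w (M t0 w)%:E)%E.
  apply: (cvg_unique _ LK) => //.
  rewrite (_ : (fun n => \int[Q]_w (K n w)%:E)%E = (fun n => \int[Q]_w (H n w)%:E)%E)//.
  by apply/funext => n; have [] := HH n.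
by case: HM => _ _ /(_ 0 t0 setT); apply => //; exact: ltW.
Unshelve. all: by end_near. Qed.

End optional_stopping.

(** * Stopping times and hitting times of open sets *)

Section filtrations.
Context {R : realType} {d : nat} {dO : measure_display} {Omega : measurableType dO}.
Variable X : R -> Omega -> 'rV[R]_d.
Hypothesis mX : forall t, 0 <= t -> measurable_fun setT (X t).
Hypothesis Xcadlag : cadlag_paths X.
Local Notation F := (rc_filtration X).
Local Notation F0 := (natural_filtration X).

Lemma natural_sigma_algebra t : sigma_algebra setT (F0 t).
Proof. exact: smallest_sigma_algebra. Qed.

Lemma rc_sigma_algebra t : sigma_algebra setT (F t).
Proof.
split.
- by move=> s ts; case: (natural_sigma_algebra s).
- by move=> A FA s ts; case: (natural_sigma_algebra s) => _ + _; apply; exact: FA.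
- move=> A FA s ts; case: (natural_sigma_algebra s) => _ _; apply => n.
  exact: FA.
Qed.

Lemma rc_setC t A : F t A -> F t (~` A).
Proof. by move=> FA; rewrite -setTD; case: (rc_sigma_algebra t) => _ + _; apply. Qed.

Lemma rc_setT t : F t setT.
Proof. by rewrite -setC0; apply: rc_setC; case: (rc_sigma_algebra t). Qed.

Lemma rc_bigcup t (A : nat -> set Omega) : (forall n, F t (A n)) -> F t (\bigcup_n A n).
Proof. by move=> FA; case: (rc_sigma_algebra t) => _ _; apply. Qed.

Lemma rc_bigcap t (A : nat -> set Omega) : (forall n, F t (A n)) -> F t (\bigcap_n A n).
Proof.
move=> FA; rewrite -[X in F t X]setCK setC_bigcap; apply: rc_setC.
by apply: rc_bigcup => n; apply: rc_setC.
Qed.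

Lemma rc_setU t A B : F t A -> F t B -> F t (A `|` B).
Proof.
move=> FA FB; rewrite -bigcup2E; apply: rc_bigcup => -[|[|n]] //=.
by case: (rc_sigma_algebra t).
Qed.

Lemma rc_setI t A B : F t A -> F t B -> F t (A `&` B).
Proof.
move=> FA FB; rewrite -[X in F t X]setCK setCI; apply: rc_setC.
by apply: rc_setU; exact: rc_setC.
Qed.

Lemma rc_bigcup_rat t (P : set rat) (A : rat -> set Omega) :
  (forall q, P q -> F t (A q)) -> F t (\bigcup_(q in P) A q).
Proof.
move=> FA; rewrite bigcup_mkcond.
pose B n := if unpickle n is Some q then (if q \in P then A q else set0) else set0.
rewrite (_ : \bigcup_q _ = \bigcup_n B n).
  apply: rc_bigcup => n; rewrite /B.
  have F00 : F t set0 by case: (rc_sigma_algebra t).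
  by case: unpickle => // q; case: ifPn => // /set_mem; exact: FA.
apply/seteqP; split=> [w [q _ Aq]|w [n _]].
  exists (pickle q); first exact: Logic.I.
  rewrite /B pickleK; exact: Aq.
by rewrite /B; case: unpickle => // q Aq; exists q.
Qed.

Lemma rc_le s t : 0 <= s -> s <= t -> F s `<=` F t.
Proof.
move=> _ st A FA u tu; apply: FA; move: tu.
by rewrite /= !in_itv/= !andbT; exact: le_lt_trans.
Qed.

Lemma rc_measurable t A : 0 <= t -> F t A -> measurable A.
Proof.
move=> t0 /(_ (t + 1)); rewrite /= in_itv/= andbT ltrDl => /(_ ltr01).
apply: smallest_sub; first exact: sigma_algebra_measurable.
move=> A' [u /=]; rewrite in_itv/= => /andP[u0 _] [B mB <-].
exact: (mX u0 measurableT mB).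
Qed.

Lemma rc_preimage s t (B : set 'rV[R]_d) : 0 <= s -> s <= t -> measurable B ->
  F t (X s @^-1` B).
Proof.
move=> s0 st mB u; rewrite /= in_itv/= andbT => tu.
apply: sub_sigma_algebra; exists s.
  by rewrite /= in_itv/= s0 (le_trans st (ltW tu)).
by exists B => //; rewrite setTI.
Qed.

(** The strict inequality suits hitting times of open sets; for a right-continuous filtration it
    expresses the usual notion of stopping time. Only levels up to the horizon are constrained. *)
Definition stops (t : R) (T : Omega -> R) : Prop :=
  forall s, 0 < s -> s <= t -> F s [set w | T w < s].

Lemma stops_min t T1 T2 : stops t T1 -> stops t T2 ->
  stops t (fun w => Num.min (T1 w) (T2 w)).
Proof.
move=> H1 H2 s s0 st; rewrite (_ : [set w | _] = [set w | T1 w < s] `|` [set w | T2 w < s]).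
  by apply: rc_setU; [exact: H1|exact: H2].
by apply/seteqP; split=> w /=; rewrite gt_min => /orP.
Qed.

(** A supremum of times all below s may equal s, so a rational bound strictly below s is required as
    a witness. *)
Lemma stops_sup t (T : nat -> Omega -> R) : (forall n, stops t (T n)) ->
  (forall n w, 0 <= T n w <= t) -> stops t (fun w => sup (range (T ^~ w))).
Proof.
move=> HT T0 s s0 st.
have hs w : has_sup (range (T ^~ w)).
  split; first by exists (T 0%N w), 0%N.
  by exists t => _ [n _ <-]; case/andP: (T0 n w).
rewrite (_ : [set w | _] = \bigcup_(q in [set q : rat | 0 < ratr q :> R /\ ratr q < s])
    \bigcap_n [set w | T n w < ratr q]).
  apply: rc_bigcup_rat => q [q0 qs]; apply: rc_bigcap => n.
  apply: (rc_le (ltW q0) (ltW qs)); apply: HT => //.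
  by rewrite (le_trans (ltW qs)).
have sup0 w : 0 <= sup (range (T ^~ w)).
  have /andP[T00 _] := T0 0%N w; apply: (le_trans T00).
  by apply: ub_le_sup; [case: (hs w)|exists 0%N].
apply/seteqP; split=> [w /= Ts|w [q /= [q0 qs] Tq]].
  have [q] := rat_in_itvoo Ts; rewrite in_itv/= => /andP[q1 q2].
  exists q; first by split=> //; exact: le_lt_trans q1.
  move=> n _ /=; apply: le_lt_trans q1.
  by apply: ub_le_sup; [case: (hs w)|exists n].
apply: le_lt_trans qs; apply: ge_sup; first by case: (hs w).
by move=> _ [n _ <-]; apply: ltW; exact: Tq.
Qed.

(** Adjoining [t] caps the hitting time at the horizon and keeps the infimum over a nonempty set. *)
Definition hit (O : set 'rV[R]_d) (t : R) (w : Omega) : R :=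
  inf ([set s | 0 <= s <= t /\ O (X s w)] `|` [set t]).

Section hit.
Variables (O : set 'rV[R]_d) (t : R).
Hypothesis t0 : 0 <= t.

Let hinf w : has_inf ([set s | 0 <= s <= t /\ O (X s w)] `|` [set t]).
Proof.
split; first by exists t; right.
by exists 0 => s [[/andP[]]|->].
Qed.

Lemma hit_bounds w : 0 <= hit O t w <= t.
Proof.
apply/andP; split.
  apply: lb_le_inf; first by exists t; right.
  by move=> s [[/andP[]]|->].
by apply: ge_inf; [case: (hinf w)|right].
Qed.

Lemma hit_le w s : 0 <= s <= t -> O (X s w) -> hit O t w <= s.
Proof. by move=> st Os; apply: ge_inf; [case: (hinf w)|left]. Qed.

Lemma hit_before w s : 0 <= s -> s < hit O t w -> ~ O (X s w).
Proof.
move=> s0 sh Os; have /andP[_ ht] := hit_bounds w.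
have : hit O t w <= s by apply: hit_le => //; rewrite s0 ltW// (lt_le_trans sh).
by rewrite leNgt sh.
Qed.

Lemma hit_lt w a : hit O t w < a -> a <= t ->
  exists s, [/\ hit O t w <= s, s < a & O (X s w)].
Proof.
move=> ha at0.
have e0 : 0 < a - hit O t w by rewrite subr_gt0.
have [s] := inf_adherent e0 (hinf w).
rewrite -/(hit O t w) addrC subrK => -[[st Os]|->] sa.
  by exists s; split=> //; exact: hit_le.
by move: sa; rewrite ltNge at0.
Qed.

(** Strictly before the horizon, the infimum is approached by genuine visits to [O], from the right;
    right-continuity carries them to the limit. *)
Lemma hit_closure w : hit O t w < t -> closure O (X (hit O t w) w).
Proof.
move=> ht; have /andP[h0 _] := hit_bounds w.
have [rc _] := Xcadlag w.
move=> B XB; have := rc _ h0 B XB.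
rewrite /= /at_right /within/= => Hnear.
have [e /= e0 He] : exists2 e, 0 < e & forall s, hit O t w <= s -> s < hit O t w + e -> B (X s w).
  have [e /= e0 He] := (nbhs_ballP _ _).1 Hnear.
  exists e => // s hs se; move: hs; rewrite le_eqVlt => /predU1P[<-|hs].
    exact: nbhs_singleton XB.
  apply: (He s) => //; rewrite /ball/= distrC.
  by rewrite ger0_norm ?subr_ge0 ?(ltW hs)// ltrBlDl.
have [s [hs sa Os]] := @hit_lt w (Num.min (hit O t w + e) t)
  ltac:(by rewrite lt_min ltrDl e0) ltac:(by rewrite ge_min lexx orbT).
by exists (X s w); split=> //; apply: He => //; move: sa; rewrite lt_min => /andP[].
Qed.

(** A right-continuous path that visits an open set stays in it for a short while, hence visits it
    at a rational time; the event is a countable union. *)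
Lemma hit_stops : open O -> stops t (hit O t).
Proof.
move=> oO s s0 st.
rewrite (_ : [set w | _] = \bigcup_(q in [set q : rat | 0 <= ratr q :> R /\ ratr q < s])
    X (ratr q) @^-1` O).
  apply: rc_bigcup_rat => q [q0 qs]; apply: rc_preimage => //; first exact: ltW.
  exact: sub_sigma_algebra.
apply/seteqP; split=> [w /= hs|w [q /= [q0 qs] Oq]]; last first.
  apply: (le_lt_trans _ qs); apply: hit_le => //.
  by rewrite q0 (le_trans (ltW qs)).
have [u [hu us Ou]] := hit_lt hs st.
have u0 : 0 <= u by apply: le_trans hu; case/andP: (hit_bounds w).
have [rc _] := Xcadlag w.
have Hnear : \forall v \near u, u < v -> O (X v w).
  by apply: (rc _ u0 O); exact: open_nbhs_nbhs.
have [e /= e0 He] := (nbhs_ballP _ _).1 Hnear.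
have [q] : exists q : rat, ratr q \in `]u, Num.min (u + e) s[.
  by apply: rat_in_itvoo; rewrite lt_min us ltrDl e0.
rewrite in_itv/= lt_min => /andP[uq /andP[qe qs]].
exists q; first by split=> //; rewrite (le_trans u0)// ltW.
apply: (He (ratr q)) => //; rewrite /ball/= distrC.
by rewrite ger0_norm ?subr_ge0 ?(ltW uq)// ltrBlDl.
Qed.

End hit.

Lemma hit_mono (O O' : set 'rV[R]_d) t w : 0 <= t -> O `<=` O' -> hit O' t w <= hit O t w.
Proof.
move=> t0 OO'; rewrite leNgt; apply/negP => hlt.
have /andP[_ h't] := hit_bounds O' t0 w.
have [s [hs sa /OO' Os]] := hit_lt t0 hlt h't.
have s0 : 0 <= s by apply: le_trans hs; case/andP: (hit_bounds O t0 w).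
exact: (@hit_before _ _ t0 _ _ s0 sa Os).
Qed.

Lemma hit_mono_time (O : set 'rV[R]_d) t t' w : 0 <= t -> t <= t' -> hit O t w <= hit O t' w.
Proof.
move=> t0 tt'; rewrite leNgt; apply/negP => hlt.
have /andP[_ ht] := hit_bounds O t0 w.
have t'0 : 0 <= t' by exact: le_trans tt'.
have [s [hs sa Os]] := hit_lt t'0 hlt (le_trans ht tt').
have s0 : 0 <= s by apply: le_trans hs; case/andP: (hit_bounds O t'0 w).
exact: (@hit_before _ _ t0 _ _ s0 sa Os).
Qed.

End filtrations.

(** * Test functions with negative drift outside a neighbourhood of G *)

Section drift.
Context {R : realType} {d : nat}.
Hypothesis d0 : (0 < d)%N.
Variables (alpha : R) (lam : R -> R).
Hypothesis alpha12 : 0 < alpha < 2.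
Variables (b : 'rV[R]_d -> 'rV[R]_d) (k : 'rV[R]_d -> 'rV[R]_d -> R).
Hypothesis hclass : stable_class lam b k.
Hypothesis hlyapunov : lyapunov_stable alpha b k.
Local Notation I := (stable_op alpha b k).

Lemma stable_op_subr_cst (V : 'rV[R]_d -> R) (c : R) x : I (fun y => V y - c)%R x = I V x.
Proof.
have E : grad (fun y => V y - c) x = grad V x.
  apply/rowP => i; rewrite !mxE /partial /derive.
  set g1 := fun h : R => _; set g2 := fun h : R => h^-1 *: (_ - V x).
  suff -> : g1 = g2 by [].
  by apply/funext => h; rewrite /g1 /g2/= opprB addrA subrK.
have L : levy_int alpha k (fun y => V y - c)%R x = levy_int alpha k V x.
  apply: eq_integral => z _; congr (_ * _)%:E; rewrite /levy E; congr (_ - _).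
  by rewrite opprB addrA subrK.
rewrite [LHS]stable_opE E L; exact: esym (stable_opE alpha b k V x).
Qed.

(** Subtracting a lower bound from [V] changes neither its gradient nor its increments, hence not
    the operator. *)
Lemma lyapunov_nonneg : exists (V : 'rV[R]_d -> R) (r eps : R),
  [/\ Ck 2 V, forall x, 0 <= V x, 0 < eps, 0 <= r &
    forall x, r < `|x| -> (I V x <= (- eps)%:E)%E] /\
  exists2 K : set 'rV[R]_d, K `<=` [set x | `|x| <= r] &
    forall x, ~ K x -> (I V x <= (- eps)%:E)%E.
Proof.
have [V [CV [c Vc] [K [eps [cK eps0 HK]]]]] := hlyapunov.
have [B [_ HB]] := compact_bounded cK.
have Kr x : K x -> `|x| <= Num.max (B + 1) 0.
  by move=> Kx; rewrite le_max HB// ltrDl.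
have HV x : ~ K x -> (I (fun y => V y - c)%R x <= (- eps)%:E)%E.
  by move=> nKx; have E := stable_op_subr_cst V c x; rewrite E; exact: HK.
exists (fun y => V y - c), (Num.max (B + 1) 0), eps; split.
  split.
  - exact: (CkB CV (Ck_cst 2 c)).
  - by move=> x; rewrite subr_ge0; apply: Vc; exists x.
  - exact: eps0.
  - by rewrite le_max lexx orbT.
  - by move=> x rx; apply: HV => /Kr; rewrite leNgt rx.
exists K; [exact: Kr|exact: HV].
Qed.

(* W is V, cut off outside the ball of radius r, minus m g_(n+1): the jumps into
   G compensate the lack of drift of V inside K, uniformly in n and r. *)
Lemma drift_functions (G : set 'rV[R]_d) (U : nat -> set 'rV[R]_d) (g : nat -> 'rV[R]_d -> R) :
  compact G -> (0 < lebesgue_rV d G)%E ->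
  (forall n, G `<=` U n) -> (forall n, Ckb 2 (g n)) -> (forall n x, 0 <= g n x <= 1) ->
  (forall n x, closure (U n.+1) x -> g n x = 1) -> (forall n x, ~ U n x -> g n x = 0) ->
  exists (V : 'rV[R]_d -> R) (m eps : R), 0 < eps /\
  forall (n : nat) (r : R), exists W, [/\ Ckb 2 W, forall y, - m <= W y, forall y, W y <= V y &
    forall y, ~ U n y -> `|y| < r -> fine (I W y) <= - eps].
Proof.
move=> cG G0 GU Cg g01 g1 gU.
have [V [rK [eps [[CV V0 eps0 rK0 Vr] [K Kr VK]]]]] := lyapunov_nonneg.
have gG n x : G x -> g n x = 1.
  by move=> Gx; apply: g1; apply: subset_closure; exact: GU.
(* The closure of [U n.+1] lies in [U n], since [g n] is 1 on the former and 0 off the latter. The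
   shift of index thus gives vanishing on a whole neighbourhood of each point outside [U n]. *)
have gnear n x : ~ U n x -> \forall y \near x, g n.+1 y = 0.
  move=> nUx; have ncl : (~` closure (U n.+1)) x.
    by move=> /g1; rewrite gU// => /eqP; rewrite eq_sym oner_eq0.
  have : nbhs x (~` closure (U n.+1)).
    by apply: open_nbhs_nbhs; split=> //; apply: closed_openC; exact: closed_closure.
  by apply: filterS => y ncy; apply: gU => Uy; apply: ncy; exact: subset_closure.
(* Any point where the Lyapunov inequality holds would do; it supplies the finite tail integral. *)
pose x0 : 'rV[R]_d := const_mx (rK + 1).
have x0r : rK < `|x0|.
  apply: (@lt_le_trans _ _ `|x0 ord0 (Ordinal d0)|); last exact: coord_le_norm.
  by rewrite mxE ger0_norm ?addr_ge0// ltrDl.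
have Vtail := lyapunov_tail_int alpha12 hclass CV V0 (Vr x0 x0r).
have [C C0 HC] := lyapunov_compact_bound alpha12 hclass CV V0 rK d0 Vtail.
have [c c0 Hc] := jump_lower alpha12 hclass rK cG G0 d0.
pose m := (C + eps) / c.
have m0 : 0 <= m by rewrite divr_ge0 ?addr_ge0// ltW.
exists V, m, eps; split=> // n r.
(* The radius serves both estimates: rK + 2 for the bound on [K], and r for the drift outside
   [K]. *)
have [V' [CV' V'V V'E]] := cutoff (`|r| + (rK + 2)) CV V0.
exists (fun y => V' y - m * g n.+1 y); split.
- exact: (CkbB m CV' (Cg n.+1)).
- move=> y; have /andP[V'0 _] := V'V y; have /andP[ga gb] := g01 n.+1 y.
  have mg : m * g n.+1 y <= m by rewrite ler_piMr.
  by rewrite lerBrDr addrC (le_trans _ V'0)// subr_le0.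
- move=> y; have /andP[_ V'1] := V'V y; have /andP[ga gb] := g01 n.+1 y.
  by rewrite lerBlDr (le_trans V'1)// lerDl mulr_ge0.
move=> y nUy yr.
have g0 n' x : 0 <= g n' x by case/andP: (g01 n' x).
have E := stable_op_lin alpha12 hclass m y CV' (Cg n.+1).
apply: (@le_trans _ _ (fine (I V' y) - m * fine (I (g n.+1) y))).
  have le_eq (u v : R) : u = v -> u <= v by move=> ->.
  apply: le_eq; exact: E.
have [Ky|nKy] := pselect (K y).
  have h1 : fine (I V' y) <= C.
    apply: (HC V' CV' V'V _ y (Kr y Ky)).
    by move=> u ur; apply: V'E; apply: (le_trans ur); rewrite lerDr.
  have h2 : c <= fine (I (g n.+1) y).
    exact: (Hc _ (Cg n.+1) (g0 n.+1) (gG n.+1) y (Kr y Ky) (gnear n y nUy)).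
  apply: (@le_trans _ _ (C - m * c)); first by apply: lerB => //; exact: ler_wpM2l.
  by rewrite /m divfK ?gt_eqF// opprD addrA subrr add0r.
have h1 : fine (I V' y) <= - eps.
  apply: (lyapunov_cutoff alpha12 hclass CV CV' V'V V'E); last exact: VK.
  apply: (lt_le_trans yr); apply: (le_trans (ler_norm r)).
  by rewrite lerDl addr_ge0.
have h2 : 0 <= fine (I (g n.+1) y).
  exact: (jump_ge0 alpha hclass (Cg n.+1) (g0 n.+1) (gnear n y nUy)).
by rewrite lerBlDr (le_trans h1)// lerDl mulr_ge0.
Qed.

End drift.

(** * The associated process *)

Section process.
Context {R : realType} {d : nat} {dO : measure_display} {Omega : measurableType dO}.
Variables (alpha : R) (lam : R -> R).
Hypothesis alpha12 : 0 < alpha < 2.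
Variables (b : 'rV[R]_d -> 'rV[R]_d) (k : 'rV[R]_d -> 'rV[R]_d -> R).
Hypothesis hclass : stable_class lam b k.
Variables (X : R -> Omega -> 'rV[R]_d) (P : probability 'rV[R]_d R -> probability Omega R).
Hypothesis hprocess : associated_process X (stable_op alpha b k) P.
Variable x0 : 'rV[R]_d.
Local Notation Q := (P (dirac x0)).
Local Notation F := (rc_filtration X).

Let mX t : 0 <= t -> measurable_fun setT (X t). Proof. exact: assoc_measurable hprocess t. Qed.
Let Xcadlag : cadlag_paths X. Proof. exact: assoc_cadlag hprocess. Qed.

Definition gen (f : 'rV[R]_d -> R) (y : 'rV[R]_d) : R := fine (stable_op alpha b k f y).

Let mgen f : Ckb 2 f -> measurable_fun setT (gen f).
Proof. exact: (measurable_stable_op alpha12 hclass). Qed.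

Let gen_bound f : Ckb 2 f ->
  forall r : R, exists C : R, forall x, `|x| <= r -> `|gen f x| <= C.
Proof.
move=> Cf r; have [C _ HC] := stable_op_local_bound alpha12 hclass r Cf.
by exists C.
Qed.

Definition compensated (f : 'rV[R]_d -> R) (t : R) (w : Omega) : R :=
  f (X t w) - f (X 0 w) - path_integral (X^~ w) (gen f) t.

Lemma compensated_martingale f : Ckb 2 f -> is_martingale Q F (compensated f).
Proof. by move=> Cf; have := assoc_martingale hprocess (dirac x0) Cf. Qed.

Let rc w t : 0 <= t -> X s w @[s --> t^'+] --> X t w.
Proof. by case: (Xcadlag w) => + _; apply. Qed.

Let ll w t : 0 < t -> cvg (X s w @[s --> t^'-]).
Proof. by case: (Xcadlag w) => _; apply. Qed.

Lemma compensated_right_cvg f w t : Ckb 2 f -> 0 <= t ->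
  compensated f s w @[s --> t^'+] --> compensated f t w.
Proof.
move=> Cf t0; apply: cvgB; first apply: cvgB.
- apply: (@continuous_cvg _ _ _ _ _ _ f (X t w)); last exact: rc.
  exact: (Ck_continuous (Ckb_Ck Cf)).
- exact: cvg_cst.
- exact: (path_integral_right_cvg (@rc w) (@ll w) (mgen Cf) (gen_bound Cf)).
Qed.

(** The path is controlled only before time [u]; where it stands at [u], perhaps after a large jump,
    does not matter since [f] is bounded on the whole space. *)
Lemma compensated_bound f (r t : R) : Ckb 2 f -> 0 <= t ->
  exists B : R, forall w u, 0 <= u <= t -> (forall s, 0 <= s -> s < u -> `|X s w| <= r) ->
    `|compensated f u w| <= B.
Proof.
move=> Cf t0; have [M M0 HM] := Ckb_bounded Cf.
have [C HC] := gen_bound Cf r.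
exists (M + M + `|C| * t) => w u /andP[u0 ut] Hu.
apply: (le_trans (ler_normB _ _)); apply: lerD.
  by apply: (le_trans (ler_normB _ _)); apply: lerD.
have : - `|C| * u <= path_integral (X^~ w) (gen f) u <= `|C| * u.
  apply: (path_integral_bound (@rc w) (@ll w) (mgen Cf) (gen_bound Cf)) => //.
  move=> s /andP[s0 su]; rewrite -ler_norml.
  by apply: (le_trans (HC _ (Hu s s0 su))); exact: ler_norm.
rewrite mulNr -ler_norml => /le_trans; apply.
by rewrite ler_wpM2l.
Qed.

Lemma compensated_stopped f (r t : R) (T : Omega -> R) : Ckb 2 f -> 0 < t ->
  (forall w, 0 <= T w <= t) -> stops X t T ->
  (forall w s, 0 <= s -> s < T w -> `|X s w| <= r) ->
  measurable_fun setT (fun w => compensated f (T w) w) /\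
  (\int[Q]_w (compensated f (T w) w)%:E = 0)%E.
Proof.
move=> Cf t0 T0 Tst TX.
have [B HB] := compensated_bound r Cf (ltW t0).
have [mT ->] := @optional_stopping _ _ _ Q F (compensated f) (@rc_setT _ _ _ _ X) (@rc_setC _ _ _ _ X)
  (@rc_setI _ _ _ _ X) (@rc_le _ _ _ _ X) (rc_measurable mX) (compensated_martingale Cf)
  (fun w u u0 => @compensated_right_cvg f w u Cf u0) T t B t0 T0 Tst
  (fun w => HB w (T w) (T0 w) (TX w)).
split=> //; rewrite integral0_eq// => w _.
by rewrite /compensated path_integral0 !subrr.
Qed.

Lemma bounded_integrable (f : Omega -> R) (B : R) : measurable_fun setT f ->
  (forall w, `|f w| <= B) -> Q.-integrable setT (EFin \o f).
Proof.
move=> mf HB; apply: measurable_bounded_integrable => //.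
  by apply: (le_lt_trans (probability_le1 Q measurableT)); rewrite ltry.
exists B; split; first exact: num_real.
by move=> M BM w _; exact: le_trans (HB w) (ltW BM).
Qed.

Lemma stops_measurable (t : R) (T : Omega -> R) : (forall w, 0 <= T w <= t) ->
  stops X t T -> measurable_fun setT T.
Proof.
move=> T0 Tst; apply: (measurability _ (RGenInftyO.measurableE R)).
move=> _ [_ [a ->] <-]; rewrite setTI.
rewrite (_ : _ @^-1` _ = [set w | T w < a]); last first.
  by apply/seteqP; split=> w /=; rewrite in_itv.
have [a0|a0] := leP a 0.
  rewrite (_ : mkset _ = set0)//; apply/seteqP; split=> // w /= Ta.
  by have /andP[] := T0 w; rewrite leNgt (lt_le_trans Ta).
have [at0|ta] := leP a t; first exact: (rc_measurable mX (ltW a0) (Tst a a0 at0)).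
rewrite (_ : mkset _ = setT)//; apply/seteqP; split=> // w _ /=.
by have /andP[_ /le_lt_trans] := T0 w; apply.
Qed.

Let start : set Omega := X 0 @^-1` [set x0].

Let mset1 : measurable [set x0].
Proof.
apply: closed_measurable_rV; apply: compact_closed; first exact: norm_hausdorff.
exact: compact_set1.
Qed.

Let mstart : measurable start.
Proof. by rewrite -[start]setTI; exact: (mX (lexx 0) measurableT mset1). Qed.

Let Qstart : Q (~` start) = 0%E.
Proof.
rewrite probability_setC// (assoc_initial hprocess)// /dirac/= indicE mem_set//.
by rewrite subee.
Qed.

(** The initial law makes [X 0 = x0] only almost sure, so the null event where it fails is discarded
    before comparing pointwise. *)
Lemma le_integral_start (f g : Omega -> R) :
  Q.-integrable setT (EFin \o f) -> Q.-integrable setT (EFin \o g) ->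
  (forall w, X 0 w = x0 -> f w <= g w) ->
  (\int[Q]_w (f w)%:E <= \int[Q]_w (g w)%:E)%E.
Proof.
move=> fi gi fg; have mC := measurableC mstart.
rewrite (negligible_integral mC measurableT fi Qstart).
rewrite (negligible_integral mC measurableT gi Qstart).
rewrite setTD setCK; apply: le_integral => //.
- exact: (integrableS measurableT mstart (@subsetT _ _) fi).
- exact: (integrableS measurableT mstart (@subsetT _ _) gi).
- by move=> w; rewrite inE => ws; rewrite lee_fin; exact: fg.
Qed.

(** Dynkin's formula: up to [T] the generator is at most - eps, so eps T is at most the compensated
    value plus W(x0) - W(X_T), hence at most a variable of mean 0 plus m + v0. *)
Lemma expected_time (W : 'rV[R]_d -> R) (m v0 eps r t : R) (T : Omega -> R) :
  Ckb 2 W -> (forall y, - m <= W y) -> W x0 <= v0 -> 0 < eps -> 0 < t ->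
  (forall w, 0 <= T w <= t) -> stops X t T ->
  (forall w s, 0 <= s -> s < T w -> `|X s w| <= r /\ gen W (X s w) <= - eps) ->
  (\int[Q]_w (T w)%:E <= ((m + v0) / eps)%:E)%E.
Proof.
move=> CW Wm Wv eps0 t0 T0 Tst TX.
have TX1 w s : 0 <= s -> s < T w -> `|X s w| <= r by move=> s0 sT; case: (TX w s s0 sT).
have [mM iM] := compensated_stopped CW t0 T0 Tst TX1.
have [B HB] := compensated_bound r CW (ltW t0).
have [C HC] := gen_bound CW r.
have mT := stops_measurable T0 Tst.
have Ti : Q.-integrable setT (EFin \o T).
  by apply: (@bounded_integrable _ t) => // w; case/andP: (T0 w) => a c; rewrite ger0_norm.
have eTi : Q.-integrable setT (EFin \o (fun w => eps * T w)).
  exact: (integrableZl measurableT eps Ti).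
have Mi : Q.-integrable setT (EFin \o (fun w => compensated W (T w) w)).
  by apply: (@bounded_integrable _ B) => // w; apply: HB => // s; exact: TX1.
have ci : Q.-integrable setT (EFin \o (fun=> m + v0)).
  exact: finite_measure_integrable_cst.
have gi : Q.-integrable setT (EFin \o (fun w => compensated W (T w) w + (m + v0))).
  exact: (integrableD measurableT Mi ci).
have : (\int[Q]_w (eps * T w)%:E <= \int[Q]_w (compensated W (T w) w + (m + v0))%:E)%E.
  apply: le_integral_start => // w Xw.
  have /andP[Tw0 Twt] := T0 w.
  have /andP[_ H] : - `|C| * T w <= path_integral (X^~ w) (gen W) (T w) <= (- eps) * T w.
    apply: (path_integral_bound (@rc w) (@ll w) (mgen CW) (gen_bound CW)) => //.
    move=> s /andP[s0 sT]; have [Xr ->] := TX w s s0 sT; rewrite andbT.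
    have := le_trans (HC _ Xr) (ler_norm C).
    by rewrite ler_norml => /andP[].
  have := Wm (X (T w) w); rewrite /compensated Xw; lra.
rewrite (_ : (\int[Q]_w (compensated W (T w) w + (m + v0))%:E)%E = (m + v0)%:E); last first.
  have := integralD_EFin measurableT Mi ci => /= E.
  rewrite E iM add0e; transitivity ((m + v0)%:E * Q setT)%E; first exact: integral_cst.
  have -> : Q setT = 1%E by exact: probability_setT.
  by rewrite mule1.
under eq_integral do rewrite EFinM.
rewrite integralZl// => H.
by rewrite mulrC EFinM lee_pdivlMl.
Qed.

(** The time integral is continuous, so a discrepancy between the limit of f(X(T_n)) and the value
    of f at the limit time would show up in the mean. It will be applied with [E] the paths that
    enter every neighbourhood of G before leaving a ball; off [E] the times are eventually
    constant. *)
Lemma quasi_left_continuity (f : 'rV[R]_d -> R) (r t : R) (T : nat -> Omega -> R)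
    (E : set Omega) :
  Ckb 2 f -> (forall y, 0 <= f y <= 1) -> 0 < t ->
  (forall n w, 0 <= T n w <= t) -> (forall n, stops X t (T n)) ->
  (forall w, nondecreasing_seq (T ^~ w)) ->
  (forall w s, 0 <= s -> s < sup (range (T ^~ w)) -> `|X s w| <= r) ->
  (forall w, E w -> \forall n \near \oo, f (X (T n w) w) = 1) ->
  (forall w, ~ E w -> \forall n \near \oo, T n w = sup (range (T ^~ w))) ->
  {ae Q, forall w, E w -> f (X (sup (range (T ^~ w))) w) = 1}.
Proof.
move=> Cf f01 t0 T0 Tst Tnd SX fE nE.
pose S w := sup (range (T ^~ w)).
have ub w : has_ubound (range (T ^~ w)) by exists t => _ [n _ <-]; case/andP: (T0 n w).
have TS n w : T n w <= S w by apply: ub_le_sup => //; exists n.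
have St w : S w <= t by apply: ge_sup; [exists (T 0%N w), 0%N|move=> _ [n _ <-]; case/andP: (T0 n w)].
have S0 w : 0 <= S w <= t.
  by rewrite St andbT (le_trans _ (TS 0%N w))//; case/andP: (T0 0%N w).
have cT w : T n w @[n --> \oo] --> S w by exact: nondecreasing_cvgn.
have Sst : stops X t S by exact: stops_sup.
have [mS iS] := compensated_stopped Cf t0 S0 Sst SX.
have TX n w s : 0 <= s -> s < T n w -> `|X s w| <= r.
  by move=> s0 sT; apply: SX => //; exact: lt_le_trans (TS n w).
have [B HB] := compensated_bound r Cf (ltW t0).
pose D n w := compensated f (T n w) w - compensated f (S w) w.
have mTn n : measurable_fun setT (fun w => compensated f (T n w) w).
  by have [] := compensated_stopped Cf t0 (T0 n) (Tst n) (TX n).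
have mD n : measurable_fun setT (D n) by exact: measurable_funB.
have bT n w : `|compensated f (T n w) w| <= B by apply: HB => // s; exact: TX.
have bS w : `|compensated f (S w) w| <= B by apply: HB => // s; exact: SX.
have iD n : (\int[Q]_w (D n w)%:E = 0)%E.
  have [_ iT] := compensated_stopped Cf t0 (T0 n) (Tst n) (TX n).
  have := integralB_EFin measurableT (bounded_integrable (mTn n) (bT n))
    (bounded_integrable mS bS).
  by rewrite iT iS sube0 => <-; apply: eq_integral => w _.
(* The defect of [f] at the limit time: it is nonnegative because f <= 1, so a zero mean forces it
   to vanish almost surely. *)
pose L w := if w \in E then 1 - f (X (S w) w) else 0.
have cPI w : path_integral (X^~ w) (gen f) (T n w) @[n --> \oo] -->
    path_integral (X^~ w) (gen f) (S w).
  have [N HN] := cadlag_bounded (@rc w) (@ll w) t.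
  have [C HC] := gen_bound Cf N.
  have C0 : 0 <= C by apply: le_trans (HC (X 0 w) (HN 0 _)); rewrite ?lexx ?(ltW t0).
  apply/cvgrPdist_le => e e0.
  have /cvgrPdist_le /(_ (e / (C + 1))) H := cT w.
  have e1 : 0 < e / (C + 1) by rewrite divr_gt0// ltr_wpDl.
  near=> n.
  have Hn : `|S w - T n w| <= e / (C + 1) by near: n; exact: H.
  apply: (@le_trans _ _ (C * (S w - T n w))).
    apply: (path_integral_lip (@rc w) (@ll w) (mgen Cf) (gen_bound Cf)).
    - by case/andP: (T0 n w).
    - exact: TS.
    - by move=> u /andP[u0 uS]; apply: HC; apply: HN; rewrite u0 (le_trans uS).
  rewrite ger0_norm ?subr_ge0// in Hn.
  apply: (@le_trans _ _ ((C + 1) * (S w - T n w))).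
    by rewrite ler_wpM2r ?subr_ge0// lerDl.
  by rewrite mulrC -ler_pdivlMr// ltr_wpDl.
(* On E the stopped values of f tend to 1 instead of f (X (S w) w), while both
   martingales have mean 0. *)
have cD w : D n w @[n --> \oo] --> L w.
  rewrite /L; case: ifPn => [/set_mem Ew|/negP nEw].
    rewrite (_ : 1 - f (X (S w) w) = 1 - f (X 0 w) - path_integral (X^~ w) (gen f) (S w)
      - compensated f (S w) w); last by rewrite /compensated; ring.
    apply: cvgB; last exact: cvg_cst.
    apply: cvgB => //; apply: cvgB; last exact: cvg_cst.
    by apply: cvg_near_cst; exact: (fE w Ew).
  apply: cvg_near_cst; apply: filterS (nE w _); last by move=> Ew; apply: nEw; exact: mem_set.
  by move=> n Tn; rewrite /D Tn subrr.
have L0 w : 0 <= L w.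
  by rewrite /L; case: ifP => // _; rewrite subr_ge0; case/andP: (f01 (X (S w) w)).
(* Measurability comes from the convergence of [D n], [E] being an arbitrary set. *)
have mL : measurable_fun setT L.
  apply: (measurable_fun_cvg (h := D)) => [//|w _]; exact: cD.
have cB : Q.-integrable setT (EFin \o (fun=> B + B)).
  exact: finite_measure_integrable_cst.
have lim0 : (\int[Q]_w (D n w)%:E)%E @[n --> \oo] --> (\int[Q]_w (L w)%:E)%E.
  apply: (@dominated_cvg _ _ _ Q setT measurableT (fun n w => (D n w)%:E) _ _ _ _ _ cB) => //.
  - by move=> n; exact/measurable_EFinP.
  - by move=> w _; apply: cvg_EFin; [exact: nearW|exact: cD].
  - by move=> n w _; rewrite lee_fin (le_trans (ler_normB _ _))// lerD.
have iL : (\int[Q]_w (L w)%:E = 0)%E.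
  apply: (cvg_unique _ lim0) => //.
  by rewrite (_ : (fun n => _) = fun=> 0%E); [exact: cvg_cst|apply/funext => n; rewrite iD].
have mL' : measurable_fun setT (EFin \o L) by exact/measurable_EFinP.
have [+ _] := ae_eq_integral_abs Q measurableT mL'.
have -> : (\int[Q]_w `|(EFin \o L) w|)%E = 0%E.
  by rewrite -[RHS]iL; apply: eq_integral => w _; rewrite /= ger0_norm.
move=> /(_ erefl); apply: filterS => w /(_ Logic.I) [Lw] Ew.
move: Lw; rewrite /L mem_set// => /eqP.
by rewrite subr_eq0 => /eqP <-.
Unshelve. all: by end_near. Qed.

End process.

(* f need not be measurable: its integral is a supremum over the simple functions
   below it. *)
Lemma integral_le_ae {R : realType} {dO : measure_display} {Omega : measurableType dO}
    (Q : {measure set Omega -> \bar R}) (f g : Omega -> \bar R) :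
  (forall w, 0 <= f w)%E -> (forall w, 0 <= g w)%E -> measurable_fun setT g ->
  {ae Q, forall w, (f w <= g w)%E} -> (\int[Q]_w f w <= \int[Q]_w g w)%E.
Proof.
move=> f0 g0 mg [N [mN QN fgN]].
(* An infinite value on the null set turns the almost sure inequality into one valid everywhere. *)
pose g' w := (g w + (if w \in N then +oo else 0))%E.
have mg' : measurable_fun setT g'.
  apply: emeasurable_funD => //; apply: measurable_fun_if => //.
  apply: (measurable_fun_bool true).
  rewrite (_ : _ @^-1` _ = N) ?setTI//.
  by apply/seteqP; split=> w /=; [exact: set_mem|exact: mem_set].
have fg' w : (f w <= g' w)%E.
  rewrite /g'; case: ifPn => [_|/negP wN].
    by rewrite addey ?leey// gt_eqF// (lt_le_trans _ (g0 w))// ltNy0.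
  rewrite adde0; apply: contrapT => fg; apply: wN; apply: mem_set.
  by apply: fgN => /= H; apply: fg.
have g'0 w : (0 <= g' w)%E by apply: le_trans (f0 w) (fg' w).
apply: (@le_trans _ _ (\int[Q]_w g' w)%E).
  rewrite !ge0_integralTE//; apply: ereal_sup_le => _ [h hf <-].
  by exists h => // w; exact: le_trans (hf w) (fg' w).
rewrite (@ge0_ae_eq_integral _ _ _ Q setT g' g)//.
exists N; split=> // w /= H; apply: contrapT => wN; apply: H => _.
by rewrite /g' memNset// adde0.
Qed.

(** * Positive recurrence: passage to the limit in the neighbourhoods and the localization *)

Theorem theorem5p1 (R : realType) (d : nat) (hd : (0 < d)%N)
    (alpha : R) (halpha : 1 < alpha < 2)
    (lam : R -> R)
    (lam_gt0 : forall r, 0 <= r -> 0 < lam r)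
    (lam_nd : forall r s, 0 <= r -> r <= s -> lam r <= lam s)
    (b : 'rV[R]_d -> 'rV[R]_d) (k : 'rV[R]_d -> 'rV[R]_d -> R)
    (hclass : stable_class lam b k)
    (hlyapunov : lyapunov_stable alpha b k)
    (K0 : R)
    (hgrowth : forall x z : 'rV[R]_d,
      Num.max (dotv x (b x)) (enorm x * k x z) <= K0 * (1 + enorm x ^+ 2))
    (dO : measure_display) (Omega : measurableType dO)
    (X : R -> Omega -> 'rV[R]_d)
    (P : probability 'rV[R]_d R -> probability Omega R)
    (hprocess : associated_process X (stable_op alpha b k) P) :
  positive_recurrent X P.
Proof.
move=> G cG G0 x0.
have alpha12 : 0 < alpha < 2.
  by case/andP: halpha => /(lt_trans ltr01) -> ->.
have [U [g [[oU UU GU UG] [Cg g01 g1 gU]]]] := cutoff_sequence cG.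
have [V [m [eps [eps0 HW]]]] :=
  drift_functions hd alpha12 hclass hlyapunov cG G0 GU Cg g01 g1 gU.
have mX := assoc_measurable hprocess.
have Xcadlag := assoc_cadlag hprocess.
pose O (N : nat) := [set y : 'rV[R]_d | N%:R < `|y|].
have oO N : open (O N) by exact: open_norm_gt.
(* The horizon grows together with the ball, so that the single index N localizes in time and
   space. *)
pose t (N : nat) : R := N.+1%:R.
have t0 N : 0 < t N by rewrite ltr0n.
have t0' N : 0 <= t N by exact: ltW.
pose eta n N := hit X (U n) (t N).
pose rho N := hit X (O N) (t N).
pose S n N w := Num.min (eta n N w) (rho N w).
have eta0 n N w : 0 <= eta n N w <= t N by exact: hit_bounds.
have rho0 N w : 0 <= rho N w <= t N by exact: hit_bounds.
have S0 n N w : 0 <= S n N w <= t N.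
  have /andP[a1 a2] := eta0 n N w; have /andP[b1 b2] := rho0 N w.
  by rewrite le_min a1 b1/= ge_min a2.
have Sst n N : stops X (t N) (S n N).
  apply: stops_min; first exact: (hit_stops Xcadlag (t0' N) (oU n)).
  exact: (hit_stops Xcadlag (t0' N) (oO N)).
have SX n N w s : 0 <= s -> s < S n N w -> ~ U n (X s w) /\ `|X s w| <= N%:R.
  move=> s0; rewrite lt_min => /andP[s1 s2]; split.
    exact: (@hit_before _ _ _ _ X (U n) (t N) (t0' N) w s s0 s1).
  rewrite leNgt; apply/negP.
  exact: (@hit_before _ _ _ _ X (O N) (t N) (t0' N) w s s0 s2).
have UUn n n' : (n <= n')%N -> U n' `<=` U n.
  elim: n' => [|n' IH]; first by rewrite leqn0 => /eqP ->.
  rewrite leq_eqVlt => /predU1P[->//|]; rewrite ltnS => /IH.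
  exact: subset_trans (UU n').
have etan n n' N w : (n <= n')%N -> eta n N w <= eta n' N w.
  by move=> nn'; apply: hit_mono => //; exact: UUn.
have Snn n n' N N' w : (n <= n')%N -> (N <= N')%N -> S n N w <= S n' N' w.
  move=> nn' NN'; have tt : t N <= t N' by rewrite ler_nat ltnS.
  rewrite le_min; apply/andP; split.
    apply: (@le_trans _ _ (eta n N w)); first by rewrite ge_min lexx.
    apply: (@le_trans _ _ (eta n' N w)); first exact: etan.
    exact: hit_mono_time.
  apply: (@le_trans _ _ (rho N w)); first by rewrite ge_min lexx orbT.
  apply: (@le_trans _ _ (hit X (O N) (t N') w)); first exact: hit_mono_time.
  apply: hit_mono => // y /=; apply: le_lt_trans.
  by rewrite ler_nat.
have mS n N : measurable_fun setT (S n N).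
  exact: (stops_measurable hprocess (S0 n N) (Sst n N)).
pose C := ((m + V x0) / eps)%:E : \bar R.
have ES n N : (\int[P (dirac x0)]_w (S n N w)%:E <= C)%E.
  (* Before [S n N] the path stays in the closed ball of radius N, strictly inside the cutoff radius
     N + 1. *)
  have [W [CW Wm WV IW]] := HW n (t N).
  apply: (expected_time alpha12 hclass hprocess CW Wm (WV x0) eps0 (t0 N) (S0 n N) (Sst n N)
    (r := N%:R)).
  move=> w s s0 sS; have [nU Xr] := SX n N w s s0 sS; split=> //.
  by apply: IW => //; rewrite (le_lt_trans Xr)// ltr_nat.
pose Z N w := sup (range (fun n => S n N w)).
have SZ n N w : S n N w <= Z N w.
  apply: ub_le_sup; last by exists n.
  by exists (t N) => _ [j _ <-]; case/andP: (S0 j N w).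
have Zle N w (c : R) : (forall n, S n N w <= c) -> Z N w <= c.
  by move=> H; apply: ge_sup; [exists (S 0%N N w), 0%N|move=> _ [n _ <-]].
have qlc : {ae P (dirac x0), forall w, forall j N, (forall n, eta n N w < rho N w) ->
    g j (X (Z N w) w) = 1}.
  (* The exceptional null set must not depend on [j] or [N]; the latter will be chosen according to
     the path. *)
  apply/ae_foralln => j; apply/ae_foralln => N.
  refine (quasi_left_continuity alpha12 hclass hprocess x0 (T := fun n => S n N)
    (E := [set w | forall n, eta n N w < rho N w]) (r := N%:R) (Cg j) (g01 j) (t0 N)
    (fun n => S0 n N) (fun n => Sst n N) _ _ _ _).
  - by move=> w n n' nn'; exact: Snn.
  - move=> w s s0 /sup_gt[|_ [n _ <-] sS]; first by exists (S 0%N N w), 0%N.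
    by have [] := SX n N w s s0 sS.
  (* For n > j the path at time [S n N] is in the closure of [U n], hence in that of [U j.+1], where
     [g j] is 1. *)
  - move=> w Ew; exists j.+1 => // n /= jn.
    have Se : S n N w = eta n N w by rewrite /S min_l// ltW.
    rewrite Se; apply: g1; apply: (closure_subset (UUn _ _ jn)).
    apply: hit_closure => //; apply: (lt_le_trans (Ew n)).
    by case/andP: (rho0 N w).
  (* Once some neighbourhood is not reached before the exit from the ball, neither are the smaller
     ones: the times are stationary at [rho N w]. *)
  - move=> w /existsNP[n0 /negP]; rewrite -leNgt => rn0.
    have rn n : (n0 <= n)%N -> S n N w = rho N w.
      by move=> n0n; rewrite /S min_r// (le_trans rn0)// etan.
    exists n0 => // n /= n0n; apply/eqP; rewrite eq_le; apply/andP; split.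
      exact: SZ.
    by rewrite rn//; apply: Zle => n'; rewrite ge_min lexx orbT.
(* [S] is nondecreasing in both indices, so the diagonal captures the double limit and monotone
   convergence keeps the bound [C]. *)
pose sigma w := ereal_sup (range (fun N => (S N N w)%:E)).
have Snd w : nondecreasing_seq (fun N => (S N N w)%:E).
  by move=> n n' nn'; rewrite lee_fin; exact: Snn.
have csigma w : (S N N w)%:E @[N --> \oo] --> sigma w.
  exact: ereal_nondecreasing_cvgn.
have Ssigma N w : ((S N N w)%:E <= sigma w)%E by apply: ereal_sup_ubound; exists N.
have sigma0 w : (0 <= sigma w)%E.
  by apply: le_trans (Ssigma 0%N w); rewrite lee_fin; case/andP: (S0 0%N 0%N w).
have mSE N : measurable_fun setT (fun w => (S N N w)%:E) by exact/measurable_EFinP.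
have msigma : measurable_fun setT sigma.
  exact: (emeasurable_fun_cvg (fun N w => (S N N w)%:E)).
have Esigma : (\int[P (dirac x0)]_w sigma w <= C)%E.
  rewrite (eq_integral (fun w => limn (fun N => (S N N w)%:E))); last first.
    by move=> w _; apply/esym/cvg_lim => //; exact: csigma.
  rewrite monotone_convergence//.
  - apply: lime_le; last by apply: nearW => N; exact: ES.
    apply: ereal_nondecreasing_is_cvgn => n n' nn'.
    apply: ge0_le_integral => //.
    + by move=> w _; rewrite lee_fin; case/andP: (S0 n n w).
    + by move=> w _; exact: Snd.
  - by move=> N w _; rewrite lee_fin; case/andP: (S0 N N w).
apply: (@le_lt_trans _ _ (\int[P (dirac x0)]_w sigma w)%E); last first.
  by apply: le_lt_trans Esigma _; rewrite ltry.
apply: integral_le_ae => //.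
  by move=> w; apply: le_ereal_inf_tmp => _ [s [s0 _] <-]; rewrite lee_fin.
apply: filterS qlc => w Hw.
have [->|sfin] := eqVneq (sigma w) +oo%E; first exact: leey.
have {}sfin : sigma w \is a fin_num by rewrite ge0_fin_numE// lt_neqAle sfin leey.
pose r := fine (sigma w).
have rE : r%:E = sigma w by exact: fineK.
have r0 : 0 <= r by exact: fine_ge0.
have [rcw llw] := Xcadlag w.
have [B HB] := cadlag_bounded rcw llw (r + 1).
(* The ball contains the path up to time r + 1 and the horizon is at least r + 1; the exit time
   [rho N w] is then strictly later than [sigma w]. *)
pose N := (Num.bound `|B|%R + Num.bound `|(r + 1)%R|%R)%N.
have BN : B <= N%:R.
  apply: (le_trans (ler_norm _)); apply: ltW; apply: (lt_le_trans (archi_boundP (normr_ge0 B))).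
  by rewrite ler_nat leq_addr.
have rN : r + 1 <= t N.
  apply: (le_trans (ler_norm _)); apply: ltW.
  apply: (lt_le_trans (archi_boundP (normr_ge0 (r + 1)))).
  by rewrite ler_nat leqW// leq_addl.
have rrho : r + 1 <= rho N w.
  rewrite leNgt; apply/negP => H.
  have [s [hs sr]] := hit_lt (t0' N) H rN.
  apply/negP; rewrite -leNgt; apply: le_trans BN; apply: HB.
  by rewrite (ltW sr) andbT (le_trans _ hs)//; case/andP: (rho0 N w).
have Sr n : S n N w <= r.
  rewrite -lee_fin rE; apply: le_trans (Ssigma (maxn n N) w).
  by rewrite lee_fin; apply: Snn; rewrite ?leq_maxl ?leq_maxr.
(* The minimum of the two times is at most r, which is below the exit time, so it is the hitting
   time that comes first. *)
have Ew n : eta n N w < rho N w.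
  have rr : r < rho N w by apply: lt_le_trans rrho; rewrite ltrDl.
  by have := le_lt_trans (Sr n) rr; rewrite gt_min ltxx orbF.
(* A nonzero value of [g j] places the point in [U j], and the sets [U j] shrink to [G]. *)
have GZ : G (X (Z N w) w).
  apply: UG => j; apply: contrapT => /gU; rewrite (Hw j N Ew) => /eqP.
  by rewrite oner_eq0.
apply: (@le_trans _ _ (Z N w)%:E); last by rewrite -rE lee_fin; exact: Zle.
apply: ereal_inf_lbound; exists (Z N w) => //; split; last by move=> /(_ GZ).
by apply: le_trans (SZ 0%N N w); case/andP: (S0 0%N N w).
Qed.
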